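(* Let $\nu(dx)=\nu(|x|)\,dx$ be an infinite isotropic unimodal Lévy measure on $\mathbb R^d$, that is, $(0,\infty)\ni r\mapsto\nu(r)$ is nonincreasing, $\nu(\mathbb R^d\setminus\{0\})=\infty$ and $\int_{\mathbb R^d\setminus\{0\}}(|x|^2\wedge1)\,\nu(dx)<\infty$. Let $\psi(\xi)=\int_{\mathbb R^d}(1-\cos\langle\xi,x\rangle)\,\nu(dx)$, and write $\psi(r)=\psi(\xi)$ for $r=|\xi|$. Let $0<\underline\alpha\le\overline\alpha<2$, assume $0\not\equiv\psi\in\mathrm{WLSC}(\underline\alpha,\underline c)\cap\mathrm{WUSC}(\overline\alpha,\overline c)$ and $d>\overline\alpha$, and let $$p_t(x)=(2\pi)^{-d}\int_{\mathbb R^d}e^{i\langle\xi,x\rangle}e^{-t\psi(\xi)}\,d\xi,\qquad t>0,\ x\in\mathbb R^d.$$ Then for every $0<\beta<(d-\overline\alpha)/\overline\alpha$ there exist constants $c_1,c_2>0$ such that for all $t>0$ and $x\in\mathbb R^d\setminus\{0\}$, $$\int_{\mathbb R^d}p_t(y-x)\,\psi(|y|^{-1})^{-\beta-1}|y|^{-d}\,dy\le c_1\,\psi(|x|^{-1})^{-\beta-1}|x|^{-d}$$ and $$\int_{\mathbb R^d}\tilde p_t(x,y)\,\psi(|y|^{-1})^{-\beta-1}|y|^{-d}\,dy\le c_1\,\psi(|x|^{-1})^{-\beta-1}|x|^{-d},$$ where $\tilde p$ is the Schrödinger perturbation of $p_t(x,y)=p_t(y-x)$ by $q(x)=c_2\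,\psi(1/|x|)$.
   Context: For $\varphi:[0,\infty)\to[0,\infty)$: $\varphi\in\mathrm{WLSC}(\underline\alpha,\underline c)$ (with $\underline c\in(0,1]$) means $\varphi(\lambda\theta)\ge\underline c\,\lambda^{\underline\alpha}\varphi(\theta)$ for all $\lambda\ge1$, $\theta>0$; $\varphi\in\mathrm{WUSC}(\overline\alpha,\overline c)$ (with $\overline c\in[1,\infty)$) means $\varphi(\lambda\theta)\le\overline c\,\lambda^{\overline\alpha}\varphi(\theta)$ for all $\lambda\ge1$, $\theta>0$. The function $\psi$ is radial, and the scaling conditions refer to $r\mapsto\psi(r)$ on $[0,\infty)$. Under these assumptions $p_t$ is a convolution semigroup of probability densities. For $q\ge0$, the Schrödinger perturbation of $p$ by $q$ is $\tilde p=\sum_{n=0}^\infty p^{(n)}$, where $p^{(0)}_t(x,y)=p_t(x,y)$ and $$p^{(n)}_t(x,y)=\int_0^t\int_{\mathbb R^d}p_s(x,z)\,q(z)\,p^{(n-1)}_{t-s}(z,y)\,dz\,ds,\qquad n\ge1.$$ *)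

(* Defs.v *)
From HB Require Import structures.
From mathcomp Require Import all_boot all_order all_algebra.
From mathcomp Require Import complex.
From mathcomp Require Import all_classical all_reals all_analysis.

Set Implicit Arguments.
Unset Strict Implicit.
Unset Printing Implicit Defensive.

Import Order.TTheory GRing.Theory Num.Theory.
Import numFieldNormedType.Exports.

Local Open Scope classical_set_scope.
Local Open Scope ring_scope.

(* R^n is the type of n-tuples, which the library equips with the product
   (Borel) sigma-algebra. *)
Notation Rn R n := (n.-tuple (measurableTypeR R)).

Section vectors.
Context {R : realType} {n : nat}.
Implicit Types x y : Rn R n.

Definition subv x y : Rn R n := [tuple (tnth x i - tnth y i : R) | i < n].

Definition dotv x y : R := \sum_(i < n) (tnth x i : R) * tnth y i.

Definition normv x : R := Num.sqrt (dotv x x).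

Definition zerov : Rn R n := [tuple (0 : R) | i < n].

(* The vector r e_1. *)
Definition axisv (r : R) : Rn R n :=
  [tuple (if val i == 0%N then r else 0 : R) | i < n].

End vectors.

(* Lebesgue measure on R^n, by induction on n: on R^0 it is the unit mass on
   the empty tuple, and on R^(n+1) it is the image of the product of the
   Lebesgue measures on R and R^n under (a, x) |-> a :: x. *)

Section lebesgue_succ.
Context {R : realType} {n : nat}.

Definition consv (u : measurableTypeR R * Rn R n) : Rn R n.+1 :=
  [the n.+1.-tuple (measurableTypeR R) of u.1 :: u.2].

Definition tailv (x : Rn R n.+1) : Rn R n := [tuple of behead x].

Lemma measurable_consv : measurable_fun setT consv.
Proof. exact: (@measurable_cons _ _ _ (measurableTypeR R)). Qed.

Lemma measurable_tailv : measurable_fun setT tailv.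
Proof. exact: (@measurable_behead _ (measurableTypeR R)). Qed.

Variable mu : {sigma_finite_measure set (Rn R n) -> \bar R}.

Definition lebesgue_succ : set (Rn R n.+1) -> \bar R :=
  pushforward ((@lebesgue_measure R) \x mu)%E consv.

Let prod_mu : measure (measurableTypeR R * Rn R n)%type R :=
  ((@lebesgue_measure R) \x mu)%E.

Let measurable_consv_preimage A :
  measurable A -> measurable (consv @^-1` A).
Proof. by move=> mA; rewrite -[X in measurable X]setTI; exact: measurable_consv. Qed.

Let lebesgue_succ0 : lebesgue_succ set0 = 0%E.
Proof. by rewrite /lebesgue_succ /pushforward preimage_set0 measure0. Qed.

Let lebesgue_succ_ge0 A : (0 <= lebesgue_succ A)%E.
Proof. exact: (measure_ge0 prod_mu). Qed.

Let lebesgue_succ_sigma_additive : semi_sigma_additive lebesgue_succ.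
Proof.
move=> F mF tF mUF; rewrite /lebesgue_succ /pushforward preimage_bigcup.
apply: (@measure_semi_sigma_additive _ _ _ prod_mu).
- by move=> k; exact: measurable_consv_preimage.
- apply/trivIsetP => /= i j _ _ ij; rewrite -preimage_setI.
  by move/trivIsetP : tF => /(_ _ _ _ _ ij) ->//; rewrite preimage_set0.
- by rewrite -preimage_bigcup; exact: measurable_consv_preimage.
Qed.

HB.instance Definition _ := isMeasure.Build _ _ _ lebesgue_succ
  lebesgue_succ0 lebesgue_succ_ge0 lebesgue_succ_sigma_additive.

Let lebesgue_succ_sigma_finite : sigma_finite setT lebesgue_succ.
Proof.
have /sigma_finiteP[F [TF ndF Foo]] := sigma_finiteT (@lebesgue_measure R).
have /sigma_finiteP[G [TG ndG Goo]] := sigma_finiteT mu.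
pose unconsv (x : Rn R n.+1) := (tnth x ord0, tailv x).
have munconsv : measurable_fun setT unconsv.
  apply/measurable_fun_pairP; split; first exact: measurable_tnth.
  exact: measurable_tailv.
have consvK u : unconsv (consv u) = u.
  by case: u => a x; rewrite /unconsv/=; congr (_, _); apply: val_inj.
exists (fun k => unconsv @^-1` (F k `*` G k)).
  apply/seteqP; split => // x _.
  have [i _ Fi] : (\bigcup_i F i) (tnth x ord0) by rewrite -TF.
  have [j _ Gj] : (\bigcup_j G j) (tailv x) by rewrite -TG.
  exists (maxn i j) => //; split => /=.
  - by move: Fi; exact/subsetPset/ndF/leq_maxl.
  - by move: Gj; exact/subsetPset/ndG/leq_maxr.
move=> k; have [mF Fk] := Foo k; have [mG Gk] := Goo k; split.
  by rewrite -[X in measurable X]setTI; apply: munconsv => //; exact: measurableX.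
rewrite /lebesgue_succ /pushforward -comp_preimage.
rewrite (_ : _ \o _ = id); last by apply/funext => u /=; rewrite consvK.
by rewrite preimage_id product_measure1E// lte_mul_pinfty// ge0_fin_numE.
Qed.

HB.instance Definition _ := Measure_isSigmaFinite.Build _ _ _ lebesgue_succ
  lebesgue_succ_sigma_finite.

End lebesgue_succ.

Fixpoint lebesgue_Rn (R : realType) (n : nat) :
    {sigma_finite_measure set (Rn R n) -> \bar R} :=
  if n is m.+1 then lebesgue_succ (lebesgue_Rn R m)
  else \d_([tuple] : Rn R 0).

Section definitions.
Context {R : realType}.
Implicit Types (d : nat) (phi nur : R -> R).

(* phi stands for a function [0, oo) -> [0, oo). *)
Definition WLSC (a c : R) phi :=
  [/\ 0 < c, c <= 1 & forall lambda theta : R, 1 <= lambda -> 0 < theta ->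
    c * lambda `^ a * phi theta <= phi (lambda * theta)].

Definition WUSC (a c : R) phi :=
  1 <= c /\ forall lambda theta : R, 1 <= lambda -> 0 < theta ->
    phi (lambda * theta) <= c * lambda `^ a * phi theta.

(* nu is the measure nur(|x|) dx, where only the values of nur on (0, oo)
   matter. *)
Definition infinite_isotropic_unimodal_levy d
    (nu : {measure set (Rn R d) -> \bar R}) nur :=
  [/\ forall r, 0 < r -> 0 <= nur r,
      forall r s, 0 < r -> r <= s -> nur s <= nur r,
      forall A, measurable A ->
        nu A = (\int[lebesgue_Rn R d]_(x in A) (nur (normv x))%:E)%E,
      nu (~` [set zerov]) = +oo%E &
      (\int[nu]_(x in ~` [set zerov])
        (Num.min (normv x ^+ 2) 1)%:E < +oo)%E].

Definition levy_exponent d (nu : {measure set (Rn R d) -> \bar R})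
    (xi : Rn R d) : R :=
  \int[nu]_x (1 - cos (dotv xi x)).

(* psi(r) = psi(xi) for r = |xi|: for a radial function Psi and r >= 0, the
   value of Psi on the sphere of radius r, read at r e_1. *)
Definition radial_profile d (Psi : Rn R d -> R) (r : R) : R := Psi (axisv r).

Definition cexp_i (theta : R) : R[i] := Complex (cos theta) (sin theta).

Definition complex_integral d (f : Rn R d -> R[i]) : R[i] :=
  Complex (\int[lebesgue_Rn R d]_x complex.Re (f x))
          (\int[lebesgue_Rn R d]_x complex.Im (f x)).

(* The inverse Fourier transform of exp (- t Psi). It is real because Psi is
   even; complex.Re only casts it from R[i] to R. *)
Definition heat_density d (Psi : Rn R d -> R) (t : R) (x : Rn R d) : R :=
  complex.Re (real_complex R ((2 * pi) ^- d) *
    complex_integral (fun xi =>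
      cexp_i (dotv xi x) * real_complex R (expR (- t * Psi xi)))).

Fixpoint schrodinger_term d (p : R -> Rn R d -> Rn R d -> R)
    (q : Rn R d -> R) (n : nat) (t : R) (x y : Rn R d) : \bar R :=
  if n is m.+1 then
    (\int[lebesgue_measure]_(s in `]0%R, t[) \int[lebesgue_Rn R d]_z
      ((p s x z * q z)%:E * schrodinger_term p q m (t - s)%R z y))%E
  else (p t x y)%:E.

(* The terms are extended real numbers: for q >= 0 they may be infinite. *)
Definition schrodinger d (p : R -> Rn R d -> Rn R d -> R)
    (q : Rn R d -> R) (t : R) (x y : Rn R d) : \bar R :=
  (\sum_(0 <= n <oo) schrodinger_term p q n t x y)%E.

End definitions.

(* Main.v *)
Require Import Defs.
From HB Require Import structures.
From mathcomp Require Import all_boot all_order all_algebra.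
From mathcomp Require Import all_classical all_reals all_analysis.
From mathcomp Require Import measurable_realfun.
From mathcomp Require Import ring lra.

Set Implicit Arguments.
Unset Strict Implicit.
Unset Printing Implicit Defensive.

Import Order.TTheory GRing.Theory Num.Theory.
Import numFieldNormedType.Exports.

Local Open Scope classical_set_scope.
Local Open Scope ring_scope.

(* With [g u = u `^ (beta - 1)] put
     [H x = \int_0^oo g u * (\int_u^oo p_v x dv) du] and
     [G x = \int_0^oo g u * p_u x du].
   By the semigroup property, [P_t H + \int_0^t P_s G ds <= H].  Two estimates
   of the heat kernel turn this into the theorem.  First, [p_t] is radially
   nonincreasing, because [exp (- t psi)] is a limit of transforms of
   exponential series in convolutions of unimodal functions; so
   [p_t x <= C |x|^-d], and bounding the Fourier integral with the weak
   scaling of [psi] gives [p_t x <= C |x|^-d (t psi (1/|x|))^-kappa] for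
   [t psi (1/|x|) >= 1], where [beta + 1 < kappa < d / aup].  Second,
   [p_t x >= c |x|^-d] when [t psi (1/|x|)] lies in some [[A, 2 A]].
   Integrating in time, [H] is comparable with
   [h = psi (1/|x|)^(- beta - 1) |x|^-d] and [G >= c' psi (1/|x|) h], hence
   [q H <= G] for small [c2].  Induction on the partial sums of the perturbation
   series then shows that the perturbed kernel applied to [H] is at most [H]. *)

(** * Vectors and Lebesgue measure on R^n *)

(** Iterating the perturbation requires an inequality without loss of constants, and [H] is built to
    satisfy one: [P_t] shifts the tail integral from [u] to [u + t], so what [H] loses under [P_t]
    is a time integral of [P_s G]. The comparison of [H] with [h] is made once, at the end, and its
    cost becomes [c1]. The window for [kappa] carries the hypothesis on [beta]: the tail bound makes
    [v^beta * p_v x] integrable for large [v] when [kappa > beta + 1], while the bound of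
    [exp (- t psi)] by a multiple of [|xi|^(- aup kappa)] near the origin is integrable when
    [aup kappa < d]. Such a [kappa] exists exactly when [beta < (d - aup) / aup]. Geometry enters
    through the reflection exchanging two points: it preserves Lebesgue measure, gives the rotation
    invariance of integrals, and shows that convolution preserves unimodality. Fourier inversion is
    replaced by Gaussian cutoffs: the transform of a cut-off density is a Gaussian average of
    [exp (- t psi)], which yields mass at most one and the semigroup law as the cutoff is
    removed. *)

Section vectors.
Context {R : realType} {n : nat}.
Implicit Types x y z : Rn R n.

Definition plusv x y : Rn R n := [tuple (tnth x i + tnth y i : R) | i < n].

Definition scalev (r : R) x : Rn R n := [tuple (r * tnth x i : R) | i < n].

Lemma tnth_subv x y i : tnth (subv x y) i = (tnth x i - tnth y i : R).
Proof. by rewrite tnth_mktuple. Qed.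

Lemma tnth_plusv x y i : tnth (plusv x y) i = (tnth x i + tnth y i : R).
Proof. by rewrite tnth_mktuple. Qed.

Lemma tnth_scalev r x i : tnth (scalev r x) i = (r * tnth x i : R).
Proof. by rewrite tnth_mktuple. Qed.

Lemma tnth_zerov i : tnth (@zerov R n) i = (0 : R).
Proof. by rewrite tnth_mktuple. Qed.

Definition tnthE := (tnth_subv, tnth_plusv, tnth_scalev, tnth_zerov).

Lemma dotvC x y : dotv x y = dotv y x.
Proof. by apply: eq_bigr => i _; rewrite mulrC. Qed.

Lemma dotvDl x y z : dotv (plusv x y) z = dotv x z + dotv y z.
Proof. by rewrite -big_split; apply: eq_bigr => i _ /=; rewrite tnthE mulrDl. Qed.

Lemma dotvBl x y z : dotv (subv x y) z = dotv x z - dotv y z.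
Proof. by rewrite -sumrB; apply: eq_bigr => i _ /=; rewrite tnthE mulrBl. Qed.

Lemma dotvZl r x z : dotv (scalev r x) z = r * dotv x z.
Proof. by rewrite mulr_sumr; apply: eq_bigr => i _ /=; rewrite tnthE mulrA. Qed.

Lemma dotvDr x y z : dotv z (plusv x y) = dotv z x + dotv z y.
Proof. by rewrite dotvC dotvDl !(dotvC z). Qed.

Lemma dotvBr x y z : dotv z (subv x y) = dotv z x - dotv z y.
Proof. by rewrite dotvC dotvBl !(dotvC z). Qed.

Lemma dotvZr r x z : dotv z (scalev r x) = r * dotv z x.
Proof. by rewrite dotvC dotvZl (dotvC z). Qed.

Lemma dotv0l x : dotv zerov x = 0.
Proof. by apply: big1 => i _; rewrite tnthE mul0r. Qed.

Lemma dotv0r x : dotv x zerov = 0.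
Proof. by rewrite dotvC dotv0l. Qed.

Definition dotvE := (dotvDl, dotvDr, dotvBl, dotvBr, dotvZl, dotvZr, dotv0l, dotv0r).

Lemma dotv_ge0 x : 0 <= dotv x x.
Proof. by apply: sumr_ge0 => i _; rewrite -expr2 sqr_ge0. Qed.

Lemma dotv_eq0 x : dotv x x = 0 -> x = zerov.
Proof.
move=> /eqP; rewrite psumr_eq0; last by move=> i _; rewrite -expr2 sqr_ge0.
move=> /allP x0; apply: eq_from_tnth => i; rewrite tnthE.
by have := x0 i (mem_index_enum i); rewrite /= -expr2 sqrf_eq0 => /eqP.
Qed.

Lemma normv_ge0 x : 0 <= normv x. Proof. exact: sqrtr_ge0. Qed.

Lemma normv_sqr x : normv x ^+ 2 = dotv x x.
Proof. by rewrite sqr_sqrtr// dotv_ge0. Qed.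

Lemma normv0 : normv (@zerov R n) = 0.
Proof. by rewrite /normv dotv0l sqrtr0. Qed.

Lemma normv_eq0 x : normv x = 0 -> x = zerov.
Proof. by move=> x0; apply: dotv_eq0; rewrite -normv_sqr x0 expr0n. Qed.

Lemma normv_gt0 x : x <> zerov -> 0 < normv x.
Proof.
by move=> x0; rewrite lt_def normv_ge0 andbT; apply/eqP => /normv_eq0.
Qed.

Lemma ler_normv x y : (normv x <= normv y) = (dotv x x <= dotv y y).
Proof. by rewrite /normv ler_psqrt// nnegrE dotv_ge0. Qed.

Lemma normvZ r x : normv (scalev r x) = `|r| * normv x.
Proof.
by rewrite /normv !dotvE mulrA -expr2 sqrtrM ?sqr_ge0// sqrtr_sqr.
Qed.

Lemma plusvK x y : subv (plusv x y) y = x.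
Proof. by apply: eq_from_tnth => i; rewrite !tnthE addrK. Qed.

Lemma plusvC x y : plusv x y = plusv y x.
Proof. by apply: eq_from_tnth => i; rewrite !tnthE addrC. Qed.

Lemma subv_zerov x : subv x zerov = x.
Proof. by apply: eq_from_tnth => i; rewrite !tnthE subr0. Qed.

Lemma subvN x y : subv x y = plusv x (scalev (-1) y).
Proof. by apply: eq_from_tnth => i; rewrite !tnthE mulN1r. Qed.

Lemma dotv_CauchySchwarz x y : dotv x y ^+ 2 <= dotv x x * dotv y y.
Proof.
have [y0|y0] := eqVneq (dotv y y) 0.
  by rewrite y0 (dotv_eq0 y0) dotv0r expr0n/= mulr0.
have yy : 0 < dotv y y by rewrite lt_def y0 dotv_ge0.
have := dotv_ge0 (subv (scalev (dotv y y) x) (scalev (dotv x y) y)).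
rewrite !dotvE (dotvC y x).
rewrite (_ : _ - _ = dotv y y * (dotv x x * dotv y y - dotv x y ^+ 2)); last by ring.
by rewrite pmulr_rge0// subr_ge0.
Qed.

Lemma measurable_dotv d (T : measurableType d) (D : set T) (f g : T -> Rn R n) :
  measurable_fun D f -> measurable_fun D g ->
  measurable_fun D (fun t => dotv (f t) (g t)).
Proof.
move=> mf mg; apply: measurable_sum => i.
apply: measurable_funM.
  exact: (measurableT_comp (measurable_tnth i) mf).
exact: (measurableT_comp (measurable_tnth i) mg).
Qed.

Lemma measurable_normv d (T : measurableType d) (D : set T) (f : T -> Rn R n) :
  measurable_fun D f -> measurable_fun D (fun t => normv (f t)).
Proof.
move=> mf; apply: (measurableT_comp (f := @Num.sqrt R)).
  by apply: continuous_measurable_fun; exact: sqrt_continuous.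
exact: measurable_dotv.
Qed.

Lemma measurable_mktuple d (T : measurableType d) (f : 'I_n -> T -> R) :
  (forall i, measurable_fun setT (f i)) ->
  measurable_fun setT (fun t => [tuple f i t | i < n] : Rn R n).
Proof.
move=> mf; apply/measurable_fun_tnthP => i.
have -> : (@tnth n (measurableTypeR R))^~ i \o (fun t => [tuple f j t | j < n] : Rn R n) = f i.
  by apply/funext => t /=; rewrite tnth_mktuple.
exact: mf.
Qed.

Lemma measurable_tnthT d (T : measurableType d) (f : T -> Rn R n) i :
  measurable_fun setT f -> measurable_fun setT (fun t => tnth (f t) i : R).
Proof. by move=> mf; exact: (measurableT_comp (measurable_tnth i) mf). Qed.

Lemma measurable_plusv d (T : measurableType d) (f g : T -> Rn R n) :
  measurable_fun setT f -> measurable_fun setT g ->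
  measurable_fun setT (fun t => plusv (f t) (g t)).
Proof.
move=> mf mg; apply: measurable_mktuple => i; apply: measurable_funD;
  exact: measurable_tnthT.
Qed.

Lemma measurable_subv d (T : measurableType d) (f g : T -> Rn R n) :
  measurable_fun setT f -> measurable_fun setT g ->
  measurable_fun setT (fun t => subv (f t) (g t)).
Proof.
move=> mf mg; apply: measurable_mktuple => i; apply: measurable_funB;
  exact: measurable_tnthT.
Qed.

Lemma measurable_scalev d (T : measurableType d) (r : T -> R) (f : T -> Rn R n) :
  measurable_fun setT r -> measurable_fun setT f ->
  measurable_fun setT (fun t => scalev (r t) (f t)).
Proof.
move=> mr mf; apply: measurable_mktuple => i; apply: measurable_funM => //.
exact: measurable_tnthT.
Qed.

End vectors.

(** * Lebesgue measure under translations and dilations *)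

Section lebesgue_line.
Local Open Scope ereal_scope.
Context {R : realType}.
Implicit Types f : R -> \bar R.
Notation mu := (@lebesgue_measure R).

(** The image of Lebesgue measure under the shift gives every half-open interval its length, so
    uniqueness of Lebesgue measure identifies the two. [ge0_integral_scale] follows the same
    route. *)
Lemma ge0_integral_shift f (a : R) : measurable_fun setT f -> (forall x, 0 <= f x) ->
  \int[mu]_x f (x + a)%R = \int[mu]_x f x.
Proof.
move=> mf f0.
have mphi : measurable_fun [set: R] (fun x : R => (x + a)%R : measurableTypeR R).
  exact: measurable_funD.
transitivity (\int[pushforward mu (fun x : R => (x + a)%R : measurableTypeR R)]_x f x).
  by rewrite ge0_integral_pushforward// => x _; exact: f0.
apply: eq_measure_integral => A mA _.
apply/esym/lebesgue_measure_unique => //= _ [[b c]] _ <-.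
rewrite /pushforward (_ : _ @^-1` _ = `](b - a)%R, (c - a)%R]%classic); last first.
  by apply/seteqP; split=> x/=; rewrite !in_itv/= ltrBlDr lerBrDr.
rewrite !lebesgue_measure_itv/= !lte_fin ltrD2r -!EFinB opprB.
by case: ifP => // _; congr EFin; ring.
Qed.

Lemma ge0_integral_scale f (r : R) : r != 0%R -> measurable_fun setT f ->
  (forall x, 0 <= f x) -> \int[mu]_x f x = `|r|%:E * \int[mu]_x f (r * x)%R.
Proof.
move=> r0 mf f0.
have mphi : measurable_fun [set: R] (fun x : R => (r * x)%R : measurableTypeR R).
  exact: measurable_funM.
have -> : \int[mu]_x f (r * x)%R =
    \int[pushforward mu (fun x : R => (r * x)%R : measurableTypeR R)]_x f x.
  by rewrite ge0_integral_pushforward// => x _; exact: f0.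
rewrite -[`|r|%R]/((NngNum (normr_ge0 r))%:num)%R -ge0_integral_mscale//.
apply: eq_measure_integral => A mA _.
apply: lebesgue_measure_unique => //= _ [[b c]] _ <-.
rewrite /mscale /= /pushforward.
have [rneg|rpos|r00] := ltgtP r 0%R; last by rewrite r00 eqxx in r0.
(* A negative factor exchanges the endpoints, so the preimage is closed on the left; its length is
   unaffected. *)
- rewrite (_ : _ @^-1` _ = `[(c / r)%R, (b / r)%R[%classic); last first.
    apply/seteqP; split=> x/=; rewrite !in_itv/= ler_ndivrMr// ltr_ndivlMr//.
      by rewrite mulrC => /andP[-> ->].
    by rewrite mulrC => /andP[-> ->].
  rewrite !lebesgue_measure_itv/= !lte_fin ltr_ndivrMr// divfK//.
  case: ifP => _; last by rewrite mule0.
  rewrite -!EFinB -EFinM ltr0_norm//; congr EFin; field => //.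
- rewrite (_ : _ @^-1` _ = `](b / r)%R, (c / r)%R]%classic); last first.
    by apply/seteqP; split=> x/=; rewrite !in_itv/= ler_pdivlMr// ltr_pdivrMr// mulrC.
  rewrite !lebesgue_measure_itv/= !lte_fin ltr_pdivrMr// divfK//.
  case: ifP => _; last by rewrite mule0.
  rewrite -!EFinB -EFinM gtr0_norm//; congr EFin; field => //.
Qed.

End lebesgue_line.

(** Positive and negative parts commute with composition by [T], and the integral is the difference
    of theirs; so no integrability is required of [f]. *)
Lemma ge0_integral_comp_invariant d (X : measurableType d) (R : realType)
    (mu : {measure set X -> \bar R}) (T : X -> X) :
  (forall f : X -> \bar R, measurable_fun setT f -> (forall x, (0 <= f x)%E) ->
    (\int[mu]_x f (T x) = \int[mu]_x f x)%E) ->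
  forall f : X -> \bar R, measurable_fun setT f ->
    (\int[mu]_x f (T x) = \int[mu]_x f x)%E.
Proof.
move=> H f mf; rewrite integralE [RHS]integralE; congr (_ - _)%E.
- rewrite -(H (f^\+)%E) //; last exact: measurable_funepos.
  by apply: eq_integral => x _; rewrite /= !funeposE.
- rewrite -(H (f^\-)%E) //; last exact: measurable_funeneg.
  by apply: eq_integral => x _; rewrite /= !funenegE.
Qed.

Section lebesgue_Rn_theory.
Local Open Scope ereal_scope.
Context {R : realType}.
Notation mu := (@lebesgue_measure R).
Notation lam n := (lebesgue_Rn R n).

(** Tonelli for the recursive definition of [lebesgue_Rn]; it drives every induction on the
    dimension. *)
Lemma ge0_integral_lebesgue_succ n (f : Rn R n.+1 -> \bar R) :
  measurable_fun setT f -> (forall x, 0 <= f x) ->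
  \int[lam n.+1]_x f x = \int[mu]_a \int[lam n]_x f (consv (a, x)).
Proof.
move=> mf f0.
have -> : \int[lam n.+1]_x f x = \int[mu \x lam n]_u f (consv u).
  rewrite /= /lebesgue_succ ge0_integral_pushforward//; first exact: measurable_consv.
rewrite (fubini_tonelli1 (f \o consv))//; last by move=> ?; exact: f0.
by apply: measurableT_comp => //; exact: measurable_consv.
Qed.

Lemma measurable_consv_r n (T : Rn R n.+1 -> \bar R) (a : R) :
  measurable_fun setT T -> measurable_fun setT (fun x => T (consv (a, x))).
Proof.
move=> mT; apply: (measurableT_comp mT); apply: (measurableT_comp measurable_consv).
exact: pair1_measurable.
Qed.

Lemma measurable_int_consv n (f : Rn R n.+1 -> \bar R) :
  measurable_fun setT f -> (forall x, 0 <= f x) ->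
  measurable_fun setT (fun a => \int[lam n]_x f (consv (a, x))).
Proof.
move=> mf f0; apply: (measurable_fun_fubini_tonelli_F (m2 := lam n) (f \o consv)).
  by apply: measurableT_comp => //; exact: measurable_consv.
by move=> ?; exact: f0.
Qed.

Lemma tnth_consv0 n (a : R) (x : Rn R n) : tnth (consv (a, x)) ord0 = a.
Proof. by []. Qed.

Lemma tnth_consvS n (a : R) (x : Rn R n) i : tnth (consv (a, x)) (lift ord0 i) = tnth x i.
Proof. exact: tnthS. Qed.

Lemma tuple_eqS n (x y : Rn R n.+1) : tnth x ord0 = tnth y ord0 ->
  (forall i, tnth x (lift ord0 i) = tnth y (lift ord0 i)) -> x = y.
Proof.
move=> h0 hS; apply: eq_from_tnth => i.
by have [j ->|->] := unliftP ord0 i.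
Qed.

Lemma plusv_consv n (a b : R) (x y : Rn R n) :
  plusv (consv (a, x)) (consv (b, y)) = consv ((a + b)%R, plusv x y).
Proof.
by apply: tuple_eqS => [|i]; rewrite tnthE ?tnth_consv0 ?tnth_consvS ?tnthE.
Qed.

Lemma scalev_consv n (a r : R) (x : Rn R n) :
  scalev r (consv (a, x)) = consv ((r * a)%R, scalev r x).
Proof.
by apply: tuple_eqS => [|i]; rewrite tnthE ?tnth_consv0 ?tnth_consvS ?tnthE.
Qed.

Lemma consv_surj n (x : Rn R n.+1) : x = consv (tnth x ord0, tailv x).
Proof. by apply: val_inj; case: x => [[|a s]]. Qed.

Lemma dotv_consv n (a b : R) (x y : Rn R n) :
  dotv (consv (a, x)) (consv (b, y)) = (a * b + dotv x y)%R.
Proof.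
rewrite /dotv big_ord_recl !tnth_consv0; congr (_ + _)%R.
by apply: eq_bigr => i _; rewrite !tnth_consvS.
Qed.

Lemma measurable_plusvr n (a : Rn R n) :
  measurable_fun setT (fun x : Rn R n => plusv x a).
Proof. exact: measurable_plusv. Qed.

Lemma ge0_integral_plusv n (a : Rn R n) (f : Rn R n -> \bar R) :
  measurable_fun setT f -> (forall x, 0 <= f x) ->
  \int[lam n]_x f (plusv x a) = \int[lam n]_x f x.
Proof.
elim: n a f => [|n ih] a f mf f0.
  by apply: eq_integral => x _; rewrite (tuple0 x) [plusv _ _]tuple0.
rewrite ge0_integral_lebesgue_succ//; last first.
  by apply: (measurableT_comp mf); exact: measurable_plusvr.
rewrite ge0_integral_lebesgue_succ//.
rewrite -(ge0_integral_shift (tnth a ord0) (measurable_int_consv mf f0)); last first.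
  by move=> x; exact: integral_ge0.
apply: eq_integral => b _.
rewrite -[RHS](ih (tailv a)) => [||//]; last exact: measurable_consv_r.
by apply: eq_integral => x _; rewrite -plusv_consv -consv_surj.
Qed.

Lemma ge0_integral_scalev n (r : R) (f : Rn R n -> \bar R) : r != 0%R ->
  measurable_fun setT f -> (forall x, 0 <= f x) ->
  \int[lam n]_x f x = (`|r| ^+ n)%:E * \int[lam n]_x f (scalev r x).
Proof.
move=> r0; elim: n f => [|n ih] f mf f0.
  rewrite expr0 mul1e.
  by apply: eq_integral => x _; rewrite (tuple0 x) [scalev _ _]tuple0.
have mfr : measurable_fun setT (fun x : Rn R n.+1 => f (scalev r x)).
  by apply: (measurableT_comp mf); exact: (@measurable_scalev _ _ _ _ (cst r) id).
rewrite [in RHS]ge0_integral_lebesgue_succ// ge0_integral_lebesgue_succ//.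
rewrite (ge0_integral_scale r0 (measurable_int_consv mf f0)); last first.
  by move=> x; exact: integral_ge0.
rewrite exprS EFinM -muleA; congr (_ * _).
rewrite -ge0_integralZl//; last 2 first.
- exact: (measurable_int_consv mfr (fun x => f0 _)).
- by move=> *; exact: integral_ge0.
apply: eq_integral => b _.
rewrite ih => [||//]; last exact: measurable_consv_r.
by congr (_ * _); apply: eq_integral => x _; rewrite scalev_consv.
Qed.

Lemma integral_plusv n (a : Rn R n) (f : Rn R n -> \bar R) :
  measurable_fun setT f ->
  \int[lam n]_x f (plusv x a) = \int[lam n]_x f x.
Proof.
by apply: ge0_integral_comp_invariant => {}f mf f0; exact: ge0_integral_plusv.
Qed.

Lemma integral_oppv n (f : Rn R n -> \bar R) : measurable_fun setT f ->
  \int[lam n]_x f (scalev (-1)%R x) = \int[lam n]_x f x.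
Proof.
apply: ge0_integral_comp_invariant => {}f mf f0.
by rewrite [RHS](@ge0_integral_scalev _ (-1)%R)// ?oppr_eq0 ?oner_eq0// normrN1 expr1n mul1e.
Qed.

Lemma integral_subvl n (a : Rn R n) (f : Rn R n -> \bar R) :
  measurable_fun setT f ->
  \int[lam n]_x f (subv a x) = \int[lam n]_x f x.
Proof.
move=> mf; rewrite -(integral_plusv a mf) -(@integral_oppv _ (fun x => f (plusv x a))).
  apply: eq_integral => x _; congr f.
  by apply: eq_from_tnth => i; rewrite !tnthE; ring.
by apply: (measurableT_comp mf); exact: measurable_plusvr.
Qed.

End lebesgue_Rn_theory.

Section Rintegral_tools.
Context d (T : measurableType d) (R : realType) (mu : {measure set T -> \bar R}).
Implicit Types f g : T -> R.

Lemma Rintegral_dominated_cvg (f_ : nat -> T -> R) f g :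
  (forall n, measurable_fun setT (f_ n)) ->
  (forall x, f_ ^~ x @ \oo --> f x) ->
  mu.-integrable setT (EFin \o g) -> (forall n x, `|f_ n x| <= g x) ->
  mu.-integrable setT (EFin \o f) /\
  \int[mu]_x f_ n x @[n --> \oo] --> \int[mu]_x f x.
Proof.
move=> mf_ f_f ig f_g.
have mf : measurable_fun setT f.
  by apply: (measurable_fun_cvg (h := f_)) => // x _; exact: f_f.
have [||||intf _ cvgf] := @dominated_convergence _ _ _ mu setT measurableT
    (fun n => EFin \o f_ n) (EFin \o f) (EFin \o g) _ _ _ ig.
- by move=> n; exact/measurable_EFinP.
- exact/measurable_EFinP.
- by apply: aeW => x _; apply: cvg_EFin; [exact: nearW|exact: f_f].
- by apply: aeW => x n _; rewrite /= lee_fin.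
split => //; apply: fine_cvg; rewrite fineK//.
exact: integrable_fin_num.
Qed.

Lemma integrable_bounded_mul f g (c : R) :
  measurable_fun setT f -> mu.-integrable setT (EFin \o g) ->
  (forall x, `|f x| <= c * `|g x|) -> mu.-integrable setT (EFin \o f).
Proof.
move=> mf ig fg; apply: (@le_integrable _ _ _ _ _ _ _ (EFin \o (fun x => c * g x))) => //.
- exact/measurable_EFinP.
- move=> x _; rewrite /= lee_fin (le_trans (fg x))// normrM ler_wpM2r// ler_norm //.
- by have := integrableZl measurableT c ig.
Qed.

Lemma integrable_EFin_measurable f : mu.-integrable setT (EFin \o f) ->
  measurable_fun setT f.
Proof. by move=> /measurable_int/measurable_EFinP. Qed.

Lemma EFin_Rintegral f : mu.-integrable setT (EFin \o f) ->
  (\int[mu]_x f x)%:E = (\int[mu]_x (f x)%:E)%E.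
Proof. by move=> /(integrable_fin_num measurableT) /fineK. Qed.

End Rintegral_tools.

(** * Gaussian integrals and reflections *)

Section gaussian_line.
Context {R : realType}.
Notation mu := (@lebesgue_measure R).

Definition gaussr (s u : R) := expR (- (s * u ^+ 2)).

Lemma measurable_gaussr s : measurable_fun setT (gaussr s).
Proof.
apply: measurableT_comp => //; apply: measurableT_comp => //.
by apply: measurable_funM => //; exact: measurable_funX.
Qed.

Lemma gaussr_gauss_fun (s : R) u : 0 < s -> gaussr s u = gauss_fun (Num.sqrt s * u).
Proof. by move=> s0; rewrite /gaussr /gauss_fun exprMn sqr_sqrtr ?ltW. Qed.

Lemma integral_gaussr (s : R) : 0 < s ->
  (\int[mu]_u (gaussr s u)%:E = (Num.sqrt (pi / s))%:E)%E.
Proof.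
move=> s0; have ss0 : 0 < Num.sqrt s by rewrite sqrtr_gt0.
have := @integralT_gauss R; rewrite (@ge0_integral_scale _ _ (Num.sqrt s)); last 3 first.
- by rewrite gt_eqF.
- by apply/measurable_EFinP; exact: measurable_gauss_fun.
- by move=> x; rewrite lee_fin gauss_fun_ge0.
under eq_integral do rewrite -gaussr_gauss_fun//.
move=> h; rewrite -[LHS]mul1e -(mulVf (lt0r_neq0 ss0)) EFinM -muleA.
rewrite -{2}(gtr0_norm ss0) h -EFinM mulrC sqrtrM ?pi_ge0//.
by rewrite sqrtrV// ltW.
Qed.

Lemma integrable_gaussr (s : R) : 0 < s -> mu.-integrable setT (EFin \o gaussr s).
Proof.
move=> s0; apply/integrableP; split.
  by apply/measurable_EFinP; exact: measurable_gaussr.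
under eq_integral => u _ do rewrite /= ger0_norm ?expR_ge0//.
by rewrite integral_gaussr ?ltry.
Qed.

Lemma gaussr_ge0 (s u : R) : 0 <= gaussr s u. Proof. exact: expR_ge0. Qed.

(** From [|u| <= 1 + u^2 / 2 <= exp (u^2 / 2)]. The right-hand side is the majorant that allows
    differentiation under the integral in [derive_gauss_cos]. *)
Lemma gaussr_moment (u : R) : `|u| * gaussr 1 u <= gaussr (2^-1) u.
Proof.
rewrite /gaussr mul1r.
have -> : expR (- u ^+ 2) = expR (- (2^-1 * u ^+ 2)) * expR (- (2^-1 * u ^+ 2)).
  by rewrite -expRD; congr expR; field.
rewrite mulrA ger_pMl ?expR_gt0// expRN -ler_pdivlMr ?invr_gt0 ?expR_gt0// div1r invrK.
apply: (le_trans _ (expR_ge1Dx _)).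
rewrite -(real_normK (num_real u)).
have := sqr_ge0 (`|u| - 1); rewrite sqrrB1; lra.
Qed.

Definition gauss_cos (x : R) := \int[mu]_u (cos (u * x) * gaussr 1 u).

Lemma measurable_cosM (x : R) : measurable_fun setT (fun u : R => cos (u * x)).
Proof.
apply: (measurableT_comp (f := @cos R)); last exact: measurable_funM.
by apply: continuous_measurable_fun; exact: continuous_cos.
Qed.

Lemma measurable_sinM (x : R) : measurable_fun setT (fun u : R => sin (u * x)).
Proof.
apply: (measurableT_comp (f := @sin R)); last exact: measurable_funM.
by apply: continuous_measurable_fun; exact: continuous_sin.
Qed.

Lemma cos_norm_le1 (a : R) : `|cos a| <= 1.
Proof. by rewrite ler_norml cos_geN1 cos_le1. Qed.

Lemma sin_norm_le1 (a : R) : `|sin a| <= 1.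
Proof. by rewrite ler_norml sin_geN1 sin_le1. Qed.

Lemma integrable_cos_gaussr (s x : R) : 0 < s ->
  mu.-integrable setT (EFin \o (fun u => cos (u * x) * gaussr s u)).
Proof.
move=> s0; apply: (@integrable_bounded_mul _ _ R mu (fun u => cos (u * x) * gaussr s u) (gaussr s) 1).
- by apply: measurable_funM; [exact: measurable_cosM|exact: measurable_gaussr].
- exact: integrable_gaussr.
- by move=> u; rewrite normrM ler_wpM2r// cos_norm_le1.
Qed.

Lemma derive_gauss_cos (x : R) :
  is_derive x 1 gauss_cos (- \int[mu]_u (u * sin (u * x) * gaussr 1 u)).
Proof.
pose f (y u : R) := cos (u * y) * gaussr 1 u.
have df (y u : R) : is_derive y (1 : R) (f ^~ u) (- (u * sin (u * y) * gaussr 1 u)).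
  rewrite /f.
  have h : is_derive y (1 : R) (fun z : R => u * z) u.
    by apply: is_derive_eq; rewrite scaler1.
  have h2 : is_derive y (1 : R) (fun z : R => cos (u * z)) (- sin (u * y) * u).
    by have := is_derive1_comp (is_derive_cos (u * y)) h.
  apply: is_derive_eq; rewrite scaler0 add0r /GRing.scale/=; ring.
have xI : (`]x - 1, x + 1[%classic : set R) x by rewrite /= in_itv/=; lra.
have intf y : (`]x - 1, x + 1[%classic : set R) y ->
    mu.-integrable setT (EFin \o f y).
  by move=> _; exact: integrable_cos_gaussr.
have derf y u : (`]x - 1, x + 1[%classic : set R) y -> [set: R] u ->
    derivable (f ^~ u) y 1.
  by move=> _ _; case: (df y u).
have G0 (u : R) : 0 <= gaussr (2^-1) u by exact: expR_ge0.
have hs : (0 : R) < 2^-1 by rewrite invr_gt0.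
have Gub y u : (`]x - 1, x + 1[%classic : set R) y -> [set: R] u ->
    `|partial1of2 f y u| <= gaussr (2^-1) u.
  move=> _ _; rewrite partial1of2E; have [_ ->] := df y u.
  rewrite normrN !normrM (ger0_norm (expR_ge0 _)).
  apply: le_trans (gaussr_moment u); rewrite ler_wpM2r ?expR_ge0//.
  by rewrite ler_piMr// sin_norm_le1.
have iG := integrable_gaussr hs.
have D := derivable_under_integral measurableT xI intf derf G0 iG Gub.
have E := differentiation_under_integral measurableT xI intf derf G0 iG Gub.
split; first exact: D.
rewrite -derive1E; rewrite [LHS]E.
transitivity (\int[mu]_y (-1 * (y * sin (y * x) * gaussr 1 y))).
  apply: eq_Rintegral => u _; rewrite partial1of2E; have [_ ->] := df x u.
  by rewrite mulN1r.
rewrite RintegralZl ?mulN1r//.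
apply: (@integrable_bounded_mul _ _ R mu (fun y => y * sin (y * x) * gaussr 1 y) (gaussr (2^-1)) 1) => //.
  apply: measurable_funM; last exact: measurable_gaussr.
  by apply: measurable_funM => //; exact: measurable_sinM.
move=> u; rewrite !normrM mul1r (ger0_norm (G0 u)) (ger0_norm (gaussr_ge0 1 u)).
apply: le_trans (gaussr_moment u); rewrite ler_wpM2r ?expR_ge0//.
by rewrite ler_piMr// sin_norm_le1.
Qed.

(** Integration by parts: the difference [k] of the two integrands is the derivative of [K], which
    vanishes at both infinities. *)
Lemma integral_sin_gaussr (x : R) :
  \int[mu]_u (u * sin (u * x) * gaussr 1 u) = x / 2 * gauss_cos x.
Proof.
have hs : (0 : R) < 2^-1 by rewrite invr_gt0.
pose k (u : R) := u * sin (u * x) * gaussr 1 u - x / 2 * (cos (u * x) * gaussr 1 u).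
pose K (u : R) := - (2^-1) * (gaussr 1 u * sin (u * x)).
have i1 : mu.-integrable setT (EFin \o (fun u => u * sin (u * x) * gaussr 1 u)).
  apply: (@integrable_bounded_mul _ _ R mu (fun y => y * sin (y * x) * gaussr 1 y) (gaussr (2^-1)) 1) => //.
  - apply: measurable_funM; last exact: measurable_gaussr.
    by apply: measurable_funM => //; exact: measurable_sinM.
  - exact: integrable_gaussr.
  move=> u; rewrite !normrM mul1r (ger0_norm (expR_ge0 _)) (ger0_norm (expR_ge0 _)).
  apply: le_trans (gaussr_moment u); rewrite ler_wpM2r ?expR_ge0//.
  by rewrite ler_piMr// sin_norm_le1.
have i2 : mu.-integrable setT (EFin \o (fun u => x / 2 * (cos (u * x) * gaussr 1 u))).
  have := integrableZl measurableT (x / 2) (integrable_cos_gaussr x (@ltr01 R)).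
  by under eq_fun do rewrite -EFinM.
have ik : mu.-integrable setT (EFin \o k) by exact: (integrableB measurableT i1 i2).
have -> : \int[mu]_u (u * sin (u * x) * gaussr 1 u) =
    \int[mu]_u k u + x / 2 * gauss_cos x.
  rewrite /gauss_cos -RintegralZl//; last exact: integrable_cos_gaussr.
  by rewrite /k RintegralB// subrK.
suff -> : \int[mu]_u k u = 0 by rewrite add0r.
have dK (u : R) : is_derive u (1 : R) K (k u).
  have h : is_derive u (1 : R) (fun z : R => z * x) x.
    by apply: is_derive_eq; rewrite scaler0 add0r /GRing.scale/= mulr1.
  have h2 : is_derive u (1 : R) (fun z : R => sin (z * x)) (cos (u * x) * x).
    by apply: (@is_derive1_comp _ sin (fun z : R => z * x)).
  have h3 : is_derive u (1 : R) (fun z : R => - (1 * z ^+ 2)) (- (2 * u)).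
    by apply: is_derive_eq; rewrite /GRing.scale/=; ring.
  have h4 : is_derive u (1 : R) (gaussr 1) (gaussr 1 u * (- (2 * u))).
    by apply: (@is_derive1_comp _ expR (fun z : R => - (1 * z ^+ 2))).
  by rewrite /K /k; apply: is_derive_eq; rewrite /GRing.scale/=; field.
have cK : continuous K.
  by move=> u; apply: differentiable_continuous; apply/derivable1_diffP; case: (dK u).
have ck : continuous k.
  have cm : continuous (fun u : R => u * x).
    by move=> u; apply: cvgM; [exact: cvg_id|exact: cvg_cst].
  have cg : continuous (gaussr 1 : R -> R).
    move=> u; apply: differentiable_continuous; apply/derivable1_diffP.
    have h3 : is_derive u (1 : R) (fun z : R => - (1 * z ^+ 2)) (- (2 * u)).
      by apply: is_derive_eq; rewrite /GRing.scale/=; ring.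
    by case: (@is_derive1_comp _ expR (fun z : R => - (1 * z ^+ 2)) u _ _ _ h3).
  move=> u; apply: cvgB; apply: cvgM.
  - by apply: cvgM; [exact: cvg_id|apply: (continuous_comp (cm u)); exact: continuous_sin].
  - exact: cg.
  - exact: cvg_cst.
  - by apply: cvgM; [apply: (continuous_comp (cm u)); exact: continuous_cos|exact: cg].
(* The integral of [k] over [I n] is computed in two ways: it tends to 0 by the fundamental theorem
   of calculus and to the full integral by dominated convergence. *)
pose I (n : nat) := `[- n.+1%:R, n.+1%:R : R]%classic.
have FTC n : \int[mu]_(u in I n) k u = K n.+1%:R - K (- n.+1%:R).
  rewrite /Rintegral (@continuous_FTC2 _ k K).
  - by [].
  - by have := ltr0Sn R n; lra.
  - by apply: continuous_subspaceT.
  - split; first by move=> u _; case: (dK u).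
    + by apply: cvg_at_right_filter; exact: cK.
    + by apply: cvg_at_left_filter; exact: cK.
  - by move=> u _; rewrite derive1E; case: (dK u).
have KB (u : R) : `|K u| <= gaussr 1 u.
  rewrite /K normrM normrN normrM (ger0_norm (expR_ge0 _)).
  rewrite (ger0_norm (ltW hs)); have := sin_norm_le1 (u * x).
  have := expR_ge0 (- (1 * u ^+ 2)); rewrite -/(gaussr 1 u); nra.
have g0 : (gaussr 1 (n.+1%:R : R)) @[n --> \oo] --> (0 : R).
  apply: (@squeeze_cvgr _ _ _ _ (cst 0) (fun n => n.+1%:R^-1)).
  - apply: nearW => n /=; rewrite expR_ge0/= /gaussr expRN lef_pV2 ?posrE ?expR_gt0//.
    apply: (le_trans _ (expR_ge1Dx _)); rewrite mul1r.
    have : 1 <= n.+1%:R :> R by rewrite ler1n.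
    nra.
  - exact: cvg_cst.
  - exact: cvg_harmonic.
have L0 : \int[mu]_(u in I n) k u @[n --> \oo] --> (0 : R).
  under eq_fun do rewrite FTC.
  apply: norm_cvg0; apply: (@squeeze_cvgr _ _ _ _ (cst 0) (fun n => 2 * gaussr 1 (n.+1%:R : R))).
  - apply: nearW => n /=; rewrite normr_ge0/= (le_trans (ler_normB _ _))//.
    have := KB n.+1%:R; have := KB (- n.+1%:R).
    have -> : gaussr 1 (- n.+1%:R : R) = gaussr 1 n.+1%:R by rewrite /gaussr sqrrN.
    lra.
  - exact: cvg_cst.
  - by rewrite -[X in _ --> X](mulr0 2); apply: cvgM => //; exact: cvg_cst.
have ikn := integrable_norm ik.
have hm n : measurable_fun setT (k \_ (I n)).
  apply/(measurable_restrictT (D := I n) k (measurable_itv _)).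
  exact: (measurable_funTS (continuous_measurable_fun ck)).
have hc (u : R) : (k \_ (I n)) u @[n --> \oo] --> k u.
  apply: cvg_near_cst; near=> n.
  rewrite patchE ifT// inE /I/= in_itv/= -ler_norml.
  near: n; exists (Num.truncn `|u|) => // m /= h.
  by apply: le_trans (ltW (truncnS_gt _)) _; rewrite ler_nat ltnS.
have hb n u : `|(k \_ (I n)) u| <= `|k u|.
  by rewrite patchE; case: ifP => //; rewrite normr0.
have [_ L1] := @Rintegral_dominated_cvg _ (measurableTypeR R) R mu _ _ _ hm hc ikn hb.
have LE : (fun n => \int[mu]_(u in I n) k u) = (fun n => \int[mu]_u (k \_ (I n)) u).
  by apply/funext => n; rewrite Rintegral_mkcond.
rewrite LE in L0; exact: (cvg_unique _ L1 L0).
Unshelve. all: by end_near. Qed.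

(** The two preceding lemmas say that [gauss_cos] solves [y' = - (x / 2) y]. Hence its product with
    [exp (x^2 / 4)] is constant, and the value at 0 is the Gaussian integral. *)
Lemma gauss_cosE (x : R) : gauss_cos x = Num.sqrt pi * expR (- (x ^+ 2 / 4)).
Proof.
pose E (y : R) := expR (y ^+ 2 / 4).
have dE (y : R) : is_derive y (1 : R) E (E y * (y / 2)).
  apply: (@is_derive1_comp _ expR (fun z : R => z ^+ 2 / 4)).
  by apply: is_derive_eq; rewrite /GRing.scale/=; field.
have dP (y : R) : is_derive y (1 : R) (gauss_cos * E) 0.
  have := is_deriveM (derive_gauss_cos y) (dE y).
  by rewrite integral_sin_gaussr => H; apply: is_derive_eq; rewrite /GRing.scale/=; ring.
have := @is_derive_0_is_cst _ (gauss_cos * E) x 0 dP.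
rewrite /GRing.mul/= {2}/E expr0n/= mul0r expR0 mulr1.
have -> : gauss_cos 0 = Num.sqrt pi.
  rewrite /gauss_cos /Rintegral.
  under eq_integral do rewrite mulr0 cos0 mul1r.
  by rewrite integral_gaussr// divr1.
move=> H; apply: (mulIf (lt0r_neq0 (expR_gt0 (x ^+ 2 / 4)))).
by rewrite -[RHS]mulrA -expRD addNr expR0 mulr1 -H.
Qed.

Lemma Rintegral_gaussr (s : R) : 0 < s -> \int[mu]_u gaussr s u = Num.sqrt (pi / s).
Proof. by move=> s0; rewrite /Rintegral integral_gaussr. Qed.

Lemma Rintegral_cos_gaussr (s x : R) : 0 < s ->
  \int[mu]_u (cos (u * x) * gaussr s u) = Num.sqrt (pi / s) * expR (- (x ^+ 2 / (4 * s))).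
Proof.
move=> s0; have ss0 : 0 < Num.sqrt s by rewrite sqrtr_gt0.
(* Adding the Gaussian makes the integrand nonnegative, since [1 + cos >= 0], so that
   [ge0_integral_scale] applies; the known Gaussian integral is cancelled at the end. *)
pose J (t y : R) := \int[mu]_u (gaussr t u + cos (u * y) * gaussr t u).
have JE t y : 0 < t -> J t y = Num.sqrt (pi / t) + \int[mu]_u (cos (u * y) * gaussr t u).
  move=> t0; rewrite /J RintegralD ?Rintegral_gaussr//; first exact: integrable_gaussr.
  exact: integrable_cos_gaussr.
have Js : J 1 (x / Num.sqrt s) = Num.sqrt s * J s x.
  rewrite /J /Rintegral (@ge0_integral_scale _ _ (Num.sqrt s)); last 3 first.
  - by rewrite gt_eqF.
  - apply/measurable_EFinP; apply: measurable_funD; first exact: measurable_gaussr.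
    by apply: measurable_funM; [exact: measurable_cosM|exact: measurable_gaussr].
  - move=> u; rewrite lee_fin -{1}[gaussr 1 u]mul1r -mulrDl mulr_ge0 ?expR_ge0//.
  have e u : gaussr 1 (Num.sqrt s * u) = gaussr s u.
    by rewrite gaussr_gauss_fun// sqrtr1 mul1r -gaussr_gauss_fun.
  have e' u : Num.sqrt s * u * (x / Num.sqrt s) = u * x by field; rewrite gt_eqF.
  rewrite (gtr0_norm ss0) fineM; last 2 first.
  - by [].
  - apply: (integrable_fin_num measurableT).
    have := integrableD measurableT (integrable_gaussr s0) (integrable_cos_gaussr x s0).
    by apply: (eq_integrable measurableT) => u _ /=; rewrite e e'.
  by congr (_ * fine _); apply: eq_integral => u _; rewrite e e'.
have := JE s x s0; have := JE 1 (x / Num.sqrt s) ltr01.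
rewrite -[X in _ = _ + X -> _]/(gauss_cos _) gauss_cosE Js divr1 => h1 h2.
have h3 : Num.sqrt (pi / s) = Num.sqrt pi / Num.sqrt s :> R.
  by rewrite sqrtrM ?pi_ge0// sqrtrV// ltW.
have h4 : expR (- (x / Num.sqrt s) ^+ 2 / 4) = expR (- (x ^+ 2 / (4 * s))).
  by congr expR; rewrite expr_div_n sqr_sqrtr ?ltW//; field; rewrite gt_eqF.
move: h1 h2; rewrite -mulNr h4 h3 => h1 h2.
apply: (mulfI (lt0r_neq0 ss0)).
rewrite h2 mulrDr in h1; apply: (addrI (Num.sqrt s * (Num.sqrt pi / Num.sqrt s))).
by rewrite h1; field; rewrite gt_eqF.
Qed.

End gaussian_line.

Section gaussian_Rn.
Context {R : realType}.
Notation mu := (@lebesgue_measure R).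
Notation lam n := (lebesgue_Rn R n).

Definition gaussv n (s : R) (x : Rn R n) := expR (- (s * dotv x x)).

Lemma measurable_gaussv n s d (T : measurableType d) (f : T -> Rn R n) :
  measurable_fun setT f -> measurable_fun setT (fun t => gaussv s (f t)).
Proof.
move=> mf; apply: (measurableT_comp (f := @expR R)) => //; apply: measurable_funN.
by apply: measurable_funM => //; exact: measurable_dotv.
Qed.

Lemma gaussv_ge0 n s (x : Rn R n) : 0 <= gaussv s x. Proof. exact: expR_ge0. Qed.

Lemma gaussv_consv n s (a : R) (x : Rn R n) :
  gaussv s (consv (a, x)) = gaussr s a * gaussv s x.
Proof. by rewrite /gaussv dotv_consv /gaussr -expRD mulrDr opprD expr2. Qed.

Lemma integral_gaussv n (s : R) : 0 < s ->
  (\int[lam n]_x (gaussv s x)%:E = (Num.sqrt (pi / s) ^+ n)%:E)%E.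
Proof.
move=> s0; elim: n => [|n ih].
  rewrite /= integral_dirac//; last first.
    by apply/measurable_EFinP; exact: measurable_gaussv.
  by rewrite diracT mul1e expr0 /gaussv /dotv big_ord0 mulr0 oppr0 expR0.
rewrite ge0_integral_lebesgue_succ; last 2 first.
- by apply/measurable_EFinP; exact: measurable_gaussv.
- by move=> x; rewrite lee_fin gaussv_ge0.
under eq_integral => a _ do under eq_integral => x _ do rewrite gaussv_consv EFinM.
under eq_integral => a _.
  rewrite ge0_integralZl//; last 3 first.
  - by apply/measurable_EFinP; exact: measurable_gaussv.
  - by move=> x _; rewrite lee_fin gaussv_ge0.
  - by rewrite lee_fin expR_ge0.
  rewrite ih; over.
rewrite ge0_integralZr; last 4 first.
- exact: measurableT.
- by apply/measurable_EFinP; exact: measurable_gaussr.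
- by move=> x _; rewrite lee_fin expR_ge0.
- by rewrite lee_fin exprn_ge0// sqrtr_ge0.
by rewrite integral_gaussr// exprS EFinM.
Qed.

Lemma integrable_gaussv n (s : R) : 0 < s -> (lam n).-integrable setT (EFin \o gaussv s).
Proof.
move=> s0; apply/integrableP; split.
  by apply/measurable_EFinP; exact: measurable_gaussv.
under eq_integral => u _ do rewrite /= ger0_norm ?expR_ge0//.
by rewrite integral_gaussv ?ltry.
Qed.

End gaussian_Rn.

Section reflection.
Context {R : realType} {n : nat}.
Notation lam := (lebesgue_Rn R n).
Variables (x y : Rn R n).
Let w := subv x y.

(* The reflection across the hyperplane of the points equidistant from x and y. *)
Definition reflv (z : Rn R n) : Rn R n :=
  subv z (scalev ((2 * dotv w z - (dotv x x - dotv y y)) / dotv w w) w).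

(** The linear part of the affine map [reflv]. It is an involution, so moving the argument by
    [linv a] moves the image by [a]; see [reflv_plus]. *)
Let linv (z : Rn R n) : Rn R n := subv z (scalev (2 * dotv w z / dotv w w) w).

Hypothesis xy : x <> y.

Let w0 : dotv w w != 0.
Proof.
apply/eqP => /dotv_eq0 w0; apply: xy; apply: eq_from_tnth => i.
by have := congr1 (@tnth n R ^~ i) w0; rewrite !tnthE => /eqP; rewrite subr_eq0 => /eqP.
Qed.

Lemma reflvK z : reflv (reflv z) = z.
Proof.
apply: eq_from_tnth => i; rewrite /reflv -/w; clearbody w.
by rewrite !tnthE !dotvE; field.
Qed.

Lemma reflv_dist a b : normv (subv (reflv a) (reflv b)) = normv (subv a b).
Proof.
rewrite /normv; congr Num.sqrt; rewrite /reflv -/w; clearbody w.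
by rewrite !dotvE !(dotvC _ w) (dotvC b a); field.
Qed.

Lemma dotv_w : dotv w w = dotv x x - 2 * dotv x y + dotv y y.
Proof. by rewrite /w !dotvE (dotvC y x); ring. Qed.

Lemma reflv_l : reflv x = y.
Proof.
apply: eq_from_tnth => i; rewrite /reflv -/w !tnthE.
suff -> : (2 * dotv w x - (dotv x x - dotv y y)) / dotv w w = 1 by ring.
rewrite dotv_w /w !dotvE (dotvC y x).
rewrite (_ : _ - (_ - _) = dotv x x - 2 * dotv x y + dotv y y); last by ring.
by rewrite -dotv_w divff.
Qed.

(** The sign of the right-hand side tells which of [z] and its mirror image is closer to the origin:
    if [|x| <= |y|], points on the side of [x] are moved outwards. If [|x| = |y|], norms are
    preserved. *)
Lemma normv_reflv z : normv (reflv z) ^+ 2 - normv z ^+ 2 =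
  (normv (subv z y) ^+ 2 - normv (subv z x) ^+ 2) / dotv w w *
  (normv y ^+ 2 - normv x ^+ 2).
Proof.
rewrite !normv_sqr /reflv -/w.
have E : dotv x z = dotv w z + dotv y z by rewrite /w !dotvE; ring.
by clearbody w; rewrite !dotvE !(dotvC _ w) !(dotvC z) E; field.
Qed.

Let reflv_plus z a : reflv (plusv z (linv a)) = plusv (reflv z) a.
Proof.
apply: eq_from_tnth => i; rewrite /reflv /linv -/w; clear linv; clearbody w.
by rewrite !tnthE !dotvE; field.
Qed.

(** For [|x| = |y|] the mirror passes through the origin, so the reflection is a linear isometry
    exchanging [x] and [y]. *)
Lemma dotv_reflv z : dotv x x = dotv y y -> dotv (reflv z) x = dotv z y.
Proof.
move=> exy; rewrite /reflv -/w exy subrr subr0.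
have E1 : dotv w x = dotv w w / 2.
  by rewrite dotv_w /w !dotvE (dotvC y x) -exy; field.
have E2 : dotv z x = dotv w z + dotv z y.
  by rewrite /w !dotvE (dotvC x z) (dotvC y z); ring.
by clear reflv_plus linv; clearbody w; rewrite !dotvE E1 E2; field.
Qed.

Lemma measurable_reflv : measurable_fun setT reflv.
Proof.
apply: measurable_subv => //; apply: measurable_scalev => //.
apply: measurable_funM => //; apply: measurable_funB => //.
by apply: measurable_funM => //; exact: measurable_dotv.
Qed.

Local Open Scope ereal_scope.

(* Uniqueness of the translation-invariant measure: both sides are computed
   from the double integral of [g y * f (reflv z + y)], where [g] is a Gaussian. *)
Lemma ge0_integral_reflv (f : Rn R n -> \bar R) :
  measurable_fun setT f -> (forall z, 0 <= f z) ->
  \int[lam]_z f (reflv z) = \int[lam]_z f z.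
Proof.
move=> mf f0.
pose g (z : Rn R n) := (gaussv 1 z)%:E.
have mg d (T : measurableType d) (h : T -> Rn R n) : measurable_fun setT h ->
    measurable_fun setT (fun t => g (h t)).
  by move=> mh; apply/measurable_EFinP; exact: measurable_gaussv.
have g0 z : 0 <= g z by rewrite lee_fin gaussv_ge0.
have mfr : measurable_fun setT (fun z => f (reflv z)).
  by apply: measurableT_comp => //; exact: measurable_reflv.
pose I := (Num.sqrt (pi / 1) ^+ n : R)%R.
have gI : \int[lam]_z g z = I%:E by exact: integral_gaussv.
have I0 : (0 < I)%R by rewrite exprn_gt0// sqrtr_gt0 divr1 pi_gt0.
suff : I%:E * \int[lam]_z f (reflv z) = I%:E * \int[lam]_z f z.
  by move=> /(congr1 (fun u => (I^-1)%:E * u)); rewrite !muleA -!EFinM mulVf ?mul1e// gt_eqF.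
transitivity (\int[lam]_y' \int[lam]_z (g y' * f (plusv (reflv z) y'))).
  rewrite -gI -ge0_integralZr; [|exact: measurableT|exact: mg|by []|exact: integral_ge0].
  apply: eq_integral => y' _.
  rewrite ge0_integralZl; [|exact: measurableT| |by []|by []]; last first.
    by apply: (measurableT_comp mf); apply: measurable_plusv => //; exact: measurable_reflv.
  congr (_ * _); rewrite -(integral_plusv (linv y') mfr).
  by apply: eq_integral => z _; rewrite reflv_plus.
have m1 : measurable_fun setT (fun u : Rn R n * Rn R n => g u.1 * f (plusv (reflv u.2) u.1)).
  apply: emeasurable_funM; first exact: mg.
  apply: (measurableT_comp mf); apply: measurable_plusv => //.
  by apply: measurableT_comp => //; exact: measurable_reflv.
rewrite (fubini_tonelli (fun u : Rn R n * Rn R n => g u.1 * f (plusv (reflv u.2) u.1)))//; last first.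
  by move=> u; rewrite mule_ge0.
(* At fixed [z], translating [y'] by [reflv z] moves the reflection from the argument of [f] into
   that of the Gaussian. *)
transitivity (\int[lam]_z \int[lam]_y' (g (subv y' (reflv z)) * f y')).
  apply: eq_integral => z _.
  rewrite -[RHS](@integral_plusv _ _ (reflv z)); last first.
    by apply: emeasurable_funM => //; apply: mg; exact: measurable_subv.
  by apply: eq_integral => y' _; rewrite plusvK plusvC.
have m2 : measurable_fun setT (fun u : Rn R n * Rn R n => g (subv u.2 (reflv u.1)) * f u.2).
  apply: emeasurable_funM; last exact: measurableT_comp.
  apply: mg; apply: measurable_subv => //.
  by apply: measurableT_comp => //; exact: measurable_reflv.
rewrite (fubini_tonelli (fun u : Rn R n * Rn R n => g (subv u.2 (reflv u.1)) * f u.2))//; last first.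
  by move=> u; rewrite mule_ge0.
rewrite -ge0_integralZl; [|exact: measurableT|exact: mf|by []|by rewrite lee_fin ltW].
apply: eq_integral => y' _ /=.
rewrite ge0_integralZr; [|exact: measurableT| |by []|by []]; last first.
  by apply: mg; apply: measurable_subv => //; exact: measurable_reflv.
congr (_ * _).
(* The reflection is an isometric involution, so it can be moved from [z] to the fixed point [y'];
   the remaining integral is the Gaussian mass, whatever [y'] is. *)
have -> : \int[lam]_z g (subv y' (reflv z)) = \int[lam]_z g (subv (reflv y') z).
  apply: eq_integral => z _; rewrite /g /gaussv; congr (expR (- (1 * _)))%:E.
  by rewrite -!normv_sqr -(reflv_dist y' (reflv z)) reflvK.
by rewrite integral_subvl ?gI//; exact: mg.
Qed.

Lemma integral_reflv (f : Rn R n -> \bar R) : measurable_fun setT f ->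
  \int[lam]_z f (reflv z) = \int[lam]_z f z.
Proof.
by apply: ge0_integral_comp_invariant => {}f mf f0; exact: ge0_integral_reflv.
Qed.

End reflection.

Section radial.
Context {R : realType} {n : nat}.
Notation lam := (lebesgue_Rn R n).

(** Rotation invariance, with the rotation taking [x] to [y] replaced by the reflection that
    exchanges them; it keeps [|z|] because [|x| = |y|]. *)
Lemma integral_radial (F : R -> R -> \bar R) (x y : Rn R n) :
  measurable_fun setT (fun z : Rn R n => F (normv z) (dotv z x)) -> normv x = normv y ->
  (\int[lam]_z F (normv z) (dotv z x) = \int[lam]_z F (normv z) (dotv z y))%E.
Proof.
move=> mF nxy; have [->//|/eqP xy] := eqVneq x y.
have dxy : dotv x x = dotv y y by rewrite -!normv_sqr nxy.
rewrite -(integral_reflv xy mF); apply: eq_integral => z _.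
rewrite dotv_reflv//; congr (F _ _).
have := normv_reflv xy z; rewrite nxy subrr mulr0 => /eqP; rewrite subr_eq0.
by rewrite eqrXn2 ?normv_ge0// => /eqP.
Qed.

End radial.

(** * Unimodal functions and cosine transforms *)

Section integral_param.
Context d1 d2 (T1 : measurableType d1) (T2 : measurableType d2) (R : realType).
Variable m2 : {sigma_finite_measure set T2 -> \bar R}.

(** Tonelli gives measurability for the positive and negative parts separately, hence for signed
    integrands that need not be integrable. *)
Lemma measurable_integral_param (f : T1 * T2 -> \bar R) : measurable_fun setT f ->
  measurable_fun setT (fun x => \int[m2]_y f (x, y))%E.
Proof.
move=> mf; under eq_fun do rewrite integralE.
apply: emeasurable_funB.
- rewrite [X in measurable_fun _ X](_ : _ = fun x => (\int[m2]_y f^\+ (x, y))%E); last first.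
    by apply/funext => x; apply: eq_integral => y _; rewrite !funeposE.
  apply: (measurable_fun_fubini_tonelli_F (m2 := m2) (f^\+)%E) => //.
  exact: measurable_funepos.
- rewrite [X in measurable_fun _ X](_ : _ = fun x => (\int[m2]_y f^\- (x, y))%E); last first.
    by apply/funext => x; apply: eq_integral => y _; rewrite !funenegE.
  apply: (measurable_fun_fubini_tonelli_F (m2 := m2) (f^\-)%E) => //.
  exact: measurable_funeneg.
Qed.

Lemma measurable_Rintegral_param (f : T1 * T2 -> R) : measurable_fun setT f ->
  measurable_fun setT (fun x => \int[m2]_y f (x, y)).
Proof.
move=> mf; apply: (measurableT_comp (f := fine)) => //.
by apply: (@measurable_integral_param (EFin \o f)); exact/measurable_EFinP.
Qed.

End integral_param.

Section cos_transform.
Context {R : realType} {n : nat}.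
Notation lam := (lebesgue_Rn R n).
Implicit Types (f g k : Rn R n -> R) (x y xi : Rn R n).

(** For an even [f] this is the Fourier transform, kept real. *)
Definition cos_transform f x := \int[lam]_xi (cos (dotv xi x) * f xi).

Lemma measurable_cos_dotv d (T : measurableType d) (a b : T -> Rn R n) :
  measurable_fun setT a -> measurable_fun setT b ->
  measurable_fun setT (fun t => cos (dotv (a t) (b t))).
Proof.
move=> ma mb; apply: (measurableT_comp (f := @cos R)); last exact: measurable_dotv.
by apply: continuous_measurable_fun; exact: continuous_cos.
Qed.

Lemma measurable_cos_dotvr x : measurable_fun setT (fun xi : Rn R n => cos (dotv xi x)).
Proof. exact: (@measurable_cos_dotv _ _ id (cst x)). Qed.

Lemma integrable_cos_mul f x : lam.-integrable setT (EFin \o f) ->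
  lam.-integrable setT (EFin \o (fun xi => cos (dotv xi x) * f xi)).
Proof.
move=> fi; apply: (@integrable_bounded_mul _ _ R lam _ f 1) => //.
- apply: measurable_funM; first exact: measurable_cos_dotvr.
  exact: integrable_EFin_measurable fi.
- by move=> xi; rewrite normrM ler_wpM2r// cos_norm_le1.
Qed.

Lemma measurable_cos_transform f :
  measurable_fun setT f -> measurable_fun setT (cos_transform f).
Proof.
move=> mf; apply: (@measurable_Rintegral_param _ _ _ _ _ lam
  (fun u => cos (dotv u.2 u.1) * f u.2)).
apply: measurable_funM; last exact: measurableT_comp.
by apply: measurable_cos_dotv; [exact: measurable_snd|exact: measurable_fst].
Qed.

Lemma cos_transformN f x : cos_transform f (scalev (-1) x) = cos_transform f x.
Proof. by apply: eq_Rintegral => xi _; rewrite dotvE mulN1r cosN. Qed.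

Lemma le_cos_transform f x : lam.-integrable setT (EFin \o f) ->
  `|cos_transform f x| <= \int[lam]_xi `|f xi|.
Proof.
move=> fi; apply: le_trans (le_normr_Rintegral measurableT (integrable_cos_mul x fi)) _.
apply: le_Rintegral => //.
- exact: integrable_norm (integrable_cos_mul x fi).
- exact: integrable_norm fi.
- by move=> xi _; rewrite normrM ler_piMl// cos_norm_le1.
Qed.

Lemma cos_transform_cvg (f_ : nat -> Rn R n -> R) f g x :
  (forall m, measurable_fun setT (f_ m)) ->
  (forall xi, f_ ^~ xi @ \oo --> f xi) ->
  lam.-integrable setT (EFin \o g) -> (forall m xi, `|f_ m xi| <= g xi) ->
  cos_transform (f_ m) x @[m --> \oo] --> cos_transform f x.
Proof.
move=> mf ff ig fg.
have H1 m : measurable_fun setT (fun xi => cos (dotv xi x) * f_ m xi).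
  by apply: measurable_funM => //; exact: measurable_cos_dotvr.
have H2 xi : (cos (dotv xi x) * f_ m xi) @[m --> \oo] --> cos (dotv xi x) * f xi.
  by apply: cvgM; [exact: cvg_cst|exact: ff].
have H3 m xi : `|cos (dotv xi x) * f_ m xi| <= g xi.
  by rewrite normrM (le_trans _ (fg m xi))// ler_piMl// cos_norm_le1.
by have [] := Rintegral_dominated_cvg H1 H2 ig H3.
Qed.

Definition unimodal g := (forall x, 0 <= g x) /\
  forall x y, normv x <= normv y -> g y <= g x.

Lemma unimodal_radial g x y : unimodal g -> normv x = normv y -> g x = g y.
Proof. by move=> [_ h] e; apply/eqP; rewrite eq_le !h// e. Qed.

Lemma unimodal_cvg (g_ : nat -> Rn R n -> R) g :
  (forall m, unimodal (g_ m)) -> (forall x, g_ ^~ x @ \oo --> g x) -> unimodal g.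
Proof.
move=> ug cg; split=> [x|x y xy].
  by apply: (cvgr_to_ge (cg x)); apply: nearW => m; have [] := ug m.
by apply: (ler_cvg_to (cg y) (cg x)); apply: nearW => m; have [_] := ug m; exact.
Qed.

Lemma unimodal0 : unimodal (cst 0).
Proof. by split. Qed.

Lemma unimodalD f g : unimodal f -> unimodal g -> unimodal (fun x => f x + g x).
Proof.
move=> [f0 fd] [g0 gd]; split=> [x|x y xy]; first by rewrite addr_ge0.
by rewrite lerD ?fd ?gd.
Qed.

Lemma unimodalZ (c : R) f : 0 <= c -> unimodal f -> unimodal (fun x => c * f x).
Proof.
move=> c0 [f0 fd]; split=> [x|x y xy]; first by rewrite mulr_ge0.
by rewrite ler_wpM2l ?fd.
Qed.

(** The usual convolution when [k] is even; the argument [z - x] matches the form [p_t (y - x)] of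
    the kernel. *)
Definition convol g k x := \int[lam]_z (g z * k (subv z x)).

Lemma integrable_convol g k x M : measurable_fun setT g -> (forall z, `|g z| <= M) ->
  lam.-integrable setT (EFin \o k) ->
  lam.-integrable setT (EFin \o (fun z => g z * k (subv z x))).
Proof.
move=> mg gM ik; have mk : measurable_fun setT k.
  exact: integrable_EFin_measurable ik.
apply: (@integrable_bounded_mul _ _ R lam _ (fun z => k (subv z x)) M).
- apply: measurable_funM => //; apply: (measurableT_comp mk); exact: measurable_subv.
- apply/integrableP; split.
    apply/measurable_EFinP/(measurableT_comp mk); exact: measurable_subv.
  have mak : measurable_fun setT (abse \o (EFin \o k)).
    by apply: measurableT_comp => //; exact/measurable_EFinP.
  have /integrableP[_] := ik; apply: le_lt_trans.
  rewrite -[leRHS](integral_plusv (scalev (-1) x) mak) le_eqVlt; apply/orP; left.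
  by apply/eqP; apply: eq_integral => z _; rewrite /= subvN.
- by move=> z; rewrite normrM ler_wpM2r.
Qed.

(* With [r] the reflection exchanging [x] and [y], the two factors of
   [(g z - g (r z)) * (k (z - x) - k (z - y))] always have the same sign. *)
Lemma unimodal_convol g k M : measurable_fun setT g -> (forall z, `|g z| <= M) ->
  lam.-integrable setT (EFin \o k) -> unimodal g -> unimodal k -> unimodal (convol g k).
Proof.
move=> mg gM ik [g0 gd] [k0 kd]; split=> [x|x y xy].
  by apply: Rintegral_ge0 => z _; rewrite mulr_ge0.
have [->//|/eqP nxy] := eqVneq x y.
have mk : measurable_fun setT k by exact: integrable_EFin_measurable ik.
pose r := reflv x y.
have kr z : k (subv (r z) x) = k (subv z y).
  have E : normv (subv (r z) x) = normv (subv z y).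
    by rewrite -(reflv_dist nxy) reflvK// reflv_l.
  by apply/eqP; rewrite eq_le !kd ?E.
have kr' z : k (subv (r z) y) = k (subv z x).
  have E : normv (subv (r z) y) = normv (subv z x).
    by rewrite -[in LHS](reflv_l nxy) (reflv_dist nxy).
  by apply/eqP; rewrite eq_le !kd ?E.
have mgk a : measurable_fun setT (fun z => g z * k (subv z a)).
  by apply: measurable_funM => //; apply: (measurableT_comp mk); exact: measurable_subv.
have mgr : measurable_fun setT (fun z => g (r z)).
  by apply: (measurableT_comp mg); exact: measurable_reflv.
have mgkr a : measurable_fun setT (fun z => g (r z) * k (subv z a)).
  by apply: measurable_funM => //; apply: (measurableT_comp mk); exact: measurable_subv.
have Ex : (\int[lam]_z (g z * k (subv z x))%:E = \int[lam]_z (g (r z) * k (subv z y))%:E)%E.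
  rewrite -(integral_reflv nxy); last exact/measurable_EFinP.
  by apply: eq_integral => z _; rewrite -/(r z) kr.
have Ey : (\int[lam]_z (g z * k (subv z y))%:E = \int[lam]_z (g (r z) * k (subv z x))%:E)%E.
  rewrite -(integral_reflv nxy); last exact/measurable_EFinP.
  by apply: eq_integral => z _; rewrite -/(r z) kr'.
have ix a : (\int[lam]_z (g z * k (subv z a))%:E)%E \is a fin_num.
  exact: (integrable_fin_num measurableT (integrable_convol a mg gM ik)).
have gk0 a z : (0 <= (g z * k (subv z a))%:E)%E by rewrite lee_fin mulr_ge0.
have gkr0 a z : (0 <= (g (r z) * k (subv z a))%:E)%E by rewrite lee_fin mulr_ge0.
rewrite /convol /Rintegral -lee_fin !fineK//.
(* The integral of [(g z - g (r z)) * (k (z - x) - k (z - y))] is nonnegative. Its negative terms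
   stand on the left so that only nonnegative integrals occur; by [Ex] and [Ey] the two sides are
   twice the convolution at [y] and at [x]. *)
have : (\int[lam]_z (g z * k (subv z y))%:E + \int[lam]_z (g (r z) * k (subv z x))%:E
     <= \int[lam]_z (g z * k (subv z x))%:E + \int[lam]_z (g (r z) * k (subv z y))%:E)%E.
  rewrite -!ge0_integralD//; try by move=> *; exact: gk0.
  all: try by move=> *; exact: gkr0.
  all: try by exact/measurable_EFinP.
  apply: ge0_le_integral => //.
  - by move=> z _; rewrite adde_ge0.
  - by apply: emeasurable_funD; exact/measurable_EFinP.
  - by apply: emeasurable_funD; exact/measurable_EFinP.
  move=> z _; rewrite -!EFinD lee_fin.
  have [h|/ltW h] := leP (normv (subv z x)) (normv (subv z y)).
  - suff : normv z <= normv (r z).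
      move/gd => h1; have := kd _ _ h; nra.
    rewrite -(@ler_pXn2r _ 2)// ?nnegrE ?normv_ge0// -subr_ge0 normv_reflv//.
    rewrite mulr_ge0// ?divr_ge0 ?dotv_ge0// subr_ge0 ler_pXn2r// ?nnegrE ?normv_ge0//.
  - suff : normv (r z) <= normv z.
      move/gd => h1; have := kd _ _ h; nra.
    rewrite -(@ler_pXn2r _ 2)// ?nnegrE ?normv_ge0// -subr_le0 normv_reflv//.
    rewrite mulr_le0_ge0// ?subr_ge0 ?ler_pXn2r// ?nnegrE ?normv_ge0//.
    by rewrite mulr_le0_ge0 ?invr_ge0 ?dotv_ge0// subr_le0 ler_pXn2r// ?nnegrE ?normv_ge0//.
rewrite -Ex -Ey -(fineK (ix x)) -(fineK (ix y)) -!EFinD !lee_fin; lra.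
Qed.

End cos_transform.

Section Rintegral_Fubini.
Context d1 d2 (T1 : measurableType d1) (T2 : measurableType d2) (R : realType).
Variables (m1 : {sigma_finite_measure set T1 -> \bar R})
          (m2 : {sigma_finite_measure set T2 -> \bar R}).

(** The product majorant makes [F] integrable for the product measure, which is what signed Fubini
    asks for. *)
Lemma Rintegral_Fubini (F : T1 * T2 -> R) (a : T1 -> R) (b : T2 -> R) :
  measurable_fun setT F -> m1.-integrable setT (EFin \o a) ->
  m2.-integrable setT (EFin \o b) -> (forall x y, `|F (x, y)| <= `|a x| * `|b y|) ->
  \int[m1]_x \int[m2]_y F (x, y) = \int[m2]_y \int[m1]_x F (x, y).
Proof.
move=> mF ia ib Fab.
have mF1 x : measurable_fun setT (fun y => F (x, y)).
  by apply: (measurableT_comp mF); exact: pair1_measurable.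
have mF2 y : measurable_fun setT (fun x => F (x, y)).
  by apply: (measurableT_comp mF); exact: pair2_measurable.
have i1 x : m2.-integrable setT (EFin \o (fun y => F (x, y))).
  by apply: (@integrable_bounded_mul _ _ R m2 _ b `|a x|).
have i2 y : m1.-integrable setT (EFin \o (fun x => F (x, y))).
  by apply: (@integrable_bounded_mul _ _ R m1 _ a `|b y|) => // x; rewrite mulrC.
have iF : (m1 \x m2)%E.-integrable setT (EFin \o F).
  apply/integrable12ltyP; first exact/measurable_EFinP.
  have /integrableP[mb bfin] := ib; have /integrableP[ma afin] := ia.
  apply: (@le_lt_trans _ _ (\int[m1]_x (`|a x|%:E * \int[m2]_y `|b y|%:E))%E).
    apply: ge0_le_integral => //.
    - by move=> x _; exact: integral_ge0.
    - apply: (@measurable_integral_param _ _ _ _ _ m2 (fun u => `|(F u)%:E|%E)).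
      by apply: measurableT_comp => //; exact/measurable_EFinP.
    - apply: emeasurable_funM => //; apply/measurable_EFinP.
      by apply: measurableT_comp => //; exact: integrable_EFin_measurable ia.
    - move=> x _; rewrite -ge0_integralZl; [|exact: measurableT| |by []|by []]; last first.
        by apply/measurable_EFinP/measurableT_comp => //; exact: integrable_EFin_measurable ib.
      apply: ge0_le_integral => //.
      + by apply: measurableT_comp => //; exact/measurable_EFinP.
      + apply: emeasurable_funM => //; apply/measurable_EFinP.
        by apply: measurableT_comp => //; exact: integrable_EFin_measurable ib.
      + by move=> y _; rewrite lee_fin.
  rewrite ge0_integralZr; [|exact: measurableT| |by []|exact: integral_ge0]; last first.
    by apply/measurable_EFinP/measurableT_comp => //; exact: integrable_EFin_measurable ia.
  by rewrite lte_mul_pinfty ?ge0_fin_numE ?integral_ge0//.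
rewrite /Rintegral; congr fine.
rewrite (_ : (\int[m1]_x _)%E = (\int[m1]_x \int[m2]_y (F (x, y))%:E)%E); last first.
  by apply: eq_integral => x _; rewrite fineK// (integrable_fin_num measurableT (i1 x)).
rewrite (Fubini iF); apply: eq_integral => y _.
by rewrite fineK// (integrable_fin_num measurableT (i2 y)).
Qed.

End Rintegral_Fubini.

Section cos_transform_product.
Context {R : realType} {n : nat}.
Notation lam := (lebesgue_Rn R n).
Implicit Types (f g k : Rn R n -> R) (x y xi : Rn R n).

Lemma Rintegral_plusv (a : Rn R n) f : measurable_fun setT f ->
  \int[lam]_x f (plusv x a) = \int[lam]_x f x.
Proof.
move=> mf; rewrite /Rintegral -[in RHS](integral_plusv a)//; exact/measurable_EFinP.
Qed.

Lemma Rintegral_oppv f : measurable_fun setT f ->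
  \int[lam]_x f (scalev (-1) x) = \int[lam]_x f x.
Proof.
move=> mf; rewrite /Rintegral -[in RHS](integral_oppv)//; exact/measurable_EFinP.
Qed.

Lemma cos_transform_mul f k x :
  lam.-integrable setT (EFin \o f) -> lam.-integrable setT (EFin \o k) ->
  (forall z, k (scalev (-1) z) = k z) ->
  cos_transform (fun xi => f xi * cos_transform k xi) x = convol (cos_transform f) k x.
Proof.
move=> fi ki kN.
have mf := integrable_EFin_measurable fi.
have mk := integrable_EFin_measurable ki.
pose F (u : Rn R n * Rn R n) := (cos (dotv u.1 x) * f u.1) * (cos (dotv u.2 u.1) * k u.2).
have mF : measurable_fun setT F.
  apply: measurable_funM; apply: measurable_funM.
  - exact: (measurableT_comp (measurable_cos_dotvr x)).
  - exact: measurableT_comp.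
  - by apply: measurable_cos_dotv; [exact: measurable_snd|exact: measurable_fst].
  - exact: measurableT_comp.
pose g := cos_transform f.
have mg : measurable_fun setT g by exact: measurable_cos_transform.
have ig a : lam.-integrable setT (EFin \o (fun z => k z * g (plusv a z))).
  apply: (@integrable_bounded_mul _ _ R lam _ k (\int[lam]_xi `|f xi|)) => //.
    apply: measurable_funM => //; apply: (measurableT_comp mg).
    by apply: (@measurable_plusv _ _ _ _ (cst a) id).
  by move=> z; rewrite normrM mulrC ler_wpM2r// le_cos_transform.
have ig' a : lam.-integrable setT (EFin \o (fun z => k z * g (subv a z))).
  apply: (@integrable_bounded_mul _ _ R lam _ k (\int[lam]_xi `|f xi|)) => //.
    apply: measurable_funM => //; apply: (measurableT_comp mg).
    by apply: (@measurable_subv _ _ _ _ (cst a) id).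
  by move=> z; rewrite normrM mulrC ler_wpM2r// le_cos_transform.
transitivity (\int[lam]_xi \int[lam]_z F (xi, z)).
  apply: eq_Rintegral => xi _; rewrite /F/= RintegralZl//; last exact: integrable_cos_mul.
  by rewrite mulrA.
rewrite (Rintegral_Fubini mF fi ki); last first.
  move=> xi z; rewrite /F /= normrM; apply: ler_pM => //;
    by rewrite normrM ler_piMl// cos_norm_le1.
have cosM (a b : R) : cos a * cos b = 2^-1 * cos (a + b) + 2^-1 * cos (a - b).
  by rewrite cosD cosB; field.
transitivity (\int[lam]_z (2^-1 * (k z * g (plusv x z)) + 2^-1 * (k z * g (subv x z)))).
  apply: eq_Rintegral => z _.
  have E xi : F (xi, z) = (2^-1 * k z) * (cos (dotv xi (plusv x z)) * f xi) +
      (2^-1 * k z) * (cos (dotv xi (subv x z)) * f xi).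
    rewrite /F /= !dotvE mulrACA (dotvC z xi) cosM; ring.
  under eq_Rintegral do rewrite E.
  have iZ a : lam.-integrable setT (EFin \o (fun xi => 2^-1 * k z * (cos (dotv xi a) * f xi))).
    have := integrableZl measurableT (2^-1 * k z) (integrable_cos_mul a fi).
    by under eq_fun do rewrite -EFinM.
  rewrite RintegralD//; try exact: iZ.
  rewrite !RintegralZl//; try exact: integrable_cos_mul.
  by rewrite !mulrA.
have iZ2 h : lam.-integrable setT (EFin \o h) ->
    lam.-integrable setT (EFin \o (fun xi => 2^-1 * h xi)).
  move=> ih; have := integrableZl measurableT 2^-1 ih.
  by under eq_fun do rewrite -EFinM.
rewrite RintegralD//; [|exact: iZ2|exact: iZ2].
rewrite !RintegralZl//.
have A1 : \int[lam]_z (k z * g (plusv x z)) = convol g k x.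
  rewrite /convol -[RHS](Rintegral_plusv x).
    by apply: eq_Rintegral => z _; rewrite plusvK mulrC plusvC.
  apply: measurable_funM => //; apply: (measurableT_comp mk).
  by apply: (@measurable_subv _ _ _ _ id (cst x)).
have A2 : \int[lam]_z (k z * g (subv x z)) = convol g k x.
  rewrite -A1 -[RHS]Rintegral_oppv.
    by apply: eq_Rintegral => z _; rewrite kN subvN.
  apply: measurable_funM => //; apply: (measurableT_comp mg).
  by apply: (@measurable_plusv _ _ _ _ (cst x) id).
by rewrite A1 A2 -/g; field.
Qed.

End cos_transform_product.

Section gaussian_transform.
Context {R : realType}.
Notation mu := (@lebesgue_measure R).
Notation lam n := (lebesgue_Rn R n).

(** Here [u] is signed, as it will be a cosine times a Gaussian; Tonelli, in the form [key], is
    applied to its positive and negative parts. *)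
Lemma Rintegral_consv_mul n (u : R -> R) (v : Rn R n -> R) (V : R) :
  mu.-integrable setT (EFin \o u) -> measurable_fun setT v -> (forall x, 0 <= v x) ->
  (\int[lam n]_x (v x)%:E = V%:E)%E ->
  \int[lam n.+1]_x (u (tnth x ord0) * v (tailv x)) = \int[mu]_a u a * V.
Proof.
move=> ui mv v0 vV; have mu_ := integrable_EFin_measurable ui.
have V0 : 0 <= V by rewrite -lee_fin -vV integral_ge0// => x _; rewrite lee_fin.
have key (w : R -> R) : measurable_fun setT w -> (forall a, 0 <= w a) ->
    (\int[lam n.+1]_x (w (tnth x ord0) * v (tailv x))%:E = \int[mu]_a (w a)%:E * V%:E)%E.
  move=> mw w0; rewrite ge0_integral_lebesgue_succ; last 2 first.
  - apply/measurable_EFinP/measurable_funM.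
      by apply: (measurableT_comp mw); exact: measurable_tnth.
    by apply: (measurableT_comp mv); exact: measurable_tailv.
  - by move=> x; rewrite lee_fin mulr_ge0.
  rewrite -ge0_integralZr; [|exact: measurableT|exact/measurable_EFinP|by move=> x _; rewrite lee_fin|by rewrite lee_fin].
  apply: eq_integral => a _; rewrite -vV -ge0_integralZl; [|exact: measurableT|exact/measurable_EFinP|by move=> x _; rewrite lee_fin|by rewrite lee_fin].
  apply: eq_integral => x _; rewrite tnth_consv0 EFinM; congr (_ * (v _)%:E)%E.
  exact: val_inj.
have uE : (\int[lam n.+1]_x (u (tnth x ord0) * v (tailv x))%:E = \int[mu]_a (u a)%:E * V%:E)%E.
  rewrite integralE [in RHS]integralE.
  have -> : (\int[lam n.+1]_x ((fun x => (u (tnth x ord0) * v (tailv x))%:E)^\+ x) =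
      \int[mu]_a (u^\+ a)%:E * V%:E)%E.
    rewrite -key; [|exact: measurable_funrpos|by move=> a; rewrite /funrpos le_max lexx orbT].
    apply: eq_integral => x _; rewrite funeposE -EFin_max /funrpos maxr_pMl ?mul0r//.
  have -> : (\int[lam n.+1]_x ((fun x => (u (tnth x ord0) * v (tailv x))%:E)^\- x) =
      \int[mu]_a (u^\- a)%:E * V%:E)%E.
    rewrite -key; [|exact: measurable_funrneg|by move=> a; rewrite /funrneg le_max lexx orbT].
    apply: eq_integral => x _; rewrite funenegE -EFinN -EFin_max /funrneg maxr_pMl ?mul0r ?mulNr//.
  have E1 : (\int[mu]_a ((fun a => (u a)%:E)^\+ a) = \int[mu]_a (u^\+ a)%:E)%E.
    by apply: eq_integral => a _; rewrite funeposE -EFin_max.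
  have E2 : (\int[mu]_a ((fun a => (u a)%:E)^\- a) = \int[mu]_a (u^\- a)%:E)%E.
    by apply: eq_integral => a _; rewrite funenegE -EFinN -EFin_max.
  rewrite E1 E2; apply/esym/muleBl => //; apply: fin_num_adde_defl.
  by rewrite fin_numN -E2; have := integrable_neg_fin_num measurableT ui.
rewrite /Rintegral uE fineM//; exact: integrable_fin_num.
Qed.

Lemma axisv_consv n (r : R) : axisv r = consv (r, @zerov R n) :> Rn R n.+1.
Proof.
by apply: tuple_eqS => [|i]; rewrite tnth_mktuple ?tnth_consv0 ?tnth_consvS ?tnthE.
Qed.

Lemma normv_axisv n (r : R) : normv (axisv r : Rn R n.+1) = `|r|.
Proof. by rewrite axisv_consv /normv dotv_consv dotv0l addr0 -expr2 sqrtr_sqr. Qed.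

(** By [integral_radial] the point [x] may be placed on the first axis, where the integral splits
    into a one-dimensional cosine integral and a Gaussian mass in the other coordinates. *)
Lemma cos_transform_gaussv n (s : R) (x : Rn R n) : 0 < s ->
  cos_transform (gaussv s) x = Num.sqrt (pi / s) ^+ n * expR (- (dotv x x / (4 * s))).
Proof.
move=> s0; case: n x => [|n] x.
  rewrite /cos_transform /Rintegral.
  under eq_integral do rewrite {1}/dotv big_ord0 cos0 mul1r.
  by rewrite integral_gaussv// /dotv big_ord0 mul0r oppr0 expR0 mulr1.
pose F (r v : R) := (cos v * expR (- (s * r ^+ 2)))%:E.
have FE (y : Rn R n.+1) : cos_transform (gaussv s) y =
    fine (\int[lam n.+1]_z F (normv z) (dotv z y)).
  by congr fine; apply: eq_integral => z _; rewrite /F normv_sqr.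
rewrite FE (@integral_radial _ _ F x (axisv (normv x))); last 2 first.
- apply/measurable_EFinP; apply: measurable_funM; first exact: measurable_cos_dotvr.
  apply: (measurableT_comp (f := @expR R)) => //; apply: measurable_funN.
  apply: measurable_funM => //; apply: measurable_funX.
  exact: (@measurable_normv _ _ _ _ _ id).
- by rewrite normv_axisv ger0_norm// normv_ge0.
rewrite -FE /cos_transform.
transitivity (\int[lam n.+1]_z ((fun a => cos (a * normv x) * gaussr s a) (tnth z ord0) *
   gaussv s (tailv z))).
  apply: eq_Rintegral => z _; rewrite [in LHS](consv_surj z) axisv_consv dotv_consv dotv0r addr0.
  by rewrite gaussv_consv mulrA.
rewrite (@Rintegral_consv_mul n (fun a => cos (a * normv x) * gaussr s a) _ (Num.sqrt (pi / s) ^+ n)).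
- by rewrite Rintegral_cos_gaussr// normv_sqr exprSr; ring.
- exact: integrable_cos_gaussr.
- exact: measurable_gaussv.
- by move=> y; exact: gaussv_ge0.
- exact: integral_gaussv.
Qed.

Lemma unimodal_cos_transform_gaussv n (s : R) : 0 < s ->
  unimodal (cos_transform (gaussv s) : Rn R n -> R).
Proof.
move=> s0; split=> [x|x y xy]; rewrite !cos_transform_gaussv//.
rewrite ler_wpM2l ?exprn_ge0 ?sqrtr_ge0// ler_expR lerN2 ler_pM2r ?invr_gt0 ?mulr_gt0//.
by rewrite -ler_normv.
Qed.

End gaussian_transform.

Section exponential.
Context {R : realType} {n : nat}.
Notation lam := (lebesgue_Rn R n).
Implicit Types (f g k : Rn R n -> R) (x y xi : Rn R n).

Lemma series_exp_coeff_abs (x : R) m : `|series (exp_coeff x) m| <= expR `|x|.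
Proof.
apply: (@le_trans _ _ (series (exp_coeff `|x|) m)).
  rewrite /series/= (le_trans (ler_norm_sum _ _ _))//.
  by apply: ler_sum => i _; rewrite normrM normrX ler_wpM2l ?exprn_ge0// ger0_norm// invr_ge0.
apply: nondecreasing_cvgn_le; last exact: is_cvg_series_exp_coeff.
apply/nondecreasing_seqP => i; rewrite /series/= big_nat_recr//= lerDl.
by rewrite divr_ge0// exprn_ge0.
Qed.

(** Expanding the exponential gives terms [f * K^j] with nonnegative coefficients, and each has a
    unimodal transform. The factor [f] supplies integrability: [K] is merely bounded, by [L], so the
    partial sums are dominated by [exp (t L) |f|]. *)
Lemma unimodal_cos_transform_exp f k (t : R) : 0 <= t ->
  lam.-integrable setT (EFin \o f) -> unimodal (cos_transform f) ->
  lam.-integrable setT (EFin \o k) -> unimodal k ->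
  unimodal (cos_transform (fun xi => f xi * expR (t * cos_transform k xi))).
Proof.
move=> t0 fi uf ki uk.
pose K := cos_transform k; pose L := \int[lam]_z `|k z|.
have mf := integrable_EFin_measurable fi.
have mk := integrable_EFin_measurable ki.
have mK : measurable_fun setT K by exact: measurable_cos_transform.
have KL xi : `|K xi| <= L by exact: le_cos_transform.
have kN z : k (scalev (-1) z) = k z.
  by apply: (unimodal_radial uk); rewrite normvZ normrN1 mul1r.
have mfK j : measurable_fun setT (fun xi => f xi * K xi ^+ j).
  by apply: measurable_funM => //; exact: measurable_funX.
have fKi j : lam.-integrable setT (EFin \o (fun xi => f xi * K xi ^+ j)).
  apply: (@integrable_bounded_mul _ _ R lam _ f (L ^+ j)) => //.
  by move=> xi; rewrite normrM mulrC ler_wpM2r// normrX lerXn2r ?nnegrE// (le_trans _ (KL xi)).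
have ufK j : unimodal (cos_transform (fun xi => f xi * K xi ^+ j)).
  elim: j => [|j ih].
    by rewrite (_ : (fun xi => _) = f)//; apply/funext => xi; rewrite expr0 mulr1.
  (* One more factor [K] in the symbol is one more convolution with [k], which preserves
     unimodality. *)
  rewrite (_ : cos_transform _ = convol (cos_transform (fun xi => f xi * K xi ^+ j)) k).
    apply: (@unimodal_convol _ _ _ _ (\int[lam]_xi `|f xi * K xi ^+ j|)) => //.
      exact: measurable_cos_transform.
    by move=> z; exact: le_cos_transform.
  apply/funext => x; rewrite -cos_transform_mul//.
  by apply: eq_Rintegral => xi _; rewrite exprSr (mulrA (f xi)).
pose f_ m xi := f xi * series (exp_coeff (t * K xi)) m.
have mf_ m : measurable_fun setT (f_ m).
  apply: measurable_funM => //; rewrite /series/=.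
  apply: measurable_sum => i; apply: measurable_funM => //; apply: measurable_funX.
  exact: measurable_funM.
have f_i m : lam.-integrable setT (EFin \o f_ m).
  apply: (@integrable_bounded_mul _ _ R lam _ f (expR (t * L))) => //.
  move=> xi; rewrite normrM mulrC ler_wpM2r// (le_trans (series_exp_coeff_abs _ _))//.
  by rewrite ler_expR normrM (ger0_norm t0) ler_wpM2l.
apply: (unimodal_cvg (g_ := fun m => cos_transform (f_ m))); last first.
  move=> x; apply: (@cos_transform_cvg _ _ f_ _ (fun xi => expR (t * L) * `|f xi|)) => //.
  - by move=> xi; apply: cvgM; [exact: cvg_cst|exact: is_cvg_series_exp_coeff].
  - by have := integrableZl measurableT (expR (t * L)) (integrable_norm fi).
  - move=> m xi; rewrite normrM mulrC ler_wpM2r// (le_trans (series_exp_coeff_abs _ _))//.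
    by rewrite ler_expR normrM (ger0_norm t0) ler_wpM2l.
elim=> [|m ih].
  rewrite (_ : cos_transform (f_ 0%N) = cst 0); first exact: unimodal0.
  apply/funext => x; rewrite /cos_transform.
  under eq_Rintegral do rewrite /f_ /series/= big_geq// mulr0 mulr0.
  by rewrite Rintegral_cst// mul0r.
rewrite (_ : cos_transform (f_ m.+1) = fun x => cos_transform (f_ m) x +
    t ^+ m / m`!%:R * cos_transform (fun xi => f xi * K xi ^+ m) x).
  apply: unimodalD => //; apply: unimodalZ => //.
  by rewrite divr_ge0// exprn_ge0.
apply/funext => x; rewrite /cos_transform -RintegralZl//; last exact: integrable_cos_mul.
rewrite -RintegralD//; [|exact: integrable_cos_mul|]; last first.
  have := integrableZl measurableT (t ^+ m / m`!%:R) (integrable_cos_mul x (fKi m)).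
  by under eq_fun do rewrite -EFinM.
apply: eq_Rintegral => xi _; rewrite /f_ /series/= big_nat_recr//= /exp_coeff/= exprMn; ring.
Qed.

End exponential.

(** * The Levy exponent *)

Section density.
Local Open Scope ereal_scope.
Context d (T : measurableType d) (R : realType).
Variables (nu mu : {measure set T -> \bar R}) (k : T -> R).
Hypotheses (mk : measurable_fun setT k) (k0 : forall x, (0 <= k x)%R).
Hypothesis nuE : forall A, measurable A -> nu A = \int[mu]_(x in A) (k x)%:E.

Let mkE : measurable_fun setT (EFin \o k). Proof. exact/measurable_EFinP. Qed.

Import HBNNSimple.

Let integral_density_nnsfun (h : {nnsfun T >-> R}) :
  \int[nu]_x (h x)%:E = \int[mu]_x ((h x)%:E * (k x)%:E).
Proof.
rewrite integralT_nnsfun sintegralE.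
under eq_fsbigr.
  move=> r _; rewrite nuE; last by [].
  rewrite integral_mkcond.
  over.
rewrite /=.
transitivity (\sum_(r \in range h) \int[mu]_x (r * \1_(h @^-1` [set r]) x * k x)%:E).
  apply: eq_fsbigr => r /[!inE] -[t _ <-].
  have mh : measurable (h @^-1` [set h t]) by [].
  rewrite -ge0_integralZl; last 4 first.
  - exact: measurableT.
  - exact: (proj1 (measurable_restrictT _ mh) (measurable_funTS mkE)).
  - by move=> x _; rewrite patchE; case: ifP => // _; rewrite lee_fin.
  - by rewrite lee_fin.
  apply: eq_integral => x _; rewrite patchE indicE.
  by case: ifP => _ /=; rewrite ?mulr1 ?mulr0 ?mul0r ?mule0 ?EFinM.
rewrite -ge0_integral_fsum//; last 2 first.
- move=> r; apply/measurable_EFinP; apply: measurable_funM => //.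
  by apply: measurable_funM => //; exact: measurable_indic.
- move=> r x _; rewrite lee_fin mulr_ge0//.
  have [rx|rx] := eqVneq (h x) r; first by rewrite -rx mulr_ge0.
  by rewrite indicE memNset ?mulr0//=; apply/eqP.
apply: eq_integral => x _; rewrite [in RHS]fimfunE -EFinM.
rewrite fsumEFin// ; congr EFin.
by rewrite mulr_fsuml.
Qed.

(** [nuE] settles indicators, hence simple functions; increasing approximation and monotone
    convergence on both sides do the rest. *)
Lemma ge0_integral_density (f : T -> \bar R) :
  measurable_fun setT f -> (forall x, 0 <= f x) ->
  \int[nu]_x f x = \int[mu]_x (f x * (k x)%:E).
Proof.
move=> mf f0; pose f_ := nnsfun_approx measurableT mf.
have cf x : (f_ n x)%:E @[n --> \oo] --> f x by exact: (cvg_nnsfun_approx measurableT mf).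
transitivity (limn (fun n => \int[nu]_x (f_ n x)%:E)).
  rewrite -monotone_convergence//=.
  - by apply: eq_integral => x _; apply/esym/cvg_lim.
  - by move=> n; exact/measurable_EFinP.
  - by move=> n x _; rewrite lee_fin.
  - by move=> x _ a b ab; rewrite lee_fin//; exact/lefP/nd_nnsfun_approx.
transitivity (limn (fun n => \int[mu]_x ((f_ n x)%:E * (k x)%:E))).
  by congr (limn _); apply/funext => n; exact: integral_density_nnsfun.
rewrite -monotone_convergence//=.
- apply: eq_integral => x _; apply/cvg_lim => //.
  by apply: cvgeZr => //; exact: cf.
- by move=> n; apply: emeasurable_funM => //; exact/measurable_EFinP.
- by move=> n x _; rewrite mule_ge0 ?lee_fin.
- by move=> x _ a b ab; rewrite lee_wpmul2r ?lee_fin//; exact/lefP/nd_nnsfun_approx.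
Qed.

End density.

Section cosine_bound.
Context {R : realType}.

Lemma sin_le_id (u : R) : 0 <= u -> sin u <= u.
Proof.
move=> u0; rewrite -subr_ge0.
have D (x : R) : is_derive x (1 : R) (fun z : R => z - sin z) (1 - cos x).
  by apply: is_derive_eq.
have := @ger0_derive1_ndecry R (fun z => z - sin z) 0.
move=> /(_ _ _ _ 0 u (lexx _) u0); rewrite sin0 subr0; apply.
- by move=> x _; case: (D x).
- by move=> x _; rewrite derive1E; case: (D x) => _ ->; rewrite subr_ge0 cos_le1.
- apply: continuous_subspaceT => x; apply: cvgB; [exact: cvg_id|exact: continuous_sin].
Qed.

(** For [u >= 0] a negative sine forces [u > 1], because [pi >= 2], and then [|sin u| <= 1 <= u]
    suffices. *)
Lemma sin_sqr_le (u : R) : sin u ^+ 2 <= u ^+ 2.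
Proof.
wlog u0 : u / 0 <= u.
  move=> H; have [|/ltW u0] := leP 0 u; first exact: H.
  by have := H (- u); rewrite sinN !sqrrN oppr_ge0; exact.
have [h|h] := leP 0 (sin u); first by rewrite lerXn2r ?nnegrE// sin_le_id.
have [u1|u1] := leP 1 u.
  apply: (@le_trans _ _ 1); last by rewrite exprn_ege1.
  by rewrite sin2cos2 gerBl sqr_ge0.
have : 0 <= sin u.
  apply: sin_ge0_pi; rewrite u0 (le_trans (ltW u1))//.
  by have := @pi_ge2 R; lra.
by rewrite leNgt h.
Qed.

Lemma cos_ge_sqr (u : R) : 1 - cos u <= u ^+ 2 / 2.
Proof.
have -> : cos u = 1 - 2 * sin (u / 2) ^+ 2.
  have {1}-> : u = (u / 2) *+ 2 by rewrite mulr2n; field.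
  by rewrite cos_mulr2n sin2cos2 mulr2n; ring.
have := sin_sqr_le (u / 2); rewrite expr_div_n; lra.
Qed.

End cosine_bound.

(** * Volumes of balls *)

Section balls.
Context {R : realType} {n : nat}.
Notation lam := (lebesgue_Rn R n).

Definition ballv (r : R) : set (Rn R n) := [set x | normv x <= r].

Lemma measurable_ballv r : measurable (ballv r).
Proof.
rewrite -[ballv r]setTI; apply: (measurable_fun_ler _ _ measurableT (Y := [set true])) => //.
exact: (@measurable_normv _ _ _ _ _ id).
Qed.

Lemma lebesgue_ballv_scale (r : R) : 0 < r ->
  lam (ballv r) = ((r ^+ n)%:E * lam (ballv 1))%E.
Proof.
move=> r0; have mB := measurable_ballv.
have E s : lam (ballv s) = (\int[lam]_x (\1_(ballv s) x)%:E)%E.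
  by rewrite integral_indic// setIT.
rewrite !E (@ge0_integral_scalev _ _ r)//; last 2 first.
- by rewrite gt_eqF.
- by apply/measurable_EFinP; exact: measurable_indic.
rewrite gtr0_norm//; congr (_ * _)%E; apply: eq_integral => x _.
rewrite !indicE (_ : (scalev r x \in ballv r) = (x \in ballv 1))//.
by apply/idP/idP; rewrite !inE /ballv/= normvZ gtr0_norm// ger_pMr.
Qed.

(** On the unit ball the Gaussian is at least [exp (-1)], and its total mass is finite. *)
Lemma lebesgue_ballv1_lty : (lam (ballv 1) < +oo)%E.
Proof.
have mB := @measurable_ballv 1.
have : ((expR (-1))%:E * lam (ballv 1) < +oo)%E.
  apply: (@le_lt_trans _ _ (\int[lam]_x (gaussv 1 x)%:E)%E); last by rewrite integral_gaussv// ltry.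
  rewrite -integral_cst// integral_mkcond; apply: ge0_le_integral => //.
  - by move=> x _; rewrite patchE; case: ifP => // _; rewrite lee_fin expR_ge0.
  - exact: (proj1 (measurable_restrictT _ mB)).
  - by apply/measurable_EFinP; exact: measurable_gaussv.
  - move=> x _; rewrite patchE; case: ifPn => [|_]; last by rewrite lee_fin gaussv_ge0.
    rewrite inE /ballv /= => x1; rewrite lee_fin ler_expR lerN2 mul1r -normv_sqr.
    by rewrite exprn_ile1// normv_ge0.
case: (lam (ballv 1)) (measure_ge0 lam (ballv 1)) => [r _ _|_|//]; first by rewrite ltry.
by rewrite gt0_muley// lte_fin expR_gt0.
Qed.

(** If the unit ball were null, so would be all its dilates and their union, the whole space; this
    contradicts the positive Gaussian mass. *)
Lemma lebesgue_ballv1_gt0 : (0 < lam (ballv 1))%E.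
Proof.
rewrite lt_neqAle measure_ge0 andbT; apply/negP => /eqP B0.
have mB := measurable_ballv.
have Un : \bigcup_m ballv m.+1%:R = [set: Rn R n].
  apply/seteqP; split=> // x _; exists (Num.truncn (normv x)) => //.
  by rewrite /ballv/= ltW// truncnS_gt.
have : (lam \o (fun m => ballv m.+1%:R)) @ \oo --> lam [set: Rn R n].
  rewrite -Un; apply: nondecreasing_cvg_mu => //.
    by rewrite Un; exact: measurableT.
  move=> i j ij; apply/subsetPset => x; rewrite /ballv /= => h.
  by apply: le_trans h _; rewrite ler_nat.
have -> : lam \o (fun m => ballv m.+1%:R) = cst 0%E.
  by apply/funext => m; rewrite /= lebesgue_ballv_scale// -B0 mule0.
move=> /cvg_lim => /(_ (@ereal_hausdorff R)); rewrite lim_cst// => T0.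
have := @integral_gaussv R n 1 ltr01.
rewrite null_set_integral//; last by apply/measurable_EFinP; exact: measurable_gaussv.
case=> h; have /eqP := esym h.
by rewrite expf_eq0 divr1 sqrtr_eq0 leNgt pi_gt0 andbF.
Qed.

Definition ball_volume : R := fine (lam (ballv 1)).

Lemma ball_volume_gt0 : 0 < ball_volume.
Proof. by apply: fine_gt0; rewrite lebesgue_ballv1_gt0 lebesgue_ballv1_lty. Qed.

Lemma lebesgue_ballv (r : R) : 0 < r -> lam (ballv r) = (r ^+ n * ball_volume)%:E.
Proof.
move=> r0; rewrite lebesgue_ballv_scale// EFinM fineK// ge0_fin_numE//.
exact: lebesgue_ballv1_lty.
Qed.

End balls.

(** The dimension must be positive: on [R^0] the origin has mass 1. Otherwise the origin lies in
    balls of arbitrarily small volume. *)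
Lemma lebesgue_set0v {R : realType} n : lebesgue_Rn R n.+1 [set zerov] = 0%E.
Proof.
have m0 : measurable [set (@zerov R n.+1)].
  have -> : [set (@zerov R n.+1)] = ballv 0.
    apply/seteqP; split=> x; rewrite /ballv/=; first by move=> ->; rewrite normv0.
    by move=> x0; apply: normv_eq0; apply/eqP; rewrite eq_le x0 normv_ge0.
  exact: measurable_ballv.
have V0 := @ball_volume_gt0 R n.+1.
apply/eqP; rewrite eq_le measure_ge0 andbT; apply/lee_addgt0Pr => e e0; rewrite add0e.
pose r := Num.min 1 (e / @ball_volume R n.+1).
have r0 : 0 < r by rewrite lt_min ltr01 divr_gt0.
apply: (@le_trans _ _ (lebesgue_Rn R n.+1 (ballv r))).
  apply: (le_measure _ (mem_set m0) (mem_set (measurable_ballv r))).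
  by move=> x ->; rewrite /ballv/= normv0 ltW.
rewrite lebesgue_ballv// lee_fin -ler_pdivlMr// exprS.
apply: (@le_trans _ _ (r * 1)); last by rewrite mulr1 ge_min lexx orbT.
by rewrite ler_wpM2l ?(ltW r0)// exprn_ile1 ?(ltW r0)// ge_min lexx.
Qed.

(** * The Levy density and its truncations *)

Section levy_density.
Context {R : realType} {n : nat}.
Notation lam := (lebesgue_Rn R n.+1).
Variables (nu : {measure set (Rn R n.+1) -> \bar R}) (nur : R -> R).
Hypothesis Hnu : infinite_isotropic_unimodal_levy nu nur.
Notation Psi := (levy_exponent nu).

Let nur0 r : 0 < r -> 0 <= nur r. Proof. by case: Hnu => h _ _ _ _; exact: h. Qed.
Let nur_decr r s : 0 < r -> r <= s -> nur s <= nur r.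
Proof. by case: Hnu => _ h _ _ _; exact: h. Qed.
Let nuE A : measurable A -> nu A = (\int[lam]_(x in A) (nur (normv x))%:E)%E.
Proof. by case: Hnu => _ _ h _ _; exact: h. Qed.

(** The value [N] for [r <= 0] makes the profile nonincreasing on the whole line, hence measurable,
    and makes [trunc_density] unimodal up to the origin. *)
Definition trunc_profile (N : nat) (r : R) : R :=
  if 0 < r then Num.min N%:R (nur r) else N%:R.

Lemma trunc_profile_ge0 N r : 0 <= trunc_profile N r.
Proof. by rewrite /trunc_profile; case: ifP => // r0; rewrite le_min ler0n nur0. Qed.

Lemma trunc_profile_decr N r s : r <= s -> trunc_profile N s <= trunc_profile N r.
Proof.
move=> rs; rewrite /trunc_profile; case: ifPn => [s0|s0].
  case: ifPn => [r0|_]; last by rewrite ge_min lexx.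
  by rewrite le_min ge_min lexx/= ge_min nur_decr ?orbT.
by rewrite ifN// -leNgt (le_trans rs)// leNgt.
Qed.

(** The value [nur 0] is arbitrary, so it is replaced by 0; the origin is a null set. *)
Definition levy_density (x : Rn R n.+1) : R := if 0 < normv x then nur (normv x) else 0.

Definition trunc_density (N : nat) (x : Rn R n.+1) : R := trunc_profile N (normv x).

Lemma unimodal_trunc_density N : unimodal (trunc_density N).
Proof.
by split=> [x|x y xy]; [exact: trunc_profile_ge0|exact: trunc_profile_decr].
Qed.

Lemma measurable_normv_id m : measurable_fun setT (@normv R m).
Proof. exact: (@measurable_normv _ _ _ _ _ id). Qed.

Lemma measurable_trunc_density N : measurable_fun setT (trunc_density N).
Proof.
apply: (measurableT_comp (f := trunc_profile N) _ (@measurable_normv_id _)).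
by apply: nonincreasing_measurable => // r s; exact: trunc_profile_decr.
Qed.

Lemma levy_density_ge0 x : 0 <= levy_density x.
Proof. by rewrite /levy_density; case: ifP => // /nur0. Qed.

Lemma trunc_density_cvg x : x <> zerov -> trunc_density N x @[N --> \oo] --> levy_density x.
Proof.
move=> /normv_gt0 x0; rewrite /levy_density x0 /trunc_density /trunc_profile x0.
apply: cvg_near_cst; near=> N; apply/min_idPr.
near: N; exists (Num.truncn (nur (normv x))).+1 => // m /= h.
by apply: le_trans (ltW (truncnS_gt _)) _; rewrite ler_nat.
Unshelve. all: by end_near. Qed.

Let tv0 (x : Rn R n.+1) : (normv x <= 0) = (x == zerov).
Proof.
apply/idP/eqP => [x0|->]; last by rewrite normv0.
by apply: normv_eq0; apply/eqP; rewrite eq_le x0 normv_ge0.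
Qed.

(** Measurability of [nur] is not a hypothesis; it is extracted from monotonicity, through the
    bounded truncations. *)
Lemma measurable_levy_density : measurable_fun setT levy_density.
Proof.
apply: (measurable_fun_cvg (h := fun N x => if 0 < normv x then trunc_density N x else 0)).
  move=> N; apply: measurable_fun_ifT => //; last exact: measurable_trunc_density.
  apply: measurable_fun_ltr => //; exact: measurable_normv_id.
move=> x _; have [x0|/negbTE x0] := boolP (0 < normv x).
  by apply: trunc_density_cvg => xe; rewrite xe normv0 ltxx in x0.
by rewrite /levy_density x0; exact: cvg_cst.
Qed.

Lemma trunc_density_le N x : x <> zerov -> trunc_density N x <= levy_density x.
Proof.
move=> /normv_gt0 x0; rewrite /levy_density x0 /trunc_density /trunc_profile x0.
by rewrite ge_min lexx orbT.
Qed.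

Lemma ae_neq0 (P : Rn R n.+1 -> Prop) : (forall x, x <> zerov -> P x) ->
  {ae lam, forall x, P x}.
Proof.
move=> HP; exists [set zerov]; split.
- have -> : [set (@zerov R n.+1)] = ballv 0.
    by apply/seteqP; split=> x; rewrite /ballv/= tv0 => /eqP.
  exact: measurable_ballv.
- exact: lebesgue_set0v.
- by move=> x /= /contra_notP; apply => /HP.
Qed.

Lemma levy_densityE A : measurable A ->
  nu A = (\int[lam]_(x in A) (levy_density x)%:E)%E.
Proof.
move=> mA; rewrite nuE//; apply: ae_eq_integral => //.
- apply/measurable_EFinP; apply: measurable_funTS.
  rewrite (_ : (fun x => _) = fun x => if 0 < normv x then levy_density x else nur 0).
    apply: measurable_fun_ifT => //; last exact: measurable_levy_density.
    apply: measurable_fun_ltr => //; exact: measurable_normv_id.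
  apply/funext => x; rewrite /levy_density; have [//|] := ltP 0 (normv x).
  by rewrite tv0 => /eqP ->; rewrite normv0.
- apply/measurable_EFinP; apply: measurable_funTS; exact: measurable_levy_density.
- apply: ae_neq0 => x /normv_gt0 x0 _; by rewrite /levy_density x0.
Qed.

Lemma integral_levy (f : Rn R n.+1 -> \bar R) : measurable_fun setT f ->
  (forall x, 0 <= f x)%E -> (\int[nu]_x f x = \int[lam]_x (f x * (levy_density x)%:E))%E.
Proof.
apply: ge0_integral_density; last exact: levy_densityE.
- exact: measurable_levy_density.
- exact: levy_density_ge0.
Qed.

(** Its integrability is the Levy condition on [nu]. Up to a constant depending on [xi] it dominates
    [(1 - cos) * k], which is how limits are taken in the Levy exponent. *)
Definition levy_weight (x : Rn R n.+1) : R := Num.min (normv x ^+ 2) 1 * levy_density x.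

Lemma integrable_levy_weight : lam.-integrable setT (EFin \o levy_weight).
Proof.
have m1 : measurable_fun setT (fun x : Rn R n.+1 => Num.min (normv x ^+ 2) 1).
  by apply: measurable_minr => //; apply: measurable_funX; exact: measurable_normv_id.
have ge0 x : 0 <= Num.min (@normv R n.+1 x ^+ 2) 1 by rewrite le_min sqr_ge0 ler01.
apply/integrableP; split.
  by apply/measurable_EFinP/measurable_funM => //; exact: measurable_levy_density.
have [_ _ _ _] := Hnu; apply: le_lt_trans.
rewrite [leRHS]integral_mkcond (_ : _ \_ _ = (fun x => (Num.min (normv x ^+ 2) 1)%:E)).
  rewrite integral_levy => [||x]; [|exact/measurable_EFinP|by rewrite lee_fin].
  rewrite le_eqVlt; apply/orP; left; apply/eqP; apply: eq_integral => x _.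
  by rewrite /= ger0_norm ?mulr_ge0 ?levy_density_ge0.
apply/funext => x; rewrite patchE; case: ifPn => //; rewrite notin_setE /= => /contrapT ->.
by rewrite normv0 expr0n/= min_l.
Qed.

End levy_density.

Section levy_exponent_theory.
Context {R : realType} {n : nat}.
Notation lam := (lebesgue_Rn R n.+1).
Variables (nu : {measure set (Rn R n.+1) -> \bar R}) (nur : R -> R).
Hypothesis Hnu : infinite_isotropic_unimodal_levy nu nur.
Notation Psi := (levy_exponent nu).
Notation k := (@levy_density R n nur).
Notation kN := (@trunc_density R n nur).
Notation W := (@levy_weight R n nur).

Let mk : measurable_fun setT k := measurable_levy_density Hnu.
Let mkN N : measurable_fun setT (kN N) := measurable_trunc_density Hnu N.
Let k0 x : 0 <= k x := levy_density_ge0 Hnu x.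
Let kN0 N x : 0 <= kN N x. Proof. exact: (trunc_profile_ge0 Hnu). Qed.

Let W0 x : 0 <= W x.
Proof. by rewrite mulr_ge0// le_min sqr_ge0 ler01. Qed.

Let m1cos (xi : Rn R n.+1) : measurable_fun setT (fun z => 1 - cos (dotv xi z)).
Proof.
by apply: measurable_funB => //; apply: (@measurable_cos_dotv _ _ _ _ (cst xi) id).
Qed.

Lemma one_sub_cos_le (xi z : Rn R n.+1) : 0 <= 1 - cos (dotv xi z) <=
  2 * (1 + normv xi ^+ 2) * Num.min (normv z ^+ 2) 1.
Proof.
rewrite subr_ge0 cos_le1/=.
have x0 := sqr_ge0 (normv xi); have z0 := sqr_ge0 (normv z).
have [z1|z1] := leP (normv z ^+ 2) 1.
  apply: le_trans (cos_ge_sqr _) _.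
  have := dotv_CauchySchwarz xi z; rewrite -!normv_sqr; nra.
have := cos_geN1 (dotv xi z); nra.
Qed.

Let bound_k (xi : Rn R n.+1) z :
  `|(1 - cos (dotv xi z)) * k z| <= 2 * (1 + normv xi ^+ 2) * W z.
Proof.
have /andP[h1 h2] := one_sub_cos_le xi z.
by rewrite ger0_norm ?mulr_ge0// /levy_weight mulrA ler_wpM2r.
Qed.

Lemma levy_exponentE xi : Psi xi = \int[lam]_z ((1 - cos (dotv xi z)) * k z).
Proof.
rewrite /levy_exponent /Rintegral (integral_levy Hnu); last 2 first.
- exact/measurable_EFinP.
- by move=> z; rewrite lee_fin subr_ge0 cos_le1.
by congr fine; apply: eq_integral => z _; rewrite EFinM.
Qed.

Lemma levy_exponent_ge0 xi : 0 <= Psi xi.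
Proof. by apply: Rintegral_ge0 => z _; rewrite subr_ge0 cos_le1. Qed.

Lemma levy_exponent0 : Psi zerov = 0.
Proof.
rewrite levy_exponentE; under eq_Rintegral do rewrite dotv0l cos0 subrr mul0r.
by rewrite Rintegral_cst// mul0r.
Qed.

Lemma measurable_levy_exponent : measurable_fun setT Psi.
Proof.
rewrite (_ : Psi = fun xi => \int[lam]_z ((1 - cos (dotv xi z)) * k z)); last first.
  by apply/funext => xi; exact: levy_exponentE.
apply: (@measurable_Rintegral_param _ _ _ _ _ lam
  (fun u => (1 - cos (dotv u.1 u.2)) * k u.2)).
apply: measurable_funM; last exact: measurableT_comp.
apply: measurable_funB => //.
by apply: measurable_cos_dotv; [exact: measurable_fst|exact: measurable_snd].
Qed.

Lemma levy_exponent_radial xi eta : normv xi = normv eta -> Psi xi = Psi eta.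
Proof.
move=> e; rewrite !levy_exponentE /Rintegral.
pose F (r v : R) := ((1 - cos v) * (if 0 < r then nur r else 0))%:E.
have FE x : (\int[lam]_z ((1 - cos (dotv x z)) * k z)%:E =
    \int[lam]_z F (normv z) (dotv z x))%E.
  by apply: eq_integral => z _; rewrite dotvC.
rewrite !FE; congr fine; apply: integral_radial => //.
have := measurable_funM (m1cos xi) mk => /measurable_EFinP.
by apply: eq_measurable_fun => z _; rewrite /= dotvC.
Qed.

(** Boundedness of the sequence gives one multiple of [levy_weight] as a common majorant. This is
    the continuity of [Psi] used for Gaussian averages. *)
Lemma levy_exponent_cvg (xi_ : nat -> Rn R n.+1) xi (r : R) :
  (forall m, normv (xi_ m) <= r) ->
  (forall z, dotv (xi_ m) z @[m --> \oo] --> dotv xi z) ->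
  Psi (xi_ m) @[m --> \oo] --> Psi xi.
Proof.
move=> xr xc; rewrite levy_exponentE; under eq_fun do rewrite levy_exponentE.
have r0 : 0 <= r by rewrite (le_trans _ (xr 0%N))// normv_ge0.
have H1 m : measurable_fun setT (fun z => (1 - cos (dotv (xi_ m) z)) * k z).
  exact: measurable_funM.
have H2 z : (1 - cos (dotv (xi_ m) z)) * k z @[m --> \oo] --> (1 - cos (dotv xi z)) * k z.
  apply: cvgM; last exact: cvg_cst.
  apply: cvgB; first exact: cvg_cst.
  by apply: (cvg_comp _ _ (xc z)); exact: continuous_cos.
have H3 m z : `|(1 - cos (dotv (xi_ m) z)) * k z| <= 2 * (1 + r ^+ 2) * W z.
  apply: le_trans (bound_k _ _) _; rewrite ler_wpM2r// ler_wpM2l// lerD2l.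
  by rewrite lerXn2r ?nnegrE ?normv_ge0.
have iW : lam.-integrable setT (EFin \o (fun z => 2 * (1 + r ^+ 2) * W z)).
  have := integrableZl measurableT (2 * (1 + r ^+ 2)) (integrable_levy_weight Hnu).
  by under eq_fun do rewrite -EFinM.
by have [] := Rintegral_dominated_cvg H1 H2 iW H3.
Qed.

(** The truncation is at most [N] on the unit ball; outside it is at most [levy_weight], whose
    minimum equals 1 there. *)
Lemma integrable_trunc_density N : lam.-integrable setT (EFin \o kN N).
Proof.
have mB := @measurable_ballv R n.+1 1.
have iB : lam.-integrable setT (EFin \o (fun x => N%:R * \1_(ballv 1) x)).
  have i1 : lam.-integrable setT (EFin \o (\1_(ballv 1) : _ -> R)).
    apply/integrableP; split; first exact/measurable_EFinP/measurable_indic.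
    under eq_integral do rewrite /= ger0_norm//.
    by rewrite integral_indic// setIT lebesgue_ballv1_lty.
  have := integrableZl measurableT (N%:R : R) i1.
  by under eq_fun do rewrite -EFinM.
have iS : lam.-integrable setT (EFin \o (fun x => N%:R * \1_(ballv 1) x + W x)).
  have := integrableD measurableT iB (integrable_levy_weight Hnu).
  by apply: (eq_integrable measurableT) => x _ /=.
apply: (@integrable_bounded_mul _ _ R lam _ _ 1 (mkN N) iS) => x.
rewrite mul1r !ger0_norm//; last by rewrite addr_ge0// mulr_ge0.
have [x1|x1] := leP (normv x) 1.
  rewrite indicE mem_set// mulr1 (@le_trans _ _ N%:R)// ?lerDl//.
  by rewrite /trunc_density /trunc_profile; case: ifP => // _; rewrite ge_min lexx.
rewrite ler_wpDl ?mulr_ge0//.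
have xn0 : x <> zerov by move=> xe; rewrite xe normv0 ltr10 in x1.
apply: le_trans (trunc_density_le _ _ xn0) _.
by rewrite /levy_weight min_r ?mul1r// exprn_ege1// ltW.
Qed.

(** The exponent of the finite measure with density [kN N], a compound Poisson exponent:
    [exp (- t * trunc_exponent)] is a constant times the exponential of [t] times the cosine
    transform of a unimodal function. *)
Definition trunc_exponent N xi : R :=
  \int[lam]_z kN N z - cos_transform (kN N) xi.

Lemma trunc_exponentE N xi :
  trunc_exponent N xi = \int[lam]_z ((1 - cos (dotv xi z)) * kN N z).
Proof.
rewrite /trunc_exponent /cos_transform -RintegralB//.
- by apply: eq_Rintegral => z _; rewrite dotvC; ring.
- exact: integrable_trunc_density.
- exact: integrable_cos_mul (integrable_trunc_density N).
Qed.

Lemma trunc_exponent_ge0 N xi : 0 <= trunc_exponent N xi.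
Proof.
by rewrite trunc_exponentE Rintegral_ge0// => z _; rewrite mulr_ge0// subr_ge0 cos_le1.
Qed.

Lemma trunc_exponent_cvg xi : trunc_exponent N xi @[N --> \oo] --> Psi xi.
Proof.
rewrite levy_exponentE; under eq_fun do rewrite trunc_exponentE.
have H1 N : measurable_fun setT (fun z => (1 - cos (dotv xi z)) * kN N z).
  exact: measurable_funM.
have H2 z : (1 - cos (dotv xi z)) * kN N z @[N --> \oo] --> (1 - cos (dotv xi z)) * k z.
  have [->|/eqP z0] := eqVneq z zerov.
    by under eq_fun do rewrite dotv0r cos0 subrr mul0r; rewrite dotv0r cos0 subrr mul0r; exact: cvg_cst.
  by apply: cvgM; [exact: cvg_cst|exact: trunc_density_cvg].
have H3 N z : `|(1 - cos (dotv xi z)) * kN N z| <= 2 * (1 + normv xi ^+ 2) * W z.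
  have [->|/eqP z0] := eqVneq z zerov.
    by rewrite dotv0r cos0 subrr mul0r normr0 mulr_ge0// mulr_ge0// addr_ge0// sqr_ge0.
  apply: le_trans (bound_k _ _); rewrite !normrM ler_wpM2l// !ger0_norm//.
  exact: trunc_density_le.
have iW : lam.-integrable setT (EFin \o (fun z => 2 * (1 + normv xi ^+ 2) * W z)).
  have := integrableZl measurableT (2 * (1 + normv xi ^+ 2)) (integrable_levy_weight Hnu).
  by under eq_fun do rewrite -EFinM.
by have [] := Rintegral_dominated_cvg H1 H2 iW H3.
Qed.

Lemma gaussv_scale_cvg1 (xi : Rn R n.+1) : gaussv m.+1%:R^-1 xi @[m --> \oo] --> (1 : R).
Proof.
have h : - (m.+1%:R^-1 * dotv xi xi) @[m --> \oo] --> (0 : R).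
  rewrite -[X in _ --> X]oppr0; apply: cvgN.
  rewrite -(mul0r (dotv xi xi)); apply: cvgM; last exact: cvg_cst.
  exact: cvg_harmonic.
have := @continuous_cvg nat R R \oo _ _ expR 0 (@continuous_expR R 0) h.
by rewrite expR0; apply.
Qed.

(** Truncated exponents are bounded, so [exp (- t * trunc_exponent)] is not integrable; a Gaussian
    factor repairs this. The truncation is removed at a fixed Gaussian, which is the majorant; then
    the Gaussian is flattened, with [exp (- t Psi)] as majorant. *)
Lemma unimodal_cos_transform_expN t : 0 <= t ->
  lam.-integrable setT (EFin \o (fun xi => expR (- t * Psi xi))) ->
  unimodal (cos_transform (fun xi => expR (- t * Psi xi))).
Proof.
move=> t0 iP; have mP := measurable_levy_exponent.
have U1 s N : 0 < s ->
    unimodal (cos_transform (fun xi => gaussv s xi * expR (- t * trunc_exponent N xi))).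
  move=> s0; have ikN := integrable_trunc_density N.
  have ig := @integrable_gaussv R n.+1 s s0.
  rewrite (_ : cos_transform _ = fun x => expR (- t * \int[lam]_z kN N z) *
      cos_transform (fun xi => gaussv s xi * expR (t * cos_transform (kN N) xi)) x).
    apply: unimodalZ; first exact: expR_ge0.
    apply: unimodal_cos_transform_exp => //; first exact: unimodal_cos_transform_gaussv.
    exact: unimodal_trunc_density Hnu N.
  apply/funext => x; rewrite /cos_transform -RintegralZl//.
    apply: eq_Rintegral => xi _.
    have -> : - t * trunc_exponent N xi =
        - t * (\int[lam]_z kN N z) + t * cos_transform (kN N) xi.
      by rewrite /trunc_exponent; ring.
    by rewrite expRD; ring.
  apply: integrable_cos_mul.
  apply: (@integrable_bounded_mul _ _ R lam _ (gaussv s) (expR (t * \int[lam]_z `|kN N z|))) => //.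
    apply: measurable_funM; first exact: measurable_gaussv.
    apply: (measurableT_comp (f := @expR R)) => //; apply: measurable_funM => //.
    exact: measurable_cos_transform.
  move=> xi; rewrite normrM mulrC ler_wpM2r// ger0_norm ?expR_ge0// ler_expR ler_wpM2l//.
  by apply: le_trans (ler_norm _) _; exact: le_cos_transform.
have mt N : measurable_fun setT (fun xi => expR (- t * trunc_exponent N xi)).
  apply: (measurableT_comp (f := @expR R)) => //; apply: measurable_funM => //.
  by apply: measurable_funB => //; exact: measurable_cos_transform.
have e1 (a : R) : 0 <= a -> expR (- t * a) <= 1.
  by move=> a0; rewrite -expR0 ler_expR mulNr oppr_le0 mulr_ge0.
have U2 s : 0 < s -> unimodal (cos_transform (fun xi => gaussv s xi * expR (- t * Psi xi))).
  move=> s0; apply: (unimodal_cvg (fun N => U1 s N s0)) => x.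
  apply: (cos_transform_cvg (g := gaussv s)).
  - by move=> N; apply: measurable_funM => //; exact: measurable_gaussv.
  - move=> xi; apply: cvgM; first exact: cvg_cst.
    apply: (continuous_cvg _ (@continuous_expR R _)).
    by apply: cvgM; [exact: cvg_cst|exact: trunc_exponent_cvg].
  - exact: integrable_gaussv.
  - move=> N xi; rewrite ger0_norm ?mulr_ge0 ?expR_ge0//.
    by rewrite ler_piMr ?gaussv_ge0// e1// trunc_exponent_ge0.
have me : measurable_fun setT (fun xi => expR (- t * Psi xi)).
  exact: integrable_EFin_measurable iP.
apply: (unimodal_cvg (fun m => U2 m.+1%:R^-1 _)) => [m|x]; first by rewrite invr_gt0.
apply: (cos_transform_cvg (g := fun xi => expR (- t * Psi xi))) => //.
- by move=> m; apply: measurable_funM => //; exact: measurable_gaussv.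
- move=> xi; rewrite -[X in _ --> X]mul1r; apply: cvgM; last exact: cvg_cst.
  exact: gaussv_scale_cvg1.
- move=> m xi; rewrite ger0_norm ?mulr_ge0 ?expR_ge0//.
  rewrite ler_piMl ?expR_ge0// -expR0 ler_expR oppr_le0 mulr_ge0 ?dotv_ge0//.
Qed.

Lemma heat_densityE t x : heat_density Psi t x =
  (2 * pi) ^- n.+1 * cos_transform (fun xi => expR (- t * Psi xi)) x.
Proof.
rewrite /heat_density /complex_integral /= mul0r subr0; congr (_ * _).
by apply: eq_Rintegral => xi _ /=; rewrite mulr0 subr0.
Qed.

End levy_exponent_theory.

(** * The heat semigroup *)

Section heat_semigroup.
Context {R : realType} {n : nat}.
Notation lam := (lebesgue_Rn R n.+1).
Notation N := n.+1.
Variables (nu : {measure set (Rn R n.+1) -> \bar R}) (nur : R -> R).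
Hypothesis Hnu : infinite_isotropic_unimodal_levy nu nur.
Notation Psi := (levy_exponent nu).
Hypothesis iP : forall t, 0 < t ->
  lam.-integrable setT (EFin \o (fun xi => expR (- t * Psi xi))).

Let e (t : R) (xi : Rn R N) : R := expR (- t * Psi xi).
Let C t := cos_transform (e t).

Let e0 t xi : 0 <= e t xi. Proof. exact: expR_ge0. Qed.
Let e1 t xi : 0 < t -> e t xi <= 1.
Proof.
by move=> t0; rewrite -expR0 ler_expR mulNr oppr_le0 mulr_ge0 ?(ltW t0)// levy_exponent_ge0.
Qed.
Let me t : measurable_fun setT (e t).
Proof.
apply: (measurableT_comp (f := @expR R)) => //; apply: measurable_funM => //.
exact: measurable_levy_exponent Hnu.
Qed.
Let eN t xi : e t (scalev (-1) xi) = e t xi.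
Proof.
rewrite /e (levy_exponent_radial Hnu (eta := xi))//.
by rewrite normvZ normrN1 mul1r.
Qed.
Let uC t : 0 < t -> unimodal (C t).
Proof. by move=> t0; apply: (unimodal_cos_transform_expN Hnu (ltW t0)); exact: iP. Qed.
Let mC t : measurable_fun setT (C t).
Proof. exact: measurable_cos_transform. Qed.

(** Spatial cutoff, removed as [rho] tends to 0. The factor 1/4 is chosen so that its transform,
    rescaled by [rho], is proportional to [gaussv 1]. *)
Let gm (rho : R) : Rn R N -> R := gaussv (rho ^+ 2 / 4).
Let M (t rho : R) := cos_transform (fun z => gm rho z * C t z).

Let gm_pos (rho : R) : 0 < rho -> 0 < rho ^+ 2 / 4.
Proof. by move=> r0; rewrite divr_gt0// exprn_gt0. Qed.

(** By the product rule the transform of the cut-off [C t] is a convolution, and rescaling by [rho]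
    exhibits it as a Gaussian average of [e t] near [- eta]. *)
Let ME (t rho : R) eta : 0 < t -> 0 < rho -> M t rho eta =
  (2 * Num.sqrt pi) ^+ N * \int[lam]_w (gaussv 1 w * e t (subv (scalev rho w) eta)).
Proof.
move=> t0 r0; have s0 := gm_pos r0.
rewrite /M cos_transform_mul; [|exact: integrable_gaussv|exact: iP|exact: eN].
pose f (z : Rn R N) := cos_transform (gm rho) z * e t (subv z eta).
have f0 z : 0 <= f z.
  by rewrite mulr_ge0//; have [] := @unimodal_cos_transform_gaussv R N _ s0.
have mes : measurable_fun setT (fun z => e t (subv z eta)).
  by apply: (measurableT_comp (me t)); apply: (@measurable_subv _ _ _ _ id (cst eta)).
have mf : measurable_fun setT f.
  apply: measurable_funM => //; apply: measurable_cos_transform; exact: measurable_gaussv.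
have mg : measurable_fun setT (fun w => gaussv 1 w * e t (subv (scalev rho w) eta)).
  apply: measurable_funM; first exact: measurable_gaussv.
  apply: (measurableT_comp mes).
  exact: (@measurable_scalev _ _ _ _ (cst rho) id).
have S : Num.sqrt (pi / (rho ^+ 2 / 4)) = 2 * Num.sqrt pi / rho.
  rewrite (_ : pi / _ = (2 / rho) ^+ 2 * pi); last by field; rewrite gt_eqF.
  rewrite sqrtrM ?sqr_ge0// sqrtr_sqr ger0_norm ?divr_ge0 ?(ltW r0)//; field.
  by rewrite gt_eqF.
have fE w : f (scalev rho w) = (2 * Num.sqrt pi / rho) ^+ N *
    (gaussv 1 w * e t (subv (scalev rho w) eta)).
  rewrite /f cos_transform_gaussv// S [RHS]mulrA; congr (_ * expR _ * _).
  by rewrite !dotvE; field; rewrite gt_eqF.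
have mEf : measurable_fun setT (EFin \o f) by apply/measurable_EFinP; exact: mf.
rewrite (_ : convol _ _ _ = fine (\int[lam]_z (EFin \o f) z)%E); last by [].
rewrite (@ge0_integral_scalev _ _ rho (EFin \o f)); last 3 first.
- by rewrite gt_eqF.
- exact: mEf.
- by move=> z; rewrite lee_fin.
have -> : (\int[lam]_w (EFin \o f) (scalev rho w) = \int[lam]_w (((2 * Num.sqrt pi / rho) ^+ N)%:E *
    (gaussv 1 w * e t (subv (scalev rho w) eta))%:E))%E.
  by apply: eq_integral => w _; rewrite -EFinM -fE.
rewrite ge0_integralZl; last 4 first.
- exact: measurableT.
- by apply/measurable_EFinP; exact: mg.
- by move=> w _; rewrite lee_fin mulr_ge0// gaussv_ge0.
- by rewrite lee_fin exprn_ge0// divr_ge0 ?(ltW r0)// mulr_ge0// sqrtr_ge0.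
rewrite muleA -EFinM gtr0_norm// -exprMn mulrC divfK ?gt_eqF//.
rewrite fineM//; apply: (integrable_fin_num measurableT).
apply: (@integrable_bounded_mul _ _ R lam _ (gaussv 1) 1 mg); first exact: integrable_gaussv.
by move=> w; rewrite normrM mulrC ler_wpM2r// ger0_norm// e1.
Qed.

Let sqrtpi2 : (2 * Num.sqrt pi) ^+ N * Num.sqrt (pi / 1) ^+ N = (2 * pi) ^+ N :> R.
Proof. by rewrite -exprMn divr1 -mulrA -expr2 sqr_sqrtr ?pi_ge0. Qed.

Let mge t rho eta : measurable_fun setT (fun w => gaussv 1 w * e t (subv (scalev rho w) eta)).
Proof.
apply: measurable_funM; first exact: measurable_gaussv.
apply: (measurableT_comp (me t)); apply: (@measurable_subv _ _ _ _ (scalev rho) (cst eta)) => //.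
exact: (@measurable_scalev _ _ _ _ (cst rho) id).
Qed.

Let ge_le t (rho : R) eta w : 0 < t ->
  `|gaussv 1 w * e t (subv (scalev rho w) eta)| <= gaussv 1 w.
Proof.
move=> t0; have g0 := gaussv_ge0 1 w; have h0 : 0 <= e t (subv (scalev rho w) eta) by [].
rewrite (ger0_norm (mulr_ge0 g0 h0)); apply: ler_piMr; first exact: g0.
exact: e1.
Qed.

Let M_bound (t rho : R) eta : 0 < t -> 0 < rho -> `|M t rho eta| <= (2 * pi) ^+ N.
Proof.
move=> t0 r0; rewrite ME// ger0_norm; last first.
  rewrite mulr_ge0// ?exprn_ge0 ?mulr_ge0 ?sqrtr_ge0//.
  by apply: Rintegral_ge0 => w _; rewrite mulr_ge0// gaussv_ge0.
rewrite -sqrtpi2 ler_wpM2l// ?exprn_ge0 ?mulr_ge0 ?sqrtr_ge0//.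
have <- : \int[lam]_w gaussv 1 w = Num.sqrt (pi / 1) ^+ N.
  by rewrite /Rintegral integral_gaussv.
apply: le_Rintegral => //.
- apply: (@integrable_bounded_mul _ _ R lam _ (gaussv 1) 1) => //; first exact: integrable_gaussv.
  by move=> w; rewrite mul1r (ger0_norm (gaussv_ge0 _ _)) ge_le.
- exact: integrable_gaussv.
- by move=> w _; apply: le_trans (ler_norm _) (ge_le _ _ _ t0).
Qed.

Let rhom (m : nat) : R := m.+1%:R^-1.
Let rhom0 m : 0 < rhom m. Proof. by rewrite invr_gt0. Qed.

(** Fourier inversion in the limit: the averages in [ME] concentrate at [- eta], where [Psi] has the
    same value as at [eta], and the Gaussian dominates. *)
Let M_cvg t eta : 0 < t -> M t (rhom m) eta @[m --> \oo] --> (2 * pi) ^+ N * e t eta.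
Proof.
move=> t0; under eq_fun do rewrite ME//.
rewrite -sqrtpi2 -mulrA; apply: cvgM; first exact: cvg_cst.
have -> : Num.sqrt (pi / 1) ^+ N * e t eta = \int[lam]_w (gaussv 1 w * e t eta).
  by rewrite RintegralZr//; [rewrite /Rintegral integral_gaussv|exact: integrable_gaussv].
have H1 m := mge t (rhom m) eta.
have H2 w : gaussv 1 w * e t (subv (scalev (rhom m) w) eta) @[m --> \oo] --> gaussv 1 w * e t eta.
  apply: cvgM; first exact: cvg_cst.
  apply: continuous_cvg; first exact: continuous_expR.
  apply: cvgM; first exact: cvg_cst.
  rewrite -[in X in _ --> X](_ : Psi (scalev (-1) eta) = Psi eta); last first.
    by apply: (levy_exponent_radial Hnu); rewrite normvZ normrN1 mul1r.
  (* Since [rhom m <= 1], the points [rhom m w - eta] stay in one ball; the radius comes from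
     [|a - b|^2 <= 2 (|a|^2 + |b|^2)]. *)
  apply: (levy_exponent_cvg Hnu (r := Num.sqrt (2 * (dotv w w + dotv eta eta)))).
    move=> m; rewrite /normv ler_wsqrtr// !dotvE (dotvC w eta).
    have := dotv_ge0 (plusv (scalev (rhom m) w) eta).
    rewrite !dotvE (dotvC w eta).
    have r1 : rhom m <= 1 by rewrite invf_le1// ler1n.
    have : rhom m * (rhom m * dotv w w) <= dotv w w.
      by rewrite mulrA ler_piMl ?dotv_ge0// mulr_ile1// ltW// rhom0.
    lra.
  move=> z; rewrite dotvZl mulN1r.
  have h : rhom m * dotv w z - dotv eta z @[m --> \oo] --> 0 * dotv w z - dotv eta z.
    apply: cvgB; last exact: cvg_cst.
    by apply: cvgM; [exact: cvg_harmonic|exact: cvg_cst].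
  rewrite mul0r sub0r in h; apply: cvg_trans h; apply: near_eq_cvg; apply: nearW => m.
  by rewrite !dotvE.
have H3 m w := ge_le (rhom m) eta w t0.
by have [] := Rintegral_dominated_cvg H1 H2 (@integrable_gaussv R N 1 ltr01) H3.
Qed.

Let gm_ndecr z : nondecreasing_seq (fun m => gm (rhom m) z).
Proof.
move=> i j ij; rewrite /gm ler_expR lerN2 ler_wpM2r ?dotv_ge0// ler_wpM2r//.
rewrite lerXn2r ?nnegrE ?(ltW (rhom0 _))// lef_pV2 ?posrE// ler_nat//.
Qed.

Let gm_cvg z : gm (rhom m) z @[m --> \oo] --> (1 : R).
Proof.
rewrite -expR0; apply: continuous_cvg; first exact: continuous_expR.
rewrite -[X in _ --> X]oppr0; apply: cvgN.
rewrite -(mul0r (dotv z z)); apply: cvgM; last exact: cvg_cst.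
rewrite -(mul0r 4^-1); apply: cvgM; last exact: cvg_cst.
by rewrite -[X in _ --> X](mulr0 0); apply: cvgM; exact: cvg_harmonic.
Qed.

Let gmC_integrable t m : 0 < t ->
  lam.-integrable setT (EFin \o (fun z => gm (rhom m) z * C t z)).
Proof.
move=> t0; apply: (@integrable_bounded_mul _ _ R lam _ (gm (rhom m)) (\int[lam]_xi `|e t xi|)).
- by apply: measurable_funM => //; exact: measurable_gaussv.
- by apply: integrable_gaussv; exact: gm_pos.
- by move=> z; rewrite normrM mulrC ler_wpM2r// le_cos_transform// iP.
Qed.

(* Removing the Gaussian cutoff by monotone convergence. *)
Let cutoff_cvg (f : Rn R N -> R) (x : Rn R N) :
  measurable_fun setT f -> (forall z, 0 <= f z) ->
  (\int[lam]_z (f z * gm (rhom m) (subv z x))%:E @[m --> \oo] --> \int[lam]_z (f z)%:E)%E.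
Proof.
move=> mf f0.
rewrite (eq_integral (fun z => limn (fun m => (f z * gm (rhom m) (subv z x))%:E))); last first.
  move=> z _; apply/esym/cvg_lim => //; apply: cvg_EFin; first exact: nearW.
  by rewrite -[X in _ --> X]mulr1; apply: cvgM; [exact: cvg_cst|exact: gm_cvg].
apply: cvg_monotone_convergence => //.
- move=> m; apply/measurable_EFinP/measurable_funM => //.
  by apply: measurable_gaussv; apply: (@measurable_subv _ _ _ _ id (cst x)).
- by move=> m z _; rewrite lee_fin mulr_ge0// gaussv_ge0.
- by move=> z _ i j ij; rewrite lee_fin ler_wpM2l// gm_ndecr.
Qed.

Notation p := (heat_density Psi).
Let K : R := (2 * pi) ^- N.
Let K0 : 0 < K. Proof. by rewrite invr_gt0 exprn_gt0// mulr_gt0// pi_gt0. Qed.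
Let KK : K * (2 * pi) ^+ N = 1.
Proof. by rewrite mulVf// gt_eqF// exprn_gt0// mulr_gt0// pi_gt0. Qed.
Let pE t x : p t x = K * C t x. Proof. exact: heat_densityE. Qed.

Lemma unimodal_heat_density t : 0 < t -> unimodal (p t).
Proof.
move=> t0; rewrite (_ : p t = fun x => K * C t x); last by apply/funext.
by apply: unimodalZ; [exact: ltW|exact: uC].
Qed.

Lemma heat_density_ge0 t x : 0 < t -> 0 <= p t x.
Proof. by move=> /unimodal_heat_density[]. Qed.

(** The integral of the cut-off [C t] is [M] at the origin, at most [(2 pi)^N] by [M_bound]; the
    bound survives the monotone removal of the cutoff. *)
Lemma integral_heat_density_le1 t : 0 < t -> (\int[lam]_x (p t x)%:E <= 1)%E.
Proof.
move=> t0; have C0 x : 0 <= C t x by have [] := uC t0.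
have mCE : measurable_fun setT (EFin \o C t) by exact/measurable_EFinP.
have -> : (\int[lam]_x (p t x)%:E = K%:E * \int[lam]_x (C t x)%:E)%E.
  rewrite -ge0_integralZl; [|exact: measurableT|exact: mCE|by move=> x _; rewrite lee_fin|by rewrite lee_fin ltW].
  by apply: eq_integral => x _; rewrite pE EFinM.
have h : (\int[lam]_x (C t x)%:E <= ((2 * pi) ^+ N)%:E)%E.
  have L := cutoff_cvg zerov (mC t) C0.
  rewrite -(cvg_lim (@ereal_hausdorff R) L); apply: lime_le; first by apply/cvg_ex; eexists; exact: L.
  apply: nearW => m.
  have -> : (\int[lam]_z (C t z * gm (rhom m) (subv z zerov))%:E = (M t (rhom m) zerov)%:E)%E.
    rewrite EFin_Rintegral; last exact: integrable_cos_mul (gmC_integrable m t0).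
    by apply: eq_integral => z _; rewrite dotv0r cos0 mul1r subv_zerov mulrC.
  by rewrite lee_fin; apply: le_trans (ler_norm _) (M_bound _ _ _).
apply: (@le_trans _ _ (K%:E * ((2 * pi) ^+ N)%:E)%E); first by rewrite lee_pmul2l// lte_fin.
by rewrite -EFinM KK.
Qed.

(** With the cutoff on the factor [C t], the spatial integral is the cosine transform of [e s * M].
    One sequence is thus read in two ways: in space it converges monotonically to the convolution,
    on the Fourier side dominatedly to the transform of [e s * e t]. *)
Lemma heat_density_semigroup t s x : 0 < t -> 0 < s ->
  (\int[lam]_y (p t (subv y x) * p s y)%:E = (p (t + s) x)%:E)%E.
Proof.
move=> t0 s0; have Ct0 z : 0 <= C t z by have [] := uC t0.
have Cs0 z : 0 <= C s z by have [] := uC s0.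
pose f z := C s z * C t (subv z x).
have mf : measurable_fun setT f.
  apply: measurable_funM => //; apply: (measurableT_comp (mC t)).
  exact: (@measurable_subv _ _ _ _ id (cst x)).
have f0 z : 0 <= f z by rewrite mulr_ge0.
have -> : (\int[lam]_y (p t (subv y x) * p s y)%:E = (K * K)%:E * \int[lam]_y (f y)%:E)%E.
  rewrite -ge0_integralZl; [|exact: measurableT|exact/measurable_EFinP|by move=> y _; rewrite lee_fin|by rewrite lee_fin mulr_ge0// ltW].
  by apply: eq_integral => y _; rewrite !pE -EFinM /f; congr EFin; ring.
have L := cutoff_cvg x mf f0.
pose k m z := gm (rhom m) z * C t z.
have kN m z : k m (scalev (-1) z) = k m z.
  by rewrite /k /C cos_transformN /gm /gaussv !dotvE; congr (expR _ * _); ring.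
have L1 : (cos_transform (fun xi => e s xi * M t (rhom m) xi) x)%:E @[m --> \oo] -->
    (\int[lam]_y (f y)%:E)%E.
  apply: cvg_trans L; apply: near_eq_cvg; apply: nearW => m.
  rewrite /M cos_transform_mul; [|exact: iP|exact: gmC_integrable|exact: kN].
  rewrite /convol EFin_Rintegral.
    by apply: eq_integral => z _; rewrite /f -!mulrA (mulrC (gm _ _)).
  apply: (@integrable_convol _ _ (C s) (k m) x (\int[lam]_xi `|e s xi|)) => //.
    by move=> z; apply: le_cos_transform; exact: iP.
  exact: gmC_integrable.
have mM m : measurable_fun setT (M t (rhom m)).
  apply: measurable_cos_transform; apply: measurable_funM => //; exact: measurable_gaussv.
have L2 : cos_transform (fun xi => e s xi * M t (rhom m) xi) x @[m --> \oo] -->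
    cos_transform (fun xi => e s xi * ((2 * pi) ^+ N * e t xi)) x.
  apply: (@cos_transform_cvg _ _ (fun m xi => e s xi * M t (rhom m) xi) _
     (fun xi => (2 * pi) ^+ N * e s xi)).
  - by move=> m; apply: measurable_funM.
  - by move=> xi; apply: cvgM; [exact: cvg_cst|exact: M_cvg].
  - have := integrableZl measurableT ((2 * pi) ^+ N) (iP s0).
    by under eq_fun do rewrite -EFinM.
  - by move=> m xi; rewrite normrM mulrC (ger0_norm (e0 _ _)) ler_wpM2r// M_bound.
have L3 : (cos_transform (fun xi => e s xi * M t (rhom m) xi) x)%:E @[m --> \oo] -->
    (cos_transform (fun xi => e s xi * ((2 * pi) ^+ N * e t xi)) x)%:E.
  by apply: cvg_EFin; [exact: nearW|exact: L2].
rewrite (cvg_unique (@ereal_hausdorff R) L1 L3) -EFinM pE; congr EFin.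
have -> : cos_transform (fun xi => e s xi * ((2 * pi) ^+ N * e t xi)) x =
    (2 * pi) ^+ N * C (t + s) x.
  rewrite /C /cos_transform -RintegralZl//; last first.
    by apply: integrable_cos_mul; apply: iP; rewrite addr_gt0.
  apply: eq_Rintegral => xi _; rewrite /e.
  have -> : - (t + s) * Psi xi = - s * Psi xi + - t * Psi xi by ring.
  by rewrite expRD; ring.
by rewrite mulrA -(mulrA K K) KK mulr1.
Qed.

End heat_semigroup.

(** * Heat kernel estimates *)

Section power_integrals.
Context {R : realType}.
Notation mu := (@lebesgue_measure R).
Local Open Scope ereal_scope.

Lemma continuous_powR (a x : R) : (0 < x)%R -> {for x, continuous (fun u : R => u `^ a)%R}.
Proof.
move=> x0; apply: differentiable_continuous; apply/derivable1_diffP.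
by case: (is_derive1_powR a x0).
Qed.

Lemma integral_powR_itv (a x y : R) : a != 0%R -> (0 < x)%R -> (x < y)%R ->
  \int[mu]_(u in `[x, y]) (u `^ (a - 1))%:E = ((y `^ a - x `^ a) / a)%:E.
Proof.
move=> a0 x0 xy; pose F (u : R) := (a^-1 * u `^ a)%R.
have dF (u : R) : (0 < u)%R -> is_derive u (1 : R)%R F (u `^ (a - 1))%R.
  move=> u0; have := is_derive1_powR a u0 => d; rewrite /F.
  by apply: is_derive_eq; rewrite /GRing.scale/= mulrA mulVf// mul1r.
have cF (u : R) : (0 < u)%R -> {for u, continuous F}.
  move=> u0; apply: differentiable_continuous; apply/derivable1_diffP.
  by case: (dF u u0).
rewrite (@continuous_FTC2 _ _ F _ _ xy).
- by rewrite -EFinB /F; congr EFin; field.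
- apply: continuous_in_subspaceT => u; rewrite inE /= in_itv/= => /andP[xu _].
  by apply: continuous_powR; exact: lt_le_trans xu.
- split.
  + by move=> u; rewrite in_itv/= => /andP[xu _]; case: (dF u (lt_trans x0 xu)).
  + by apply: cvg_at_right_filter; exact: cF.
  + by apply: cvg_at_left_filter; apply: cF; exact: lt_trans xy.
- move=> u; rewrite in_itv/= => /andP[xu _]; rewrite derive1E.
  by case: (dF u (lt_trans x0 xu)).
Qed.

Let measurable_powRE (a : R) (D : set R) : measurable_fun D (fun u : R => (u `^ a)%:E).
Proof. by apply: measurable_funTS; apply/measurable_EFinP; exact: measurable_powR. Qed.

Lemma integral_powR_exhaust (D : set R) (F : (set R)^nat) (a M : R) :
  nondecreasing_seq F -> (forall i, measurable (F i)) -> D `<=` \bigcup_i F i ->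
  measurable D ->
  (forall i, \int[mu]_(u in F i) (u `^ a)%:E <= M%:E) ->
  \int[mu]_(u in D) (u `^ a)%:E <= M%:E.
Proof.
move=> ndF mF DF mD FM.
apply: (@le_trans _ _ (\int[mu]_(u in \bigcup_i F i) (u `^ a)%:E)).
  apply: ge0_subset_integral => //; first exact: bigcupT_measurable.
  - exact: measurable_powRE.
  - by move=> u _; rewrite lee_fin powR_ge0.
have L : \int[mu]_(u in F i) (u `^ a)%:E @[i --> \oo] --> \int[mu]_(u in \bigcup_i F i) (u `^ a)%:E.
  apply: ge0_nondecreasing_set_cvg_integral => // i.
    exact: measurable_powRE.
  by move=> u _; rewrite lee_fin powR_ge0.
rewrite -(cvg_lim (@ereal_hausdorff R) L); apply: lime_le; first by apply/cvg_ex; eexists; exact: L.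
exact: nearW.
Qed.

Lemma integral_powR_near0 (a y : R) : (0 < a)%R -> (0 < y)%R ->
  \int[mu]_(u in `]0%R, y]) (u `^ (a - 1))%:E <= (y `^ a / a)%:E.
Proof.
move=> a0 y0.
apply: (@integral_powR_exhaust _ (fun i : nat => `[(y / i.+2%:R)%R, y]%classic)) => //.
- move=> i j ij; apply/subsetPset => u /=; rewrite !in_itv/= => /andP[h ->]; rewrite andbT.
  by apply: le_trans h; rewrite ler_pM2l// lef_pV2 ?posrE// ler_nat.
- move=> u /=; rewrite in_itv/= => /andP[u0 uy].
  exists (Num.truncn (y / u)) => //=; rewrite in_itv/= uy andbT.
  rewrite ler_pdivrMr// mulrC -ler_pdivrMr//.
  by apply: le_trans (ltW (truncnS_gt _)) _; rewrite ler_nat.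
- move=> i; rewrite integral_powR_itv ?gt_eqF ?divr_gt0//; last first.
    by rewrite ltr_pdivrMr// ltr_pMr// ltr1n.
  by rewrite lee_fin ler_pM2r ?invr_gt0// gerBl powR_ge0.
Qed.

Lemma integral_powR_infty (a x : R) : (0 < a)%R -> (0 < x)%R ->
  \int[mu]_(u in `[x, +oo[) (u `^ (- a - 1))%:E <= (x `^ (- a) / a)%:E.
Proof.
move=> a0 x0.
apply: (@integral_powR_exhaust _ (fun i : nat => `[x, (x + i.+1%:R)%R]%classic)) => //.
- move=> i j ij; apply/subsetPset => u /=; rewrite !in_itv/= => /andP[-> h] /=.
  by apply: le_trans h _; rewrite lerD2l ler_nat.
- move=> u /=; rewrite in_itv/= andbT => xu.
  exists (Num.truncn u) => //=; rewrite in_itv/= xu/=.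
  by apply: le_trans (ltW (truncnS_gt _)) _; rewrite ler_wpDl// ltW.
- move=> i; rewrite integral_powR_itv ?oppr_eq0 ?gt_eqF//; last by rewrite ltrDl.
  rewrite lee_fin invrN mulrN -mulNr opprB ler_pM2r ?invr_gt0// gerBl powR_ge0//.
Qed.

End power_integrals.

(** * Integrability of radial powers without polar coordinates *)

Section radial_integrals.
Context {R : realType} {n : nat}.
Notation mu := (@lebesgue_measure R).
Notation lam := (lebesgue_Rn R n.+1).
Notation N := (n.+1%:R : R).

(** The majorant of [exp (- t psi)] in a rescaled radius: the upper scaling will give the power
    inside the unit ball, the lower scaling the one outside. At [r = 0] it is 0 when [a] is
    nonzero. *)
Definition two_powers (a b r : R) : R := if r <= 1 then r `^ (- a) else r `^ (- b).

Lemma two_powers_ge0 a b r : 0 <= two_powers a b r.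
Proof. by rewrite /two_powers; case: ifP => _; exact: powR_ge0. Qed.

Lemma measurable_two_powers a b : measurable_fun setT (two_powers a b).
Proof.
apply: measurable_fun_ifT; [exact: measurable_fun_ler|exact: measurable_powR|].
exact: measurable_powR.
Qed.

Lemma two_powers_decr a b r s : 0 <= a -> 0 <= b -> 0 < r -> r <= s ->
  two_powers a b s <= two_powers a b r.
Proof.
move=> a0 b0 r0 rs; have s0 := lt_le_trans r0 rs.
have H c : 0 <= c -> s `^ (- c) <= r `^ (- c).
  by move=> c0; rewrite !powRN lef_pV2 ?posrE ?powR_gt0// ge0_ler_powR// nnegrE ltW.
rewrite /two_powers; have [s1|s1] := leP s 1.
  by rewrite (le_trans rs s1); exact: H.
have [r1|r1] := leP r 1; last exact: H.
apply: (@le_trans _ _ 1).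
  by rewrite powRN invf_le1 ?powR_gt0// -(powRr0 s) ler_powR// ltW.
by rewrite powRN -[leLHS]invr1 lef_pV2 ?posrE ?powR_gt0// -(powRr0 r) ger_powR// r0.
Qed.

(* Fubini for [two_powers a b s <= \int_(s/2)^s 2 * two_powers a b r / r dr]. *)
Lemma integral_two_powers_lty a b : 0 < a -> a < N -> N < b ->
  (\int[lam]_x (two_powers a b (normv x))%:E < +oo)%E.
Proof.
move=> a0 aN bN; have b0 : 0 < b by apply: lt_trans bN.
pose j := two_powers a b.
have j0 r : 0 <= j r by exact: two_powers_ge0.
have mj : measurable_fun setT j by exact: measurable_two_powers.
pose D (s : R) := `](s / 2), s]%classic.
pose F (u : Rn R n.+1 * R) : R :=
  if 0 < u.2 then if u.2 <= normv u.1 then if normv u.1 <= 2 * u.2 then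
    2 * (j u.2 * u.2 `^ (-1)) else 0 else 0 else 0.
have F0 u : 0 <= F u.
  by rewrite /F; do 3 (case: ifP => // _); rewrite mulr_ge0// mulr_ge0// powR_ge0.
have mF : measurable_fun setT F.
  have ms : measurable_fun setT (fun u : Rn R n.+1 * R => u.2) by exact: measurable_snd.
  have mn : measurable_fun setT (fun u : Rn R n.+1 * R => normv u.1).
    by apply: measurable_normv; exact: measurable_fst.
  apply: measurable_fun_ifT => //; first exact: measurable_fun_ltr.
  apply: measurable_fun_ifT => //; first exact: measurable_fun_ler.
  apply: measurable_fun_ifT => //.
    by apply: measurable_fun_ler => //; exact: measurable_funM.
  apply: measurable_funM => //; apply: measurable_funM; first exact: measurableT_comp.
  apply: (measurableT_comp (f := fun r : R => r `^ (-1))) => //; exact: measurable_powR.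
(* The interval [D s] has length [s / 2], and on it the decreasing quantity
   [2 * two_powers a b r / r] is at least its value at [s]. *)
have step1 (x : Rn R n.+1) : 0 < normv x ->
    ((j (normv x))%:E <= \int[mu]_r (F (x, r))%:E)%E.
  move=> s0; set s := normv x.
  have -> : (j s)%:E = (\int[mu]_(r in D s) (j s * (2 / s))%:E)%E.
    rewrite integral_cst /D; last exact: measurable_itv.
    rewrite /= lebesgue_measure_itv/= lte_fin ltr_pdivrMr// ltr_pMr// ltr1n.
    by rewrite -EFinB -EFinM; congr EFin; field; rewrite gt_eqF.
  rewrite integral_mkcond; apply: ge0_le_integral => //.
  - by move=> r _; rewrite patchE; case: ifP => // _; rewrite lee_fin mulr_ge0// divr_ge0// ltW.
  - have mD : measurable (D s) by exact: measurable_itv.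
    exact: (proj1 (measurable_restrictT _ mD)).
  - apply/measurable_EFinP; apply: (measurableT_comp mF); exact: pair1_measurable.
  - move=> r _; rewrite patchE; case: ifPn => [|_]; last by rewrite lee_fin.
    rewrite inE /D/= in_itv/= => /andP[h1 h2].
    have r0 : 0 < r by apply: lt_trans h1; rewrite divr_gt0.
    rewrite lee_fin /F/= r0 h2 ifT; last by rewrite -ler_pdivrMl// mulrC ltW.
    rewrite mulrCA ler_pM2l// powR_inv1 ?(ltW r0)//.
    apply: ler_pM; rewrite ?invr_ge0 ?(ltW s0)//.
      by apply: two_powers_decr => //; exact: ltW.
    by rewrite lef_pV2// posrE.
have V0 := @ball_volume_gt0 R n.+1.
(* One factor 2 comes from [F] and [2^(n+1)] from the ball of radius [2 r]. The remaining [r^(N-1)]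
   times [two_powers] gives the exponents in [g1] and [g2], integrable at 0 and at infinity
   respectively. *)
pose c := 2 ^+ n.+2 * @ball_volume R n.+1.
have c0 : 0 < c by rewrite mulr_gt0// exprn_gt0.
pose g1 := (fun r : R => (r `^ ((N - a) - 1))%:E) \_ `]0, 1].
pose g2 := (fun r : R => (r `^ (- (b - N) - 1))%:E) \_ `[1, +oo[.
have g10 r : (0 <= g1 r)%E by rewrite /g1 patchE; case: ifP => // _; rewrite lee_fin powR_ge0.
have g20 r : (0 <= g2 r)%E by rewrite /g2 patchE; case: ifP => // _; rewrite lee_fin powR_ge0.
have mg1 : measurable_fun setT g1.
  apply: (proj1 (measurable_restrictT _ (measurable_itv _))).
  by apply: measurable_funTS; apply/measurable_EFinP; exact: measurable_powR.
have mg2 : measurable_fun setT g2.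
  apply: (proj1 (measurable_restrictT _ (measurable_itv _))).
  by apply: measurable_funTS; apply/measurable_EFinP; exact: measurable_powR.
have step2 (r : R) : (\int[lam]_x (F (x, r))%:E <= c%:E * (g1 r + g2 r))%E.
  have [r0|r0] := ltP 0 r; last first.
    rewrite (_ : (\int[lam]_x _)%E = 0%E) ?mule_ge0 ?adde_ge0 ?lee_fin ?(ltW c0)//.
    by apply: integral0_eq => x _; rewrite /F/= ltNge r0.
  apply: (@le_trans _ _ (\int[lam]_(x in ballv (2 * r)) (2 * (j r * r `^ (-1)))%:E)%E).
    rewrite [leRHS]integral_mkcond; apply: ge0_le_integral => //.
    - by move=> x _; rewrite lee_fin.
    - by apply/measurable_EFinP; apply: (measurableT_comp mF); exact: pair2_measurable.
    - exact: (proj1 (measurable_restrictT _ (measurable_ballv _))).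
    - move=> x _; rewrite patchE; case: ifPn => [_|].
        have v0 : 0 <= 2 * (j r * r `^ (-1)) by rewrite mulr_ge0// mulr_ge0// powR_ge0.
        by rewrite lee_fin /F/= r0; case: (r <= normv x); case: (normv x <= 2 * r).
      by rewrite notin_setE /ballv/= => /negP/negbTE h; rewrite lee_fin /F/= h !if_same.
  rewrite integral_cst; last exact: measurable_ballv.
  have := @lebesgue_ballv R n.+1 (2 * r) (mulr_gt0 (ltr0Sn _ 1) r0) => /= ->.
  rewrite -EFinM.
  have -> : 2 * (j r * r `^ (-1)) * ((2 * r) ^+ n.+1 * @ball_volume R n.+1) =
      c * (j r * (r `^ (-1) * r `^ N)).
    by rewrite powR_mulrn ?(ltW r0)// /c exprMn !exprS; ring.
  rewrite EFinM lee_wpmul2l ?lee_fin ?(ltW c0)//.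
  have rn0 : r != 0 by rewrite gt_eqF.
  rewrite -powRD; last by rewrite rn0 implybT.
  rewrite /j /two_powers; have [r1|r1] := leP r 1.
    rewrite -powRD; last by rewrite rn0 implybT.
    rewrite (_ : - a + (-1 + N) = N - a - 1); last by ring.
    by rewrite {1}/g1 patchE ifT ?leeDl// inE/= in_itv/= r0.
  rewrite -powRD; last by rewrite rn0 implybT.
  rewrite (_ : - b + (-1 + N) = - (b - N) - 1); last by ring.
  by rewrite {1}/g2 patchE ifT ?leeDr// inE/= in_itv/= ltW.
apply: (@le_lt_trans _ _ (\int[lam]_x \int[mu]_r (F (x, r))%:E)%E).
  apply: ae_ge0_le_integral => //.
  - by move=> x _; rewrite lee_fin.
  - apply/measurable_EFinP; apply: (measurableT_comp mj); exact: (@measurable_normv _ _ _ _ _ id).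
  - by move=> x _; apply: integral_ge0 => r _; rewrite lee_fin.
  - by apply: (@measurable_integral_param _ _ _ _ _ mu (EFin \o F)); exact/measurable_EFinP.
  - by apply: ae_neq0 => x /normv_gt0 x0 _; exact: step1.
rewrite (@fubini_tonelli _ _ _ _ _ lam mu (EFin \o F)); last 2 first.
- exact/measurable_EFinP.
- by move=> u; rewrite lee_fin.
apply: (@le_lt_trans _ _ (\int[mu]_r (c%:E * (g1 r + g2 r)))%E).
  apply: ge0_le_integral => //.
  - by move=> r _; apply: integral_ge0 => x _; rewrite lee_fin.
  - apply: (measurable_fun_fubini_tonelli_G (m1 := lam) (EFin \o F)).
      exact/measurable_EFinP.
    by move=> u; rewrite lee_fin.
  - by apply: emeasurable_funM => //; exact: emeasurable_funD.
  - by move=> r _; exact: step2.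
rewrite ge0_integralZl; last 4 first.
- exact: measurableT.
- exact: emeasurable_funD.
- by move=> r _; rewrite adde_ge0.
- by rewrite lee_fin ltW.
rewrite ge0_integralD//.
have i1 : (\int[mu]_r g1 r < +oo)%E.
  rewrite -integral_mkcond; apply: le_lt_trans (ltry _).
  by apply: integral_powR_near0; rewrite ?subr_gt0.
have i2 : (\int[mu]_r g2 r < +oo)%E.
  rewrite -integral_mkcond; apply: le_lt_trans (ltry _).
  by apply: integral_powR_infty; rewrite ?subr_gt0.
by rewrite lte_mul_pinfty ?lee_fin ?(ltW c0)// lte_add_pinfty.
Qed.

End radial_integrals.

Section scaling_estimates.
Context {R : realType} {n : nat}.
Notation lam := (lebesgue_Rn R n.+1).
Notation N := (n.+1%:R : R).

(** Raise [u / q <= exp (u / q)] to the power [q]. *)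
Lemma expRN_le_powR (q u : R) : 0 < q -> 0 < u -> expR (- u) <= q `^ q * u `^ (- q).
Proof.
move=> q0 u0; rewrite expRN powRN ler_pdivlMr ?powR_gt0// mulrC ler_pdivrMr ?expR_gt0//.
have h : u / q <= expR (u / q) by apply: le_trans (expR_ge1Dx _); rewrite lerDr.
have -> : u `^ q = q `^ q * (u / q) `^ q.
  by rewrite -powRM ?divr_ge0 ?(ltW q0) ?(ltW u0)// mulrC divfK// gt_eqF.
rewrite ler_wpM2l ?powR_ge0//.
apply: le_trans (ge0_ler_powR (ltW q0) _ _ h) _; rewrite ?nnegrE ?divr_ge0 ?(ltW q0) ?(ltW u0) ?expR_ge0//.
by rewrite -expRM divfK// gt_eqF.
Qed.

Variables (a b : R).
Hypotheses (a0 : 0 < a) (aN : a < N) (bN : N < b).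

Definition two_powers_mass : R := \int[lam]_x two_powers a b (normv x).

Lemma integrable_two_powers (rho : R) : 0 < rho ->
  lam.-integrable setT (EFin \o (fun x => two_powers a b (normv x / rho))) /\
  \int[lam]_x two_powers a b (normv x / rho) = rho ^+ n.+1 * two_powers_mass.
Proof.
move=> r0; have mj := @measurable_two_powers R a b.
have mJ : measurable_fun setT (fun x : Rn R n.+1 => two_powers a b (normv x / rho)).
  apply: (measurableT_comp mj); apply: measurable_funM => //.
  exact: (@measurable_normv _ _ _ _ _ id).
have E : (\int[lam]_x (two_powers a b (normv x / rho))%:E =
    (rho ^+ n.+1)%:E * \int[lam]_x (two_powers a b (normv x))%:E)%E.
  rewrite (@ge0_integral_scalev _ _ rho (fun x => (two_powers a b (normv x / rho))%:E)); last 3 first.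
  - by rewrite gt_eqF.
  - exact/measurable_EFinP.
  - by move=> x; rewrite lee_fin two_powers_ge0.
  rewrite (gtr0_norm r0); congr (_ * _)%E; apply: eq_integral => x _.
  by rewrite normvZ (gtr0_norm r0) mulrC mulKf// gt_eqF.
have fin := integral_two_powers_lty a0 aN bN.
have ge0 : (0 <= \int[lam]_x (two_powers a b (normv x))%:E)%E.
  by apply: integral_ge0 => x _; rewrite lee_fin two_powers_ge0.
split.
  apply/integrableP; split; first exact/measurable_EFinP.
  under eq_integral do rewrite /= ger0_norm ?two_powers_ge0//.
  by rewrite E lte_mul_pinfty ?lee_fin ?exprn_ge0// ltW.
by rewrite /two_powers_mass /Rintegral E fineM// ge0_fin_numE.
Qed.

Lemma two_powers_mass_ge0 : 0 <= two_powers_mass.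
Proof. by apply: Rintegral_ge0 => x _; exact: two_powers_ge0. Qed.

End scaling_estimates.

(** * Consequences of weak scaling *)

Section weak_scaling.
Context {R : realType}.
Variables (psi : R -> R) (alo clo aup cup : R).
Hypotheses (alo0 : 0 < alo) (aup0 : 0 < aup).
Hypotheses (Hlo : WLSC alo clo psi) (Hup : WUSC aup cup psi).

Let clo0 : 0 < clo. Proof. by case: Hlo. Qed.
Let cup0 : 0 < cup. Proof. by case: Hup => h _; apply: lt_le_trans h. Qed.

(** This and the next two lemmas recast the scaling conditions around a reference radius [rho],
    which will be [1 / |x|]. *)
Lemma psi_le_lo (r rho : R) : 0 < r -> r <= rho ->
  clo * psi r <= (r / rho) `^ alo * psi rho.
Proof.
move=> r0 rrho; have rho0 := lt_le_trans r0 rrho.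
have [_ _ h] := Hlo; have := h (rho / r) r.
rewrite divfK ?gt_eqF// ler_pdivlMr// mul1r => /(_ rrho r0) h1.
have : (r / rho) `^ alo * (clo * (rho / r) `^ alo * psi r) <= (r / rho) `^ alo * psi rho.
  by rewrite ler_wpM2l ?powR_ge0.
rewrite (_ : _ * (_ * _ * _) = clo * psi r * ((r / rho) `^ alo * (rho / r) `^ alo)); last by ring.
rewrite -powRM ?divr_ge0 ?(ltW r0) ?(ltW rho0)//.
rewrite (_ : r / rho * (rho / r) = 1) ?powR1 ?mulr1//.
by field; rewrite !gt_eqF.
Qed.

Lemma psi_ge_lo (r rho : R) : 0 < rho -> rho <= r ->
  clo * (r / rho) `^ alo * psi rho <= psi r.
Proof.
move=> rho0 rrho; have [_ _ h] := Hlo; have := h (r / rho) rho.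
by rewrite divfK ?gt_eqF// ler_pdivlMr// mul1r => /(_ rrho rho0).
Qed.

Lemma psi_ge_up (r rho : R) : 0 < r -> r <= rho ->
  (r / rho) `^ aup * psi rho <= cup * psi r.
Proof.
move=> r0 rrho; have rho0 := lt_le_trans r0 rrho.
have [_ h] := Hup; have := h (rho / r) r.
rewrite divfK ?gt_eqF// ler_pdivlMr// mul1r => /(_ rrho r0) h1.
have : (r / rho) `^ aup * psi rho <= (r / rho) `^ aup * (cup * (rho / r) `^ aup * psi r).
  by rewrite ler_wpM2l ?powR_ge0.
rewrite (_ : _ * (_ * _ * _) = cup * psi r * ((r / rho) `^ aup * (rho / r) `^ aup)); last by ring.
rewrite -powRM ?divr_ge0 ?(ltW r0) ?(ltW rho0)//.
rewrite (_ : r / rho * (rho / r) = 1) ?powR1 ?mulr1//.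
by field; rewrite !gt_eqF.
Qed.

(** One positive value spreads to smaller radii by the upper scaling and to larger ones by the lower
    scaling. *)
Lemma psi_gt0 (s r : R) : 0 < s -> 0 < psi s -> 0 < r -> 0 < psi r.
Proof.
move=> s0 ps0 r0; have [rs|/ltW sr] := leP r s.
  have := psi_ge_up r0 rs; rewrite -(pmulr_rgt0 _ cup0); apply: lt_le_trans.
  by rewrite mulr_gt0// powR_gt0// divr_gt0.
apply: lt_le_trans (psi_ge_lo s0 sr).
by rewrite mulr_gt0// mulr_gt0// powR_gt0// divr_gt0.
Qed.

Variables (kappa m : R).
Hypotheses (kappa0 : 0 < kappa) (m0 : 0 < m).
Hypothesis psi0 : forall r, 0 < r -> 0 < psi r.

(** The constants of [expRN_le_powR], with exponent [kappa] and upper scaling for radii up to [rho],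
    with exponent [m] and lower scaling beyond. *)
Definition exp_bound_const : R :=
  Num.max (kappa `^ kappa * cup `^ kappa) (m `^ m * clo `^ (- m)).

Notation J := (two_powers (aup * kappa) (alo * m)).

Let C1 := exp_bound_const.

Lemma exp_bound_const_ge0 : 0 <= C1.
Proof. by rewrite le_max mulr_ge0 ?powR_ge0. Qed.

(** Beyond [rho] only the power [m] appears. The lower heat kernel bound needs this sharper form,
    because its error must decay faster than its main term. *)
Lemma expN_psi_le_out (t r rho : R) : 0 < t -> 0 < rho -> rho < r ->
  expR (- t * psi r) <= C1 * (t * psi rho) `^ (- m) * J (r / rho).
Proof.
move=> t0 rho0 rr; have r0 := lt_trans rho0 rr.
have tau0 : 0 < t * psi rho by rewrite mulr_gt0// psi0.
have s0 : 0 < r / rho by rewrite divr_gt0.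
rewrite /two_powers ifN; last by rewrite -ltNge ltr_pdivlMr// mul1r.
have h : clo * (r / rho) `^ alo * (t * psi rho) <= t * psi r.
  by rewrite mulrCA ler_pM2l// psi_ge_lo// ltW.
rewrite mulNr; apply: (@le_trans _ _ (expR (- (clo * (r / rho) `^ alo * (t * psi rho))))).
  by rewrite ler_expR lerN2.
have z0 : 0 < clo * (r / rho) `^ alo by rewrite mulr_gt0// powR_gt0.
apply: le_trans (expRN_le_powR m0 _) _; first by rewrite mulr_gt0.
rewrite powRM ?(ltW z0) ?(ltW tau0)// powRM ?(ltW clo0) ?powR_ge0// -powRrM mulrN.
rewrite (_ : _ * (_ * _ * _) = m `^ m * clo `^ (- m) *
  ((t * psi rho) `^ (- m) * (r / rho) `^ (- (alo * m)))); last by ring.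
by rewrite -[leRHS]mulrA ler_wpM2r ?mulr_ge0 ?powR_ge0// le_max lexx orbT.
Qed.

Lemma expN_psi_le (t r rho : R) : 0 < t -> 0 < rho -> 0 < r ->
  expR (- t * psi r) <=
  C1 * ((t * psi rho) `^ (- kappa) + (t * psi rho) `^ (- m)) * J (r / rho).
Proof.
move=> t0 rho0 r0; have C0 := exp_bound_const_ge0.
have [rr|rr] := ltP rho r.
  apply: le_trans (expN_psi_le_out t0 rho0 rr) _.
  by rewrite ler_wpM2r ?two_powers_ge0// ler_wpM2l// lerDr powR_ge0.
apply: (@le_trans _ _ (C1 * (t * psi rho) `^ (- kappa) * J (r / rho))); last first.
  by rewrite ler_wpM2r ?two_powers_ge0// ler_wpM2l// lerDl powR_ge0.
have tau0 : 0 < t * psi rho by rewrite mulr_gt0// psi0.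
have s0 : 0 < r / rho by rewrite divr_gt0.
rewrite /two_powers ifT; last by rewrite ler_pdivrMr// mul1r.
have h : cup^-1 * (r / rho) `^ aup * (t * psi rho) <= t * psi r.
  rewrite mulrCA ler_pM2l// -mulrA ler_pdivrMl//; exact: psi_ge_up.
rewrite mulNr; apply: (@le_trans _ _ (expR (- (cup^-1 * (r / rho) `^ aup * (t * psi rho))))).
  by rewrite ler_expR lerN2.
have z0 : 0 < cup^-1 * (r / rho) `^ aup by rewrite mulr_gt0 ?invr_gt0// powR_gt0.
apply: le_trans (expRN_le_powR kappa0 _) _; first by rewrite mulr_gt0.
have ci : 0 <= cup^-1 by rewrite invr_ge0 ltW.
rewrite (powRM _ (ltW z0) (ltW tau0)) (powRM _ ci (powR_ge0 _ _)) -powRrM mulrN.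
have -> : cup^-1 `^ (- kappa) = cup `^ kappa.
  by rewrite -powR_inv1 ?(ltW cup0)// -powRrM mulN1r opprK.
rewrite (_ : _ * (_ * _ * _) = kappa `^ kappa * cup `^ kappa *
  ((t * psi rho) `^ (- kappa) * (r / rho) `^ (- (aup * kappa)))); last by ring.
by rewrite -[leRHS]mulrA ler_wpM2r ?mulr_ge0 ?powR_ge0// le_max lexx.
Qed.

End weak_scaling.

(** * Pointwise bounds of the heat density *)

Section heat_estimates.
Context {R : realType} {n : nat}.
Notation lam := (lebesgue_Rn R n.+1).
Notation N := (n.+1%:R : R).
Variables (nu : {measure set (Rn R n.+1) -> \bar R}) (nur : R -> R).
Hypothesis Hnu : infinite_isotropic_unimodal_levy nu nur.
Notation Psi := (levy_exponent nu).
Notation psi := (radial_profile Psi).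
Variables (alo clo aup cup : R).
Hypotheses (alo0 : 0 < alo) (aup0 : 0 < aup).
Hypotheses (Hlo : WLSC alo clo psi) (Hup : WUSC aup cup psi).
Hypothesis Psi_neq0 : exists xi, Psi xi <> 0.
Variables (kappa m : R).
Hypotheses (kappa0 : 0 < kappa) (km : kappa <= m).
Hypotheses (kN : aup * kappa < N) (mN : N < alo * m).

Let m0 : 0 < m. Proof. exact: lt_le_trans km. Qed.
Let clo0 : 0 < clo. Proof. by case: Hlo. Qed.

Lemma levy_exponent_profile xi : Psi xi = psi (normv xi).
Proof.
by apply: (levy_exponent_radial Hnu); rewrite normv_axisv ger0_norm ?normv_ge0.
Qed.

Lemma levy_profile_gt0 r : 0 < r -> 0 < psi r.
Proof.
have [xi xi0] := Psi_neq0.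
have xin : 0 < normv xi.
  by apply: normv_gt0 => e; apply: xi0; rewrite e (levy_exponent0 Hnu).
apply: (psi_gt0 Hlo Hup xin).
by rewrite -levy_exponent_profile lt_def levy_exponent_ge0 andbT; apply/eqP.
Qed.

Let psi0 := levy_profile_gt0.
Let e (t : R) (xi : Rn R n.+1) : R := expR (- t * Psi xi).
Notation J := (two_powers (aup * kappa) (alo * m)).
Let C1 := exp_bound_const clo cup kappa m.
Let C10 : 0 <= C1. Proof. exact: exp_bound_const_ge0. Qed.
Let IJ := two_powers_mass (n := n) (aup * kappa) (alo * m).
Let IJ0 : 0 <= IJ. Proof. exact: two_powers_mass_ge0. Qed.
Let ak0 : 0 < aup * kappa. Proof. exact: mulr_gt0. Qed.
Let V := @ball_volume R n.+1.
Let V0 : 0 < V. Proof. exact: ball_volume_gt0. Qed.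
Let K : R := (2 * pi) ^- n.+1.
Let K0 : 0 < K. Proof. by rewrite invr_gt0 exprn_gt0// mulr_gt0// pi_gt0. Qed.

Let m0v : measurable [set (@zerov R n.+1)].
Proof.
have -> : [set (@zerov R n.+1)] = ballv 0; last exact: measurable_ballv.
apply/seteqP; split=> x; rewrite /ballv/=; first by move=> ->; rewrite normv0.
by move=> x0; apply: normv_eq0; apply/eqP; rewrite eq_le x0 normv_ge0.
Qed.

Let i0v : lam.-integrable setT (EFin \o (\1_[set zerov] : _ -> R)) /\
  \int[lam]_x (\1_[set zerov] x : R) = 0.
Proof.
have E : (\int[lam]_x (\1_[set zerov] x : R)%:E = 0)%E.
  by rewrite integral_indic// setIT; exact: lebesgue_set0v.
split; last by rewrite /Rintegral E.
apply/integrableP; split; first exact/measurable_EFinP/measurable_indic.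
under eq_integral do rewrite /= ger0_norm//.
by rewrite E ltry.
Qed.

Let me t : measurable_fun setT (e t).
Proof.
apply: (measurableT_comp (f := @expR R)) => //; apply: measurable_funM => //.
exact: measurable_levy_exponent Hnu.
Qed.

Let tau (t rho : R) := t * psi rho.
(** The indicator repairs the value at the origin, where [e t] is 1 but [J] is 0; it does not change
    the integral. *)
Let gb (t rho : R) (xi : Rn R n.+1) :=
  C1 * (tau t rho `^ (- kappa) + tau t rho `^ (- m)) * J (normv xi / rho) + \1_[set zerov] xi.

Let e_le_gb t rho xi : 0 < t -> 0 < rho -> e t xi <= gb t rho xi.
Proof.
move=> t0 r0; rewrite /gb indicE.
have [->|/eqP xi0] := eqVneq xi zerov.
  rewrite mem_set// /e (levy_exponent0 Hnu) mulr0 expR0 lerDr mulr_ge0 ?two_powers_ge0//.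
  by rewrite mulr_ge0// addr_ge0 ?powR_ge0.
rewrite memNset// addr0 /e levy_exponent_profile.
by apply: expN_psi_le => //; exact: normv_gt0.
Qed.

Let gb_int t rho : 0 < rho -> lam.-integrable setT (EFin \o gb t rho) /\
  \int[lam]_xi gb t rho xi =
    C1 * (tau t rho `^ (- kappa) + tau t rho `^ (- m)) * (rho ^+ n.+1 * IJ).
Proof.
move=> r0; have [iJ EJ] := integrable_two_powers ak0 kN mN r0.
have [i1 E1] := i0v.
pose c := C1 * (tau t rho `^ (- kappa) + tau t rho `^ (- m)).
have iZ : lam.-integrable setT (EFin \o (fun xi => c * J (normv xi / rho))).
  have := integrableZl measurableT c iJ.
  by under eq_fun do rewrite -EFinM.
split.
  have := integrableD measurableT iZ i1.
  by apply: (eq_integrable measurableT) => xi _ /=.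
by rewrite RintegralD// RintegralZl// E1 addr0 EJ.
Qed.

Lemma integrable_expN_levy t : 0 < t -> lam.-integrable setT (EFin \o e t).
Proof.
move=> t0; have [ig _] := @gb_int t 1 ltr01.
apply: (@integrable_bounded_mul _ _ R lam _ _ 1 (me t) ig) => xi.
by rewrite mul1r ger0_norm ?expR_ge0// (le_trans (e_le_gb xi t0 ltr01))// ler_norm.
Qed.

Notation p := (heat_density Psi).

(** On the ball of radius [|x|] the density is at least [p t x], and its total mass is at most 1. *)
Lemma heat_density_le_unimodal t x : 0 < t -> x <> zerov ->
  p t x <= V^-1 * normv x ^- n.+1.
Proof.
move=> t0 x0; have xn := normv_gt0 x0.
have [p0 pd] := unimodal_heat_density Hnu integrable_expN_levy t0.
have mB := measurable_ballv (n := n.+1) (normv x).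
have h : ((p t x)%:E * lam (ballv (normv x)) <= 1)%E.
  apply: le_trans (integral_heat_density_le1 Hnu integrable_expN_levy t0).
  rewrite -(integral_cst lam mB) integral_mkcond; apply: ge0_le_integral => //.
  - by move=> y _; rewrite patchE; case: ifP => // _; rewrite lee_fin.
  - exact: (proj1 (measurable_restrictT _ mB)).
  - apply/measurable_EFinP.
    rewrite (_ : p t = fun x => K * cos_transform (e t) x); last first.
      by apply/funext => y; exact: heat_densityE.
    by apply: measurable_funM => //; exact: measurable_cos_transform.
  - move=> y _; rewrite patchE; case: ifPn => [|_]; last by rewrite lee_fin.
    by rewrite inE /ballv/= => yx; rewrite lee_fin pd.
have := @lebesgue_ballv R n.+1 (normv x) xn; rewrite /= => LB.
move: h; rewrite /= LB -EFinM lee_fin -/V => h.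
by rewrite -invfM -[leRHS]mul1r ler_pdivlMr ?mulr_gt0 ?exprn_gt0// (mulrC V).
Qed.

Let cos_transform_le t x : 0 < t -> cos_transform (e t) x <= \int[lam]_xi e t xi.
Proof.
move=> t0; have ie := integrable_expN_levy t0.
apply: le_Rintegral => //; first exact: integrable_cos_mul.
by move=> xi _; rewrite ler_piMl ?expR_ge0// cos_le1.
Qed.

(** Bound the cosine by 1 and take [rho = 1 / |x|] in the majorant. Since [t psi (1/|x|) >= 1] and
    [kappa <= m], the power [- m] is absorbed by the power [- kappa], hence the factor 2. *)
Lemma heat_density_le_tail t x : 0 < t -> x <> zerov -> 1 <= t * psi (normv x)^-1 ->
  p t x <= K * C1 * 2 * IJ * normv x ^- n.+1 * (t * psi (normv x)^-1) `^ (- kappa).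
Proof.
move=> t0 x0 tau1; have xn := normv_gt0 x0.
have r0 : 0 < (normv x)^-1 by rewrite invr_gt0.
rewrite heat_densityE -/K -!mulrA ler_pM2l//.
apply: le_trans (cos_transform_le x t0) _.
have [ig Eg] := gb_int t r0.
apply: (@le_trans _ _ (\int[lam]_xi gb t (normv x)^-1 xi)).
  apply: le_Rintegral => //; first exact: integrable_expN_levy.
  by move=> xi _; exact: e_le_gb.
rewrite Eg -mulrA ler_wpM2l// exprVn.
have h : tau t (normv x)^-1 `^ (- m) <= tau t (normv x)^-1 `^ (- kappa).
  by apply: ler_powR => //; rewrite lerN2.
rewrite -/(tau _ _); set T := tau _ _ `^ (- kappa) in h *.
rewrite (_ : 2 * _ = (T + T) * (normv x ^- n.+1 * IJ)); last by ring.
by rewrite ler_wpM2r ?lerD2l// mulr_ge0// invr_ge0 exprn_ge0// ltW.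
Qed.

(* On the ball of radius [rho = 1/|x|] the cosine is at least 1/2, and the rest
   of the Fourier integral is negligible once [t * psi rho] is large. *)
Lemma heat_density_lower : exists A c : R, [/\ 1 <= A, 0 < c &
  forall t x, 0 < t -> x <> zerov ->
    A <= t * psi (normv x)^-1 -> t * psi (normv x)^-1 <= 2 * A ->
    c * normv x ^- n.+1 <= p t x].
Proof.
(* Up to [rho^N], the main part of the Fourier integral will be [B T^(- N / alo)] and the error
   [D T^(- m)]. As [q > 0], the choice of [A] makes the error at most half of the main part once
   [T >= A]; the bound [T <= 2 A] then keeps the main part away from 0. *)
pose B := 2^-1 * expR (-1) * V * clo `^ (N / alo).
have B0 : 0 < B by rewrite !mulr_gt0 ?expR_gt0 ?powR_gt0// invr_gt0.
pose D := C1 * IJ.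
have D0 : 0 <= D by rewrite mulr_ge0.
pose q := m - N / alo.
have q0 : 0 < q by rewrite subr_gt0 ltr_pdivrMr// mulrC.
pose A := Num.max 1 ((2 * D / B) `^ q^-1).
have A1 : 1 <= A by rewrite le_max lexx.
have A0 : 0 < A by apply: lt_le_trans A1.
exists A, (K * (B / 2) * (2 * A) `^ (- (N / alo))); split => //.
  by rewrite !mulr_gt0 ?divr_gt0 ?powR_gt0 ?mulr_gt0.
move=> t x t0 x0 tauA tauA2; have xn := normv_gt0 x0.
set rho := (normv x)^-1 in tauA tauA2 *.
have r0 : 0 < rho by rewrite invr_gt0.
set T := t * psi rho in tauA tauA2 *.
have T1 : 1 <= T by apply: le_trans tauA.
have T0 : 0 < T by apply: lt_le_trans T1.
(* By the lower scaling, [psi] is at most [psi rho / T] up to the radius [delta * rho], so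
   [t Psi <= 1] and [e t >= exp (-1)] there. *)
pose delta := (clo / T) `^ alo^-1.
have cT0 : 0 < clo / T by rewrite divr_gt0.
have delta0 : 0 < delta by rewrite powR_gt0.
have clo1 : clo <= 1 by case: Hlo.
have delta1 : delta <= 1.
  have one : 1 `^ alo^-1 = 1 :> R by rewrite powR1.
  rewrite -[leRHS]one ge0_ler_powR ?invr_ge0 ?(ltW alo0)// ?nnegrE ?(ltW cT0)//.
  by rewrite ler_pdivrMr// mul1r (le_trans clo1).
have deltaE : delta `^ alo = clo / T.
  by rewrite /delta -powRrM mulVf ?gt_eqF// powRr1// ltW.
have deltaN : delta ^+ n.+1 = clo `^ (N / alo) * T `^ (- (N / alo)).
  have -> : delta ^+ n.+1 = (clo * T `^ (- 1)) `^ (N / alo).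
    by rewrite -powR_mulrn ?(ltW delta0)// /delta -powRrM (mulrC alo^-1) powR_inv1 ?(ltW T0).
  by rewrite (powRM _ (ltW clo0) (powR_ge0 _ _)) -powRrM mulN1r.
have mB := measurable_ballv (n := n.+1) (delta * rho).
have lamB := @lebesgue_ballv R n.+1 (delta * rho) (mulr_gt0 delta0 r0).
have [iJ EJ] := integrable_two_powers ak0 kN mN r0.
pose L1 (xi : Rn R n.+1) : R := 2^-1 * expR (-1) * \1_(ballv (delta * rho)) xi.
pose L2 (xi : Rn R n.+1) : R := C1 * T `^ (- m) * J (normv xi / rho).
have iB : lam.-integrable setT (EFin \o (\1_(ballv (delta * rho)) : _ -> R)).
  apply/integrableP; split; first exact/measurable_EFinP/measurable_indic.
  under eq_integral do rewrite /= ger0_norm//.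
  by rewrite integral_indic// setIT /= -[X in (X < _)%E]/(lam _) lamB ltry.
have iL1 : lam.-integrable setT (EFin \o L1).
  have := integrableZl measurableT (2^-1 * expR (-1)) iB.
  by under eq_fun do rewrite -EFinM.
have iL2 : lam.-integrable setT (EFin \o L2).
  have := integrableZl measurableT (C1 * T `^ (- m)) iJ.
  by under eq_fun do rewrite -EFinM.
(* Three zones: up to [delta * rho] both the cosine and [e t] are bounded below; up to [rho] the
   cosine is still positive, so the integrand may be dropped; beyond [rho] it is at least [- e t],
   controlled by [L2]. *)
have point xi : L1 xi - L2 xi <= cos (dotv xi x) * e t xi.
  have e0 : 0 <= e t xi by exact: expR_ge0.
  have [xr|xr] := leP (normv xi) rho; last first.
    rewrite /L1 indicE memNset ?mulr0 ?sub0r; last first.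
      rewrite /ballv/=; apply/negP; rewrite -ltNge (le_lt_trans _ xr)//.
      by rewrite ler_piMl// ltW.
    have h : e t xi <= L2 xi.
      rewrite /e levy_exponent_profile.
      by apply: expN_psi_le_out.
    have := cos_geN1 (dotv xi x); nra.
  have L20 : 0 <= L2 xi by rewrite mulr_ge0 ?two_powers_ge0// mulr_ge0// powR_ge0.
  have c2 : 2^-1 <= cos (dotv xi x).
    have : dotv xi x ^+ 2 <= 1.
      apply: le_trans (dotv_CauchySchwarz _ _) _; rewrite -!normv_sqr -exprMn exprn_ile1//.
        by rewrite mulr_ge0// normv_ge0.
      by rewrite -ler_pdivlMr// div1r.
    have := cos_ge_sqr (dotv xi x); lra.
  have : L1 xi <= 2^-1 * e t xi.
    rewrite /L1 indicE; case: (boolP (xi \in _)) => [|_]; last by rewrite mulr0 mulr_ge0// invr_ge0.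
    rewrite inE /ballv/= mulr1 ler_pM2l ?invr_gt0// => xd.
    rewrite /e ler_expR mulNr lerN2.
    have [->|/eqP xi0] := eqVneq xi zerov; first by rewrite (levy_exponent0 Hnu) mulr0.
    have xin := normv_gt0 xi0; rewrite levy_exponent_profile.
    have h1 := psi_le_lo Hlo xin xr.
    have h2 : (normv xi / rho) `^ alo <= clo / T.
      rewrite -deltaE ge0_ler_powR ?(ltW alo0)// ?nnegrE ?(ltW delta0)//.
        by rewrite divr_ge0// ltW.
      by rewrite ler_pdivrMr.
    have h3 : clo * psi (normv xi) <= clo / T * psi rho.
      by apply: le_trans h1 _; rewrite ler_wpM2r// ltW// psi0.
    have h4 : psi (normv xi) <= T^-1 * psi rho by rewrite -(ler_pM2l clo0) mulrA.
    apply: (@le_trans _ _ (t * (T^-1 * psi rho))); first by rewrite ler_pM2l.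
    by rewrite mulrCA -/T mulVf// gt_eqF.
  nra.
have main : rho ^+ n.+1 * (B * T `^ (- (N / alo)) - D * T `^ (- m)) <= cos_transform (e t) x.
  apply: (@le_trans _ _ (\int[lam]_xi (L1 xi - L2 xi))); last first.
    apply: le_Rintegral => //; last exact: integrable_cos_mul (integrable_expN_levy t0).
    have := integrableB measurableT iL1 iL2.
    by apply: (eq_integrable measurableT) => xi _ /=.
  rewrite RintegralB// RintegralZl// RintegralZl// EJ.
  have -> : \int[lam]_xi (\1_(ballv (delta * rho)) xi : R) = (delta * rho) ^+ n.+1 * V.
    rewrite /Rintegral integral_indic// setIT.
    by have := congr1 fine lamB.
  rewrite exprMn deltaN /B /D -/IJ le_eqVlt; apply/orP; left; apply/eqP; ring.
have Tm : T `^ (- m) = T `^ (- (N / alo)) * T `^ (- q).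
  rewrite -powRD; last by rewrite (gt_eqF T0) implybT.
  by congr (_ `^ _); rewrite /q; ring.
have Dq : D * T `^ (- q) <= B / 2.
  rewrite powRN ler_pdivrMr ?powR_gt0// mulrC -ler_pdivrMr ?divr_gt0//.
  rewrite (_ : D / (B / 2) = 2 * D / B); last by field; rewrite gt_eqF.
  have z0 : 0 <= 2 * D / B by rewrite divr_ge0 ?(ltW B0)// mulr_ge0.
  have h : (2 * D / B) `^ q^-1 <= T by apply: le_trans tauA; rewrite le_max lexx orbT.
  apply: (@le_trans _ _ (((2 * D / B) `^ q^-1) `^ q)).
    by rewrite -powRrM mulVf ?gt_eqF// powRr1.
  by apply: ge0_ler_powR h; rewrite ?nnegrE ?powR_ge0 ?(ltW q0) ?(ltW T0).
rewrite heat_densityE -/K.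
have -> : K * (B / 2) * (2 * A) `^ (- (N / alo)) * normv x ^- n.+1 =
    K * (normv x ^- n.+1 * ((2 * A) `^ (- (N / alo)) * (B / 2))) by ring.
rewrite ler_pM2l//; apply: le_trans main; rewrite exprVn Tm.
rewrite ler_wpM2l ?invr_ge0 ?exprn_ge0 ?(ltW xn)//.
have hT : (2 * A) `^ (- (N / alo)) <= T `^ (- (N / alo)).
  have A20 : 0 < 2 * A by rewrite mulr_gt0.
  have Na0 : 0 <= N / alo by rewrite divr_ge0// ltW.
  rewrite !powRN lef_pV2 ?posrE ?(powR_gt0 _ A20) ?(powR_gt0 _ T0)//.
  by apply: ge0_ler_powR => //; rewrite nnegrE ltW.
apply: (@le_trans _ _ (T `^ (- (N / alo)) * (B / 2))).
  by rewrite ler_wpM2r// divr_ge0// ltW.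
rewrite (_ : B * _ - _ = T `^ (- (N / alo)) * (B - D * T `^ (- q))); last by ring.
by rewrite ler_wpM2l ?powR_ge0//; move: Dq; lra.
Qed.

End heat_estimates.

(** * Potentials and Schrodinger perturbations *)

Section supermedian.
Local Open Scope ereal_scope.
Context {R : realType} {n : nat}.
Notation mu := (@lebesgue_measure R).
Notation X := (Rn R n).
Notation lam := (lebesgue_Rn R n).
Variable pt : R -> X -> R.
Hypothesis mpt : measurable_fun setT (fun u : R * X => pt u.1 u.2).
Hypothesis pt0 : forall t x, (0 < t)%R -> (0 <= pt t x)%R.
Hypothesis semigroup : forall t s x, (0 < t)%R -> (0 < s)%R ->
  \int[lam]_y (pt t (subv y x) * pt s y)%:E = (pt (t + s) x)%:E.
Variable g : R -> R.
Hypothesis mg : measurable_fun setT g.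
Hypothesis g0 : forall u, (0 <= g u)%R.
Hypothesis gN : forall u, (u <= 0)%R -> g u = 0%R.

(** Extended by 0 because [pt] is controlled for positive times only; all time integrals can then
    run over the whole line, where shifts are available. *)
Definition pos_part (v : R) (x : X) : R := if (0 < v)%R then pt v x else 0%R.
Notation pp := pos_part.

Definition tail_potential (u : R) (x : X) : \bar R :=
  \int[mu]_v (if (u < v)%R then pp v x else 0%R)%:E.

Definition potential (x : X) : \bar R := \int[mu]_u ((g u)%:E * tail_potential u x).

Definition density_potential (x : X) : \bar R := \int[mu]_u (g u * pp u x)%:E.

Lemma pos_part_ge0 v x : (0 <= pp v x)%R.
Proof. by rewrite /pos_part; case: ifP => // /pt0. Qed.

Lemma measurable_pt d (T : measurableType d) (a : T -> R) (b : T -> X) :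
  measurable_fun setT a -> measurable_fun setT b ->
  measurable_fun setT (fun t => pt (a t) (b t)).
Proof.
move=> ma mb; apply: (measurableT_comp mpt (g := fun t => (a t, b t))).
exact: measurable_fun_pair.
Qed.

Lemma measurable_pos_part d (T : measurableType d) (a : T -> R) (b : T -> X) :
  measurable_fun setT a -> measurable_fun setT b ->
  measurable_fun setT (fun t => pp (a t) (b t)).
Proof.
move=> ma mb; apply: measurable_fun_ifT => //; last exact: measurable_pt.
exact: measurable_fun_ltr.
Qed.

Let mtp2 : measurable_fun setT (fun u : (R * X) * R =>
  (if (u.1.1 < u.2)%R then pp u.2 u.1.2 else 0%R)%:E).
Proof.
apply/measurable_EFinP; apply: measurable_fun_ifT => //.
  apply: measurable_fun_ltr => //; exact: measurableT_comp.
by apply: measurable_pos_part => //; exact: measurableT_comp.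
Qed.

Lemma measurable_tail_potential d (T : measurableType d) (a : T -> R) (b : T -> X) :
  measurable_fun setT a -> measurable_fun setT b ->
  measurable_fun setT (fun t => tail_potential (a t) (b t)).
Proof.
move=> ma mb.
have m1 : measurable_fun setT (fun u : R * X => tail_potential u.1 u.2).
  exact: (@measurable_integral_param _ _ _ _ _ mu _ mtp2).
apply: (measurableT_comp m1 (g := fun t => (a t, b t))).
exact: measurable_fun_pair.
Qed.

Lemma tail_potential_ge0 u x : 0 <= tail_potential u x.
Proof. by apply: integral_ge0 => v _; case: ifP => _; rewrite lee_fin ?pos_part_ge0. Qed.

Lemma potential_ge0 x : 0 <= potential x.
Proof. by apply: integral_ge0 => u _; rewrite mule_ge0 ?lee_fin ?tail_potential_ge0. Qed.

Lemma density_potential_ge0 x : 0 <= density_potential x.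
Proof. by apply: integral_ge0 => u _; rewrite lee_fin mulr_ge0 ?pos_part_ge0. Qed.

Lemma measurable_potential : measurable_fun setT potential.
Proof.
apply: (@measurable_integral_param _ _ _ _ _ mu
  (fun w : X * R => (g w.2)%:E * tail_potential w.2 w.1)).
apply: emeasurable_funM.
  by apply/measurable_EFinP; exact: measurableT_comp.
exact: measurable_tail_potential.
Qed.

Lemma measurable_density_potential : measurable_fun setT density_potential.
Proof.
apply: (@measurable_integral_param _ _ _ _ _ mu
  (fun w : X * R => (g w.2 * pp w.2 w.1)%:E)).
apply/measurable_EFinP; apply: measurable_funM; first exact: measurableT_comp.
exact: measurable_pos_part.
Qed.

Let m_shift (x : X) : measurable_fun setT (fun y : X => subv y x).
Proof. exact: (@measurable_subv _ _ _ _ id (cst x)). Qed.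

(** Under the integral the semigroup law replaces [p_v] by [p_(v + t)], which is legitimate since
    [v > u >= 0]; a shift in time concludes. *)
Lemma integral_tail_potential t u x : (0 < t)%R -> (0 <= u)%R ->
  \int[lam]_y ((pt t (subv y x))%:E * tail_potential u y) = tail_potential (u + t) x.
Proof.
move=> t0 u0.
pose F (w : X * R) := ((pt t (subv w.1 x)) * (if (u < w.2)%R then pp w.2 w.1 else 0))%:E.
have F0 w : 0 <= F w.
  by rewrite lee_fin mulr_ge0 ?pt0//; case: ifP => // _; exact: pos_part_ge0.
have mF : measurable_fun setT F.
  apply/measurable_EFinP; apply: measurable_funM.
    by apply: measurable_pt => //; apply: (measurableT_comp (m_shift x)).
  apply: measurable_fun_ifT => //; first exact: measurable_fun_ltr.
  exact: measurable_pos_part.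
transitivity (\int[lam]_y \int[mu]_v F (y, v)).
  apply: eq_integral => y _; rewrite -ge0_integralZl; last 4 first.
  - exact: measurableT.
  - apply/measurable_EFinP; apply: measurable_fun_ifT => //; first exact: measurable_fun_ltr.
    exact: measurable_pos_part.
  - by move=> v _; rewrite lee_fin; case: ifP => // _; exact: pos_part_ge0.
  - by rewrite lee_fin pt0.
  by apply: eq_integral => v _; rewrite /F EFinM.
rewrite (@fubini_tonelli _ _ _ _ _ lam mu F)//.
rewrite /tail_potential -(@ge0_integral_shift _ _ t); last 2 first.
- apply/measurable_EFinP; apply: measurable_fun_ifT => //; first exact: measurable_fun_ltr.
  exact: measurable_pos_part.
- by move=> v; rewrite lee_fin; case: ifP => // _; exact: pos_part_ge0.
apply: eq_integral => v _; rewrite ltrD2r /F/=.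
case: ifPn => [uv|_]; last by apply: integral0_eq => y _; rewrite mulr0.
have v0 : (0 < v)%R by exact: le_lt_trans uv.
by rewrite /pos_part v0 addr_gt0// semigroup// addrC.
Qed.

Lemma integral_potential t x : (0 < t)%R ->
  \int[lam]_y ((pt t (subv y x))%:E * potential y) =
  \int[mu]_u ((g u)%:E * tail_potential (u + t) x).
Proof.
move=> t0.
pose F (w : X * R) := (pt t (subv w.1 x))%:E * ((g w.2)%:E * tail_potential w.2 w.1).
have F0 w : 0 <= F w.
  by rewrite mule_ge0 ?mule_ge0 ?lee_fin ?pt0// tail_potential_ge0.
have mgt : measurable_fun setT (fun w : X * R => (g w.2)%:E * tail_potential w.2 w.1).
  apply: emeasurable_funM.
    by apply/measurable_EFinP; exact: measurableT_comp.
  exact: measurable_tail_potential.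
have mF : measurable_fun setT F.
  apply: emeasurable_funM => //; apply/measurable_EFinP.
  by apply: measurable_pt => //; apply: (measurableT_comp (m_shift x)).
transitivity (\int[lam]_y \int[mu]_v F (y, v)).
  apply: eq_integral => y _; rewrite -ge0_integralZl; last 4 first.
  - exact: measurableT.
  - by apply: emeasurable_funM; [exact/measurable_EFinP|exact: measurable_tail_potential].
  - by move=> v _; rewrite mule_ge0 ?lee_fin// tail_potential_ge0.
  - by rewrite lee_fin pt0.
  by [].
rewrite (@fubini_tonelli _ _ _ _ _ lam mu F)//.
apply: eq_integral => u _.
have [u0|/ltW u0] := leP u 0%R.
  by rewrite gN// mul0e; apply: integral0_eq => y _; rewrite /F/= gN// mul0e mule0.
rewrite -(integral_tail_potential x t0 u0) -ge0_integralZl; last 4 first.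
- exact: measurableT.
- apply: emeasurable_funM; last exact: measurable_tail_potential.
  by apply/measurable_EFinP; apply: measurable_pt.
- by move=> y _; rewrite mule_ge0 ?lee_fin ?pt0// tail_potential_ge0.
- by rewrite lee_fin.
by apply: eq_integral => y _; rewrite /F/= muleCA.
Qed.

Lemma integral_density_potential s x : (0 < s)%R ->
  \int[lam]_y ((pt s (subv y x))%:E * density_potential y) =
  \int[mu]_u (g u * pp (u + s) x)%:E.
Proof.
move=> s0.
pose F (w : X * R) := (pt s (subv w.1 x) * (g w.2 * pp w.2 w.1))%:E.
have F0 w : 0 <= F w by rewrite lee_fin !mulr_ge0// ?pt0// pos_part_ge0.
have mgp : measurable_fun setT (fun w : X * R => g w.2 * pp w.2 w.1)%R.
  by apply: measurable_funM; [exact: measurableT_comp|exact: measurable_pos_part].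
have mF : measurable_fun setT F.
  apply/measurable_EFinP; apply: measurable_funM => //.
  by apply: measurable_pt => //; apply: (measurableT_comp (m_shift x)).
transitivity (\int[lam]_y \int[mu]_v F (y, v)).
  apply: eq_integral => y _; rewrite -ge0_integralZl; last 4 first.
  - exact: measurableT.
  - by apply/measurable_EFinP; apply: measurable_funM => //; exact: measurable_pos_part.
  - by move=> v _; rewrite lee_fin mulr_ge0 ?pos_part_ge0.
  - by rewrite lee_fin pt0.
  by apply: eq_integral => v _; rewrite /F EFinM.
rewrite (@fubini_tonelli _ _ _ _ _ lam mu F)//.
apply: eq_integral => u _; rewrite /F/=.
have [u0|u0] := leP u 0%R.
  by rewrite gN// mul0r; apply: integral0_eq => y _; rewrite mul0r mulr0.
rewrite /pos_part u0 addr_gt0// addrC EFinM -semigroup// -ge0_integralZl; last 4 first.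
- exact: measurableT.
- apply/measurable_EFinP; apply: measurable_funM; last exact: measurable_pt.
  by apply: measurable_pt.
- by move=> y _; rewrite lee_fin mulr_ge0// pt0.
- by rewrite lee_fin.
by apply: eq_integral => y _; rewrite -EFinM mulrCA.
Qed.

(* [KK (u + t)] and the integral of [pp] over [(u, u + t)] add up to [KK u],
   where [KK] is the tail potential. *)
Lemma potential_supermedian t x : (0 < t)%R ->
  \int[lam]_y ((pt t (subv y x))%:E * potential y) +
  \int[mu]_(s in `]0%R, t[) \int[lam]_y ((pt s (subv y x))%:E * density_potential y)
  <= potential x.
Proof.
move=> t0; rewrite integral_potential//.
(* The condition [0 < s < t] becomes part of the integrand, so that Tonelli can exchange the two
   time integrals over the line. *)
pose F (w : R * R) := (g w.2 * (if (0 < w.1)%R && (w.1 < t)%R then pp (w.2 + w.1) x else 0))%:E.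
have F0 w : 0 <= F w.
  by rewrite lee_fin mulr_ge0//; case: ifP => // _; exact: pos_part_ge0.
have mF : measurable_fun setT F.
  apply/measurable_EFinP; apply: measurable_funM; first exact: measurableT_comp.
  apply: measurable_fun_ifT => //.
    by apply: measurable_and; exact: measurable_fun_ltr.
  by apply: measurable_pos_part => //; exact: measurable_funD.
have -> : \int[mu]_(s in `]0%R, t[) \int[lam]_y ((pt s (subv y x))%:E * density_potential y)
    = \int[mu]_s \int[mu]_u F (s, u).
  rewrite integral_mkcond; apply: eq_integral => s _; rewrite patchE.
  case: ifPn => [|].
    rewrite inE/= in_itv/= => /andP[s0 st]; rewrite integral_density_potential//.
    by apply: eq_integral => u _; rewrite /F/= s0 st.
  rewrite notin_setE/= in_itv/= => /negP/negbTE h.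
  by apply/esym; apply: integral0_eq => u _; rewrite /F/= h mulr0.
rewrite (@fubini_tonelli _ _ _ _ _ mu mu F)// -ge0_integralD//; last 4 first.
- by move=> u _; rewrite mule_ge0 ?lee_fin ?tail_potential_ge0.
- apply: emeasurable_funM; first exact/measurable_EFinP.
  by apply: measurable_tail_potential => //; exact: measurable_funD.
- by move=> u _; exact: integral_ge0.
- exact: (measurable_fun_fubini_tonelli_G (m1 := mu) F).
apply: ge0_le_integral => //.
- move=> u _; rewrite adde_ge0 ?integral_ge0// mule_ge0 ?lee_fin ?tail_potential_ge0//.
- apply: emeasurable_funD.
    apply: emeasurable_funM; first exact/measurable_EFinP.
    by apply: measurable_tail_potential => //; exact: measurable_funD.
  exact: (measurable_fun_fubini_tonelli_G (m1 := mu) F).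
- apply: emeasurable_funM; first exact/measurable_EFinP.
  exact: measurable_tail_potential.
move=> u _.
pose b (w : R) := if ((u < w) && (w < u + t))%R then pp w x else 0%R.
have b0 w : (0 <= b w)%R by rewrite /b; case: ifP => // _; exact: pos_part_ge0.
have mb : measurable_fun setT b.
  apply: measurable_fun_ifT => //; last exact: measurable_pos_part.
  by apply: measurable_and; exact: measurable_fun_ltr.
have -> : \int[mu]_s F (s, u) = (g u)%:E * \int[mu]_w (b w)%:E.
  rewrite -(@ge0_integral_shift _ (fun w => (b w)%:E) u); last 2 first.
  - exact/measurable_EFinP.
  - by move=> w; rewrite lee_fin.
  rewrite -ge0_integralZl; last 4 first.
  - exact: measurableT.
  - by apply/measurable_EFinP; apply: (measurableT_comp mb); exact: measurable_funD.
  - by move=> w _; rewrite lee_fin.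
  - by rewrite lee_fin.
  apply: eq_integral => s _; rewrite /F /b/= -EFinM.
  by rewrite ltrDr (addrC s u) ltrD2l.
rewrite -ge0_muleDr ?tail_potential_ge0//; last by apply: integral_ge0 => w _; rewrite lee_fin.
rewrite lee_wpmul2l ?lee_fin// /tail_potential -ge0_integralD//; last 4 first.
- by move=> v _; rewrite lee_fin; case: ifP => // _; exact: pos_part_ge0.
- apply/measurable_EFinP; apply: measurable_fun_ifT => //; first exact: measurable_fun_ltr.
  exact: measurable_pos_part.
- by move=> v _; rewrite lee_fin.
- exact/measurable_EFinP.
apply: ge0_le_integral => //.
- by move=> v _; rewrite adde_ge0// lee_fin//; case: ifP => // _; exact: pos_part_ge0.
- apply: emeasurable_funD; last exact/measurable_EFinP.
  apply/measurable_EFinP; apply: measurable_fun_ifT => //; first exact: measurable_fun_ltr.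
  exact: measurable_pos_part.
- apply/measurable_EFinP; apply: measurable_fun_ifT => //; first exact: measurable_fun_ltr.
  exact: measurable_pos_part.
(* The indicators of [v > u + t] and of [u < v < u + t] add up to at most that of [v > u]; only the
   point [u + t] is lost. *)
move=> v _; rewrite -EFinD lee_fin /b.
have [uv|uv] := ltP u v; rewrite /=.
  by case: ltgtP => _; rewrite ?addr0 ?add0r// pos_part_ge0.
by rewrite ltNge (le_trans uv) ?lerDl ?(ltW t0)//= addr0.
Qed.

End supermedian.

(** * Perturbation series against a supermedian function *)

Section schrodinger_supermedian.
Local Open Scope ereal_scope.
Context {R : realType} {n : nat}.
Notation mu := (@lebesgue_measure R).
Notation X := (Rn R n).
Notation lam := (lebesgue_Rn R n).
Variable p : R -> X -> X -> R.
Hypothesis mp : measurable_fun setT (fun u : R * X * X => p u.1.1 u.1.2 u.2).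
Hypothesis p0 : forall t x y, (0 < t)%R -> (0 <= p t x y)%R.
Variable q : X -> R.
Hypothesis mq : measurable_fun setT q.
Hypothesis q0 : forall z, (0 <= q z)%R.
Variable H : X -> \bar R.
Hypothesis mH : measurable_fun setT H.
Hypothesis H0 : forall z, 0 <= H z.
Hypothesis supermedian : forall t x, (0 < t)%R ->
  \int[lam]_y ((p t x y)%:E * H y) +
  \int[mu]_(s in `]0%R, t[) \int[lam]_z ((p s x z)%:E * ((q z)%:E * H z)) <= H x.

Notation S := (schrodinger_term p q).

Lemma measurable_comp_kernel d (T : measurableType d) (a : T -> R) (b c : T -> X) :
  measurable_fun setT a -> measurable_fun setT b -> measurable_fun setT c ->
  measurable_fun setT (fun t => p (a t) (b t) (c t)).
Proof.
move=> ma mb mc; apply: (measurableT_comp mp (g := fun t => ((a t, b t), c t))).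
by apply: measurable_fun_pair => //; exact: measurable_fun_pair.
Qed.

(** The parameter space [T] is arbitrary so that the induction can be applied over [T * R * X],
    where the time is [a - s] and the integration variables have become parameters. *)
Lemma measurable_schrodinger_term m d (T : measurableType d) (a : T -> R) (b c : T -> X) :
  measurable_fun setT a -> measurable_fun setT b -> measurable_fun setT c ->
  measurable_fun setT (fun t => S m (a t) (b t) (c t)).
Proof.
elim: m d T a b c => [|m ih] d T a b c ma mb mc /=.
  by apply/measurable_EFinP; exact: measurable_comp_kernel.
under eq_fun do rewrite integral_mkcond.
pose F (w : T * R * X) := (p w.1.2 (b w.1.1) w.2 * q w.2)%:E *
  S m (a w.1.1 - w.1.2)%R w.2 (c w.1.1).
have mF : measurable_fun setT F.
  have m1 : measurable_fun setT (fun w : T * R * X => w.1.1) by exact: measurableT_comp.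
  have m2 : measurable_fun setT (fun w : T * R * X => w.1.2) by exact: measurableT_comp.
  apply: emeasurable_funM.
    apply/measurable_EFinP; apply: measurable_funM; last exact: measurableT_comp.
    by apply: measurable_comp_kernel => //; exact: (measurableT_comp mb).
  apply: ih => //; last exact: (measurableT_comp mc).
  by apply: measurable_funB => //; exact: (measurableT_comp ma).
have mG := @measurable_integral_param _ _ _ _ _ lam F mF.
pose G (w : T * R) := if (0 < w.2)%R && (w.2 < a w.1)%R then \int[lam]_z F (w, z) else 0.
have mG' : measurable_fun setT G.
  apply: measurable_fun_ifT => //; apply: measurable_and.
    exact: measurable_fun_ltr.
  by apply: measurable_fun_ltr => //; exact: (measurableT_comp ma).
rewrite (_ : (fun t => _) = fun t => \int[mu]_s G (t, s)); last first.
  apply/funext => t; apply: eq_integral => s _; rewrite patchE /=.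
  by rewrite mem_setE in_itv.
exact: (@measurable_integral_param _ _ _ _ _ mu G mG').
Qed.

Lemma schrodinger_term_ge0 m t x y : (0 < t)%R -> 0 <= S m t x y.
Proof.
elim: m t x y => [|m ih] t x y t0 /=; first by rewrite lee_fin p0.
apply: integral_ge0 => s; rewrite /= in_itv/= => /andP[s0 st].
apply: integral_ge0 => z _; rewrite mule_ge0 ?lee_fin ?mulr_ge0 ?p0//.
by apply: ih; rewrite subr_gt0.
Qed.

Notation P m t x := (\int[lam]_y (S m t x y * H y)).

Let P_ge0 m t x : (0 < t)%R -> 0 <= P m t x.
Proof. by move=> t0; apply: integral_ge0 => y _; rewrite mule_ge0// schrodinger_term_ge0. Qed.

Let measurable_P m d (T : measurableType d) (a : T -> R) (b : T -> X) :
  measurable_fun setT a -> measurable_fun setT b ->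
  measurable_fun setT (fun t => P m (a t) (b t)).
Proof.
move=> ma mb; apply: (@measurable_integral_param _ _ _ _ _ lam
  (fun w : T * X => S m (a w.1) (b w.1) w.2 * H w.2)).
apply: emeasurable_funM; last exact: measurableT_comp.
by apply: measurable_schrodinger_term => //; exact: measurableT_comp.
Qed.

(** The recursion of the series integrated against [H]: Tonelli carries the integral in [y] inside
    the integrals in [s] and in [z]. *)
Let PS m t x : (0 < t)%R -> P m.+1 t x =
  \int[mu]_(s in `]0%R, t[) \int[lam]_z ((p s x z * q z)%:E * P m (t - s) z).
Proof.
move=> t0.
(* Terms are known to be nonnegative at positive times only, so the integrand is cut to [0 < s < t]
   before Tonelli is used. *)
pose A (s : R) (z y : X) := if (0 < s)%R && (s < t)%R then
  (p s x z * q z)%:E * S m (t - s)%R z y else 0.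
have A0 s z y : 0 <= A s z y.
  rewrite /A; case: ifP => // /andP[s0 st].
  by rewrite mule_ge0 ?lee_fin ?mulr_ge0 ?p0// schrodinger_term_ge0// subr_gt0.
have mA d (T : measurableType d) (a : T -> R) (b c : T -> X) :
    measurable_fun setT a -> measurable_fun setT b -> measurable_fun setT c ->
    measurable_fun setT (fun w => A (a w) (b w) (c w)).
  move=> ma mb mc; apply: measurable_fun_ifT => //.
    by apply: measurable_and; exact: measurable_fun_ltr.
  apply: emeasurable_funM.
    apply/measurable_EFinP; apply: measurable_funM; last exact: (measurableT_comp mq).
    exact: measurable_comp_kernel.
  by apply: measurable_schrodinger_term => //; exact: measurable_funB.
have AE s z y : (0 < s < t)%R -> A s z y = (p s x z * q z)%:E * S m (t - s)%R z y.
  by rewrite /A => ->.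
have AN s z y : ~~ (0 < s < t)%R -> A s z y = 0 by rewrite /A => /negbTE ->.
have SE y : S m.+1 t x y = \int[mu]_s \int[lam]_z A s z y.
  rewrite /= integral_mkcond; apply: eq_integral => s _; rewrite patchE mem_setE in_itv/=.
  case: ifPn => h; first by apply: eq_integral => z _; rewrite AE.
  by apply/esym; apply: integral0_eq => z _; rewrite AN.
pose F1 (w : X * R) := \int[lam]_z (A w.2 z w.1) * H w.1.
have mintA : measurable_fun setT (fun w : X * R => \int[lam]_z A w.2 z w.1).
  apply: (@measurable_integral_param _ _ _ _ _ lam (fun v : (X * R) * X => A v.1.2 v.2 v.1.1)).
  by apply: mA => //; exact: measurableT_comp.
have mF1 : measurable_fun setT F1.
  by apply: emeasurable_funM => //; exact: measurableT_comp.
have intA0 w : 0 <= \int[lam]_z A w.2 z w.1 :> \bar R by exact: integral_ge0.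
have F10 w : 0 <= F1 w by rewrite mule_ge0// intA0.
transitivity (\int[lam]_y \int[mu]_s F1 (y, s)).
  apply: eq_integral => y _; rewrite SE -ge0_integralZr; last 4 first.
  - exact: measurableT.
  - apply: (measurableT_comp mintA (g := fun s : R => (y, s))); exact: pair1_measurable.
  - by move=> s _; exact: (intA0 (y, s)).
  - exact: H0.
  by [].
rewrite (@fubini_tonelli _ _ _ _ _ lam mu F1 mF1 F10) [RHS]integral_mkcond.
apply: eq_integral => s _; rewrite patchE mem_setE in_itv/=.
case: ifPn => h; last first.
  apply: integral0_eq => y _; rewrite /F1/=.
  by rewrite (_ : \int[lam]_z _ = 0) ?mul0e//; apply: integral0_eq => z _; rewrite AN.
have /andP[s0 st] := h.
have ts0 : (0 < t - s)%R by rewrite subr_gt0.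
pose F2 (w : X * X) := A s w.2 w.1 * H w.1.
have mF2 : measurable_fun setT F2.
  by apply: emeasurable_funM; [apply: mA|exact: measurableT_comp].
have F20 w : 0 <= F2 w by rewrite mule_ge0.
transitivity (\int[lam]_y \int[lam]_z F2 (y, z)).
  apply: eq_integral => y _; rewrite /F1/= -ge0_integralZr; last 4 first.
  - exact: measurableT.
  - by apply: mA.
  - by [].
  - exact: H0.
  by [].
rewrite (@fubini_tonelli _ _ _ _ _ lam lam F2 mF2 F20).
apply: eq_integral => z _; rewrite -ge0_integralZl; last 4 first.
- exact: measurableT.
- by apply: emeasurable_funM => //; exact: measurable_schrodinger_term.
- by move=> y _; rewrite mule_ge0// schrodinger_term_ge0.
- by rewrite lee_fin mulr_ge0// p0.
by apply: eq_integral => y _; rewrite /F2/= AE// muleA.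
Qed.

(** Split off the term 0. By [PS] the others are an integral of [p_s q] against the shorter partial
    sum at time [t - s], which the induction bounds by [H]; what remains is the hypothesis
    [supermedian]. All times and points must therefore be treated at once. *)
Lemma schrodinger_partial_sum_le m t x : (0 < t)%R ->
  \sum_(k < m) P k t x <= H x.
Proof.
elim: m t x => [|m ih] t x t0; first by rewrite big_ord0.
rewrite big_ord_recl /=.
apply: le_trans (supermedian x t0); rewrite leeD2l//.
pose B k (s : R) := if (0 < s)%R && (s < t)%R then
  \int[lam]_z ((p s x z * q z)%:E * P k (t - s)%R z) else 0.
have B0 k s : 0 <= B k s.
  rewrite /B; case: ifP => // /andP[s0 st]; apply: integral_ge0 => z _.
  by rewrite mule_ge0 ?lee_fin ?mulr_ge0 ?p0// P_ge0// subr_gt0.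
have mpq (s : R) : measurable_fun setT (fun z => (p s x z * q z)%:E).
  apply/measurable_EFinP; apply: measurable_funM => //.
  exact: (@measurable_comp_kernel _ _ (cst s) (cst x) id).
have mB k : measurable_fun setT (B k).
  apply: measurable_fun_ifT => //.
    by apply: measurable_and; exact: measurable_fun_ltr.
  apply: (@measurable_integral_param _ _ _ _ _ lam
    (fun w : R * X => (p w.1 x w.2 * q w.2)%:E * P k (t - w.1)%R w.2)).
  apply: emeasurable_funM.
    apply/measurable_EFinP; apply: measurable_funM; last exact: measurableT_comp.
    exact: (@measurable_comp_kernel _ _ fst (cst x) snd).
  by apply: measurable_P => //; exact: measurable_funB.
rewrite (eq_bigr (fun k : 'I_m => \int[mu]_s B k s)); last first.
  move=> k _; rewrite PS// integral_mkcond; apply: eq_integral => s _.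
  by rewrite patchE mem_setE in_itv/=.
rewrite -(big_mkord xpredT (fun k => \int[mu]_s B k s)) -ge0_integral_sum//.
rewrite [leRHS]integral_mkcond; apply: ge0_le_integral => //.
- by move=> s _; rewrite sume_ge0.
- exact: emeasurable_sum.
- rewrite (_ : _ \_ _ = fun s => if (0 < s)%R && (s < t)%R then
    \int[lam]_z ((p s x z)%:E * ((q z)%:E * H z)) else 0); last first.
    by apply/funext => s; rewrite patchE mem_setE in_itv/=.
  apply: measurable_fun_ifT => //.
    by apply: measurable_and; exact: measurable_fun_ltr.
  apply: (@measurable_integral_param _ _ _ _ _ lam
    (fun w : R * X => (p w.1 x w.2)%:E * ((q w.2)%:E * H w.2))).
  apply: emeasurable_funM.
    apply/measurable_EFinP; exact: (@measurable_comp_kernel _ _ fst (cst x) snd).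
  apply: emeasurable_funM; last exact: measurableT_comp.
  by apply/measurable_EFinP; exact: measurableT_comp.
move=> s _; rewrite patchE mem_setE in_itv/= /B; case: ifP => [/andP[s0 st]|_]; last first.
  by rewrite big1.
have ts0 : (0 < t - s)%R by rewrite subr_gt0.
rewrite -ge0_integral_sum//; last 2 first.
- by move=> k; apply: emeasurable_funM => //; exact: (@measurable_P k _ _ (cst (t - s)%R) id).
- by move=> k z _; rewrite mule_ge0 ?lee_fin ?mulr_ge0 ?p0// P_ge0.
apply: ge0_le_integral => //.
- move=> z _; apply: sume_ge0 => k _.
  by rewrite mule_ge0 ?lee_fin ?mulr_ge0 ?p0// P_ge0.
- apply: emeasurable_sum => k.
  by apply: emeasurable_funM => //; exact: (@measurable_P k _ _ (cst (t - s)%R) id).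
- apply: emeasurable_funM.
    apply/measurable_EFinP; exact: (@measurable_comp_kernel _ _ (cst s) (cst x) id).
  by apply: emeasurable_funM => //; exact/measurable_EFinP.
move=> z _; rewrite muleA -EFinM -ge0_sume_distrr; last by move=> k _; exact: P_ge0.
rewrite lee_wpmul2l ?lee_fin ?mulr_ge0 ?p0//.
by rewrite big_mkord; exact: ih.
Qed.

(** The series is integrated termwise by nonnegativity, and the bound on partial sums does not
    depend on their length. Passing from [h] to [c * H] happens term by term. *)
Lemma integral_schrodinger_le (h : X -> R) (c : R) t x :
  measurable_fun setT h -> (forall y, (0 <= h y)%R) -> (0 <= c)%R ->
  (forall y, (h y)%:E <= c%:E * H y) -> (0 < t)%R ->
  \int[lam]_y (schrodinger p q t x y * (h y)%:E) <= c%:E * H x.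
Proof.
move=> mh h0 c0 hH t0.
have mS m : measurable_fun setT (fun y => S m t x y).
  exact: (@measurable_schrodinger_term m _ _ (cst t) (cst x) id).
have Sh0 m y : 0 <= S m t x y * (h y)%:E by rewrite mule_ge0 ?lee_fin// schrodinger_term_ge0.
have mSh m : measurable_fun setT (fun y => S m t x y * (h y)%:E).
  by apply: emeasurable_funM => //; exact/measurable_EFinP.
have -> : \int[lam]_y (schrodinger p q t x y * (h y)%:E) =
    \int[lam]_y \sum_(0 <= m <oo) (S m t x y * (h y)%:E).
  apply: eq_integral => y _; rewrite /schrodinger muleC -nneseriesZl//.
    by apply: eq_eseriesr => m _; rewrite muleC.
  by move=> m _; exact: schrodinger_term_ge0.
rewrite integral_nneseries//.
apply: lime_le.
  by apply: is_cvg_nneseries => m _ _; exact: integral_ge0.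
apply: nearW => m; rewrite big_mkord.
apply: (@le_trans _ _ (\sum_(k < m) (c%:E * P k t x))).
  apply: lee_sum => k _; rewrite -ge0_integralZl; last 4 first.
  - exact: measurableT.
  - exact: emeasurable_funM.
  - by move=> y _; rewrite mule_ge0// schrodinger_term_ge0.
  - by rewrite lee_fin.
  apply: ge0_le_integral => //.
  - by apply: emeasurable_funM => //; exact: emeasurable_funM.
  - move=> y _; rewrite muleCA lee_wpmul2l// schrodinger_term_ge0//.
rewrite -ge0_sume_distrr; last by move=> k _; exact: P_ge0.
by rewrite lee_wpmul2l ?lee_fin// schrodinger_partial_sum_le.
Qed.

End schrodinger_supermedian.

(** * Comparison of the potentials with the weight *)

Section potential_estimates.
Context {R : realType} {n : nat}.
Notation mu := (@lebesgue_measure R).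
Notation lam := (lebesgue_Rn R n.+1).
Notation N := (n.+1%:R : R).
Variables (nu : {measure set (Rn R n.+1) -> \bar R}) (nur : R -> R).
Hypothesis Hnu : infinite_isotropic_unimodal_levy nu nur.
Notation Psi := (levy_exponent nu).
Notation psi := (radial_profile Psi).
Variables (alo clo aup cup : R).
Hypotheses (alo0 : 0 < alo) (aup0 : 0 < aup).
Hypotheses (Hlo : WLSC alo clo psi) (Hup : WUSC aup cup psi).
Hypothesis Psi_neq0 : exists xi, Psi xi <> 0.
Variable beta : R.
Hypotheses (beta0 : 0 < beta) (betaN : beta < (N - aup) / aup).

(** The midpoint of [beta + 1] and [N / aup], an interval that is nonempty by [betaN]. Then [m] is
    taken large enough for [kappa <= m] and for integrability at infinity, [N < alo * m]. *)
Let kappa := (beta + 1 + N / aup) / 2.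
Let m := Num.max kappa (N / alo + 1).

Let bN : beta + 1 < N / aup.
Proof.
rewrite -ltrBrDr; apply: lt_le_trans betaN _.
by rewrite mulrBl divff ?gt_eqF.
Qed.

Let kb : beta + 1 < kappa. Proof. by rewrite /kappa; move: bN; lra. Qed.
Let kappa0 : 0 < kappa. Proof. by move: kb beta0; lra. Qed.
Let kN : aup * kappa < N.
Proof. by rewrite mulrC -ltr_pdivlMr// /kappa; move: bN; lra. Qed.
Let km : kappa <= m. Proof. by rewrite le_max lexx. Qed.
Let mN : N < alo * m.
Proof. by rewrite mulrC -ltr_pdivrMr// lt_max ltrDl ltr01 orbT. Qed.

Notation p := (heat_density Psi).
Let psi0 r : 0 < r -> 0 < psi r.
Proof. exact: (levy_profile_gt0 Hnu Hlo Hup Psi_neq0). Qed.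
Let iP t : 0 < t -> lam.-integrable setT (EFin \o (fun xi => expR (- t * Psi xi))).
Proof.
exact: (integrable_expN_levy Hnu aup0 Hlo Hup Psi_neq0 kappa0 km kN mN).
Qed.

Lemma measurable_heat_density : measurable_fun setT (fun u : R * Rn R n.+1 => p u.1 u.2).
Proof.
rewrite (_ : (fun u => _) = fun u : R * Rn R n.+1 => (2 * pi) ^- n.+1 *
    \int[lam]_xi (cos (dotv xi u.2) * expR (- u.1 * Psi xi))); last first.
  by apply/funext => u; rewrite heat_densityE.
apply: measurable_funM => //.
apply: (@measurable_Rintegral_param _ _ _ _ _ lam
  (fun w : R * Rn R n.+1 * Rn R n.+1 => cos (dotv w.2 w.1.2) * expR (- w.1.1 * Psi w.2))).
apply: measurable_funM.
  by apply: measurable_cos_dotv; [exact: measurable_snd|exact: measurableT_comp].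
apply: (measurableT_comp (f := @expR R)) => //; apply: measurable_funM.
  by apply: measurable_funN; exact: measurableT_comp.
apply: measurableT_comp => //; exact: (measurable_levy_exponent Hnu).
Qed.

Definition power_weight (u : R) : R := if 0 < u then u `^ (beta - 1) else 0.
Notation g := power_weight.

Lemma power_weight_ge0 u : 0 <= g u.
Proof. by rewrite /power_weight; case: ifP => // _; exact: powR_ge0. Qed.

Lemma measurable_power_weight : measurable_fun setT g.
Proof.
apply: measurable_fun_ifT; [exact: measurable_fun_ltr|exact: measurable_powR|by []].
Qed.

Lemma power_weight_le0 u : u <= 0 -> g u = 0.
Proof. by rewrite /power_weight ltNge => ->. Qed.

Notation H := (potential p g).
Notation G := (density_potential p g).
Let p0 t x : 0 < t -> 0 <= p t x.
Proof. by move=> t0; exact: (heat_density_ge0 Hnu iP). Qed.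

Definition hardy (y : Rn R n.+1) : R :=
  psi (normv y)^-1 `^ (- beta - 1) * (normv y) ^- n.+1.

Let pp_x x : measurable_fun setT (fun v : R => pos_part p v x).
Proof.
exact: (@measurable_pos_part _ _ _ measurable_heat_density _ _ id (cst x)).
Qed.

Let inner_le (v : R) : 0 < v ->
  (\int[mu]_u (if u < v then g u else 0)%:E <= (v `^ beta / beta)%:E)%E.
Proof.
move=> v0; apply: le_trans (integral_powR_near0 beta0 v0).
rewrite [leRHS]integral_mkcond; apply: ge0_le_integral => //.
- by move=> u _; rewrite lee_fin; case: ifP => // _; exact: power_weight_ge0.
- apply/measurable_EFinP; apply: measurable_fun_ifT => //.
    exact: measurable_fun_ltr.
  exact: measurable_power_weight.
- apply: (proj1 (measurable_restrictT _ (measurable_itv _))).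
  by apply: measurable_funTS; apply/measurable_EFinP; exact: measurable_powR.
- move=> u _; rewrite patchE mem_setE in_itv/= /power_weight.
  have [u0|u0] := ltP 0 u; last by rewrite if_same.
  have [uv|uv] := ltP u v; first by rewrite (ltW uv).
  by case: ifP => // _; rewrite lee_fin powR_ge0.
Qed.

(** Exchanging the integrals leaves at most the integral of [p_v x * v^beta / beta]. It is split at
    [T = 1 / psi (1/|x|)]: below [T] the unimodal bound applies, above it the tail bound, whose
    power [v^(beta - kappa)] is integrable because [kappa > beta + 1]. Both parts are multiples of
    [|x|^-N T^(beta + 1)]. *)
Lemma potential_le : exists C : R, 0 < C /\
  forall x, x <> zerov -> (H x <= (C * hardy x)%:E)%E.
Proof.
pose V := @ball_volume R n.+1.
have V0 : 0 < V by exact: ball_volume_gt0.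
pose c2 : R := (2 * pi) ^- n.+1 * exp_bound_const clo cup kappa m * 2 *
  two_powers_mass (n := n) (aup * kappa) (alo * m).
have c20 : 0 <= c2.
  rewrite !mulr_ge0 ?exp_bound_const_ge0 ?two_powers_mass_ge0//.
  by rewrite invr_ge0 exprn_ge0// mulr_ge0// pi_ge0.
pose c := kappa - beta - 1.
have c0 : 0 < c by rewrite /c; move: kb; lra.
have b10 : 0 < beta + 1 by rewrite addr_gt0.
(* One summand for each side of [T]; the divisor [beta] comes from the integral of [g] up to [v]. *)
pose C := V^-1 / beta / (beta + 1) + c2 / beta / c.
exists C; split.
  by rewrite ltr_wpDr ?divr_gt0 ?invr_gt0// !divr_ge0// ltW.
move=> x x0; have xn := normv_gt0 x0.
set r := normv x in xn; set P := psi r^-1.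
have P0 : 0 < P by rewrite psi0// invr_gt0.
pose T := P^-1.
have T0 : 0 < T by rewrite invr_gt0.
pose F (w : R * R) : R := g w.1 * (if w.1 < w.2 then pos_part p w.2 x else 0).
have F0 w : 0 <= F w.
  rewrite mulr_ge0 ?power_weight_ge0//; case: ifP => // _; exact: pos_part_ge0.
have mF : measurable_fun setT F.
  apply: measurable_funM.
    by apply: measurableT_comp => //; exact: measurable_power_weight.
  apply: measurable_fun_ifT => //; first exact: measurable_fun_ltr.
  by apply: (measurableT_comp (pp_x x)).
have E1 : H x = (\int[mu]_v \int[mu]_u (F (u, v))%:E)%E.
  rewrite -(@fubini_tonelli _ _ _ _ _ mu mu (EFin \o F)); last 2 first.
  - exact/measurable_EFinP.
  - by move=> w; rewrite lee_fin.
  apply: eq_integral => u _; rewrite -ge0_integralZl; last 4 first.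
  - exact: measurableT.
  - apply/measurable_EFinP; apply: measurable_fun_ifT;
      [exact: measurable_fun_ltr|exact: pp_x|by []].
  - by move=> v _; rewrite lee_fin; case: ifP => // _; exact: pos_part_ge0.
  - by rewrite lee_fin power_weight_ge0.
  by apply: eq_integral => v _; rewrite /= /F EFinM.
pose a1 := V^-1 * r ^- n.+1 / beta.
pose a2 := c2 * r ^- n.+1 * P `^ (- kappa) / beta.
have rn0 : 0 <= r ^- n.+1 by rewrite invr_ge0 exprn_ge0// ltW.
have a10 : 0 <= a1 by rewrite /a1 divr_ge0 ?(ltW beta0)// mulr_ge0// invr_ge0 ltW.
have a20 : 0 <= a2.
  by apply: divr_ge0; [apply: mulr_ge0; [exact: mulr_ge0|exact: powR_ge0]|exact: ltW].
pose g1 := (fun v : R => (v `^ ((beta + 1) - 1))%:E) \_ `]0, T].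
pose g2 := (fun v : R => (v `^ (- c - 1))%:E) \_ `[T, +oo[.
have g10 v : (0 <= g1 v)%E by rewrite /g1 patchE; case: ifP => // _; rewrite lee_fin powR_ge0.
have g20 v : (0 <= g2 v)%E by rewrite /g2 patchE; case: ifP => // _; rewrite lee_fin powR_ge0.
have mg1 : measurable_fun setT g1.
  apply: (proj1 (measurable_restrictT _ (measurable_itv _))).
  by apply: measurable_funTS; apply/measurable_EFinP; exact: measurable_powR.
have mg2 : measurable_fun setT g2.
  apply: (proj1 (measurable_restrictT _ (measurable_itv _))).
  by apply: measurable_funTS; apply/measurable_EFinP; exact: measurable_powR.
have bound v : (\int[mu]_u (F (u, v))%:E <= a1%:E * g1 v + a2%:E * g2 v)%E.
  have [v0|v0] := ltP 0 v; last first.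
    rewrite (_ : (\int[mu]_u _)%E = 0%E) ?adde_ge0 ?mule_ge0 ?lee_fin//.
    by apply: integral0_eq => u _; rewrite /F/= /pos_part (ltNge 0 v) v0/= if_same mulr0.
  have pv : 0 <= p v x by exact: p0.
  have -> : (\int[mu]_u (F (u, v))%:E =
      (p v x)%:E * \int[mu]_u (if u < v then g u else 0)%:E)%E.
    rewrite -ge0_integralZl; last 4 first.
    - exact: measurableT.
    - apply/measurable_EFinP; apply: measurable_fun_ifT => //.
        exact: measurable_fun_ltr.
      exact: measurable_power_weight.
    - by move=> u _; rewrite lee_fin; case: ifP => // _; exact: power_weight_ge0.
    - by rewrite lee_fin.
    apply: eq_integral => u _; rewrite /F/= /pos_part v0 -EFinM.
    by case: ifP => _; rewrite ?mulr0// mulrC.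
  apply: (@le_trans _ _ ((p v x)%:E * (v `^ beta / beta)%:E)%E).
    by rewrite lee_wpmul2l ?lee_fin// inner_le.
  rewrite -EFinM; have vb0 : 0 <= v `^ beta / beta by rewrite divr_ge0 ?powR_ge0// ltW.
  have [vT|vT] := leP v T.
    apply: (@le_trans _ _ (a1%:E * g1 v)%E); last by rewrite leeDl// mule_ge0 ?lee_fin.
    rewrite /g1 patchE mem_setE in_itv/= v0 vT -EFinM lee_fin addrK.
    have h := heat_density_le_unimodal Hnu aup0 Hlo Hup Psi_neq0 kappa0 km kN mN v0 x0.
    apply: le_trans (ler_wpM2r vb0 h) _.
    by rewrite /a1 -/r le_eqVlt; apply/orP; left; apply/eqP; rewrite -/V; ring.
  apply: (@le_trans _ _ (a2%:E * g2 v)%E); last by rewrite leeDr// mule_ge0 ?lee_fin.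
  rewrite /g2 patchE mem_setE in_itv/= (ltW vT)/= -EFinM lee_fin.
  have vP : 1 <= v * P by rewrite -ler_pdivrMr// div1r ltW.
  have h := heat_density_le_tail Hnu aup0 Hlo Hup Psi_neq0 kappa0 km kN mN v0 x0 vP.
  apply: le_trans (ler_wpM2r vb0 h) _.
  rewrite -/r -/P (powRM _ (ltW v0) (ltW P0)).
  have -> : v `^ (- c - 1) = v `^ (- kappa) * v `^ beta.
    rewrite -powRD; last by rewrite (gt_eqF v0) implybT.
    by congr (_ `^ _); rewrite /c; ring.
  by rewrite /a2 /c2 le_eqVlt; apply/orP; left; apply/eqP; ring.
rewrite E1; apply: (@le_trans _ _ (\int[mu]_v (a1%:E * g1 v + a2%:E * g2 v))%E).
  apply: ge0_le_integral => //.
  - by move=> v _; apply: integral_ge0 => u _; rewrite lee_fin.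
  - apply: (measurable_fun_fubini_tonelli_G (m1 := mu) (EFin \o F)).
      exact/measurable_EFinP.
    by move=> w; rewrite lee_fin.
  - by apply: emeasurable_funD; exact: emeasurable_funM.
rewrite ge0_integralD; last 5 first.
- exact: measurableT.
- by move=> v _; rewrite mule_ge0 ?lee_fin.
- exact: emeasurable_funM.
- by move=> v _; rewrite mule_ge0 ?lee_fin.
- exact: emeasurable_funM.
rewrite ge0_integralZl; [|exact: measurableT|exact: mg1|by []|by rewrite lee_fin].
rewrite ge0_integralZl; [|exact: measurableT|exact: mg2|by []|by rewrite lee_fin].
have i1 : (\int[mu]_v g1 v <= (T `^ (beta + 1) / (beta + 1))%:E)%E.
  by rewrite /g1 -integral_mkcond; exact: integral_powR_near0.
have i2 : (\int[mu]_v g2 v <= (T `^ (- c) / c)%:E)%E.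
  by rewrite /g2 -integral_mkcond; exact: integral_powR_infty.
apply: (@le_trans _ _ (a1%:E * (T `^ (beta + 1) / (beta + 1))%:E + a2%:E * (T `^ (- c) / c)%:E)%E).
  by apply: leeD; rewrite lee_wpmul2l ?lee_fin.
rewrite -!EFinM -EFinD lee_fin.
have TE s : T `^ s = P `^ (- s) by rewrite /T -powR_inv1 ?(ltW P0)// -powRrM mulN1r.
have h1 : P `^ (- (beta + 1)) = P `^ (- beta - 1) by congr (_ `^ _); ring.
have h2 : P `^ (- kappa) * P `^ c = P `^ (- beta - 1).
  rewrite -powRD; last by rewrite (gt_eqF P0) implybT.
  by congr (_ `^ _); rewrite /c; ring.
rewrite !TE opprK h1 /hardy -/r -/P -h2 /C /a1 /a2 h2.
rewrite (_ : c2 * r ^- n.+1 * P `^ (- kappa) / beta * (P `^ c / c) =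
  c2 * r ^- n.+1 / beta / c * (P `^ (- kappa) * P `^ c)); last by ring.
by rewrite h2 le_eqVlt; apply/orP; left; apply/eqP; ring.
Qed.

(** Only times of order [A T], with [T = 1 / psi (1/|x|)], are kept, where [p_v x] is at least
    [c |x|^-N]. The double integral [H] then has size [|x|^-N T^(beta + 1)], while the single
    integral [G] has one power of [T] less, that is, a factor [psi (1/|x|)] more. *)
Lemma potential_ge : exists c c' : R, [/\ 0 < c, 0 < c' &
  forall x, x <> zerov -> ((c * hardy x)%:E <= H x)%E /\
    ((c' * (psi (normv x)^-1 * hardy x))%:E <= G x)%E].
Proof.
have [A [c [A1 c0 low]]] := heat_density_lower Hnu alo0 aup0 Hlo Hup Psi_neq0 kappa0 km kN mN.
have A0 : 0 < A by apply: lt_le_trans A1.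
have two_b : 1 < 2 `^ beta :> R.
  have one : 1 `^ beta = 1 :> R by rewrite powR1.
  by rewrite -[ltLHS]one gt0_ltr_powR// ?nnegrE// ltr1n.
pose d1 := c * A `^ (beta + 1) * (1 - (2 `^ beta)^-1) / beta.
pose d2 := c * A `^ beta * (2 `^ beta - 1) / beta.
exists d1, d2; split.
- rewrite divr_gt0// !mulr_gt0 ?powR_gt0// subr_gt0 invf_lt1//.
- by rewrite divr_gt0// !mulr_gt0 ?powR_gt0// subr_gt0.
move=> x x0; have xn := normv_gt0 x0.
set r := normv x in xn; set P := psi r^-1.
have P0 : 0 < P by rewrite psi0// invr_gt0.
pose T := P^-1.
have T0 : 0 < T by rewrite invr_gt0.
have AT0 : 0 < A * T by rewrite mulr_gt0.
have AT2 : A * T < 2 * (A * T) by rewrite ltr_pMl// ltr1n.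
have rn0 : 0 <= r ^- n.+1 by rewrite invr_ge0 exprn_ge0// ltW.
have crn0 : 0 <= c * r ^- n.+1 by rewrite mulr_ge0// ltW.
have lowp v : A * T <= v -> v <= 2 * (A * T) -> c * r ^- n.+1 <= p v x.
  move=> v1 v2; apply: low => //; first exact: lt_le_trans v1.
    by rewrite -/r -/P -ler_pdivrMr.
  by rewrite -/r -/P -ler_pdivlMr// -mulrA.
have TE s : T `^ s = P `^ (- s) by rewrite /T -powR_inv1 ?(ltW P0)// -powRrM mulN1r.
have h1 : P `^ (- (beta + 1)) = P `^ (- beta - 1) by congr (_ `^ _); ring.
have bn0 : beta != 0 by rewrite gt_eqF.
split.
(* With [u] in [Z] and [v] in [Y] the condition [u < v] holds automatically, and [v] stays in the
   range of [lowp]. *)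
- pose Z := `[(A * T / 2), (A * T)]%classic.
  have tail u : u <= A * T -> ((c * r ^- n.+1 * (A * T))%:E <= tail_potential p u x)%E.
    move=> uAT.
    pose Y := `](A * T), (2 * (A * T))]%classic.
    have -> : (c * r ^- n.+1 * (A * T))%:E = (\int[mu]_(v in Y) (c * r ^- n.+1)%:E)%E.
      rewrite integral_cst /Y; last exact: measurable_itv.
      rewrite /= lebesgue_measure_itv/= lte_fin AT2 -EFinB -EFinM; congr EFin; ring.
    rewrite integral_mkcond; apply: ge0_le_integral => //.
    + by move=> v _; rewrite patchE; case: ifP => // _; rewrite lee_fin.
    + exact: (proj1 (measurable_restrictT _ (measurable_itv _))).
    + apply/measurable_EFinP; apply: measurable_fun_ifT;
        [exact: measurable_fun_ltr|exact: pp_x|by []].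
    + move=> v _; rewrite patchE mem_setE in_itv/=; case: ifP => [/andP[v1 v2]|_].
        rewrite (le_lt_trans uAT v1) /pos_part (lt_trans AT0 v1) lee_fin.
        by apply: lowp => //; exact: ltW.
      by rewrite lee_fin; case: ifP => // _; exact: pos_part_ge0.
  have AT20 : 0 < A * T / 2 by rewrite divr_gt0.
  have ATlt : A * T / 2 < A * T by rewrite ltr_pdivrMr// ltr_pMr// ltr1n.
  have -> : (d1 * hardy x)%:E =
      (\int[mu]_(u in Z) ((c * r ^- n.+1 * (A * T))%:E * (u `^ (beta - 1))%:E))%E.
    rewrite ge0_integralZl; last 4 first.
    - exact: measurable_itv.
    - by apply: measurable_funTS; apply/measurable_EFinP; exact: measurable_powR.
    - by move=> u _; rewrite lee_fin powR_ge0.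
    - by rewrite lee_fin mulr_ge0// ltW.
    rewrite /Z integral_powR_itv// -EFinM; congr EFin.
    rewrite (_ : A * T / 2 = A * T * 2 `^ (- 1)); last by rewrite powR_inv1.
    rewrite (powRM _ (ltW AT0) (powR_ge0 _ _)) -powRrM mulN1r (powRN 2).
    have e1 : (A * T) `^ beta * (A * T) = A `^ (beta + 1) * P `^ (- beta - 1).
      rewrite -h1 -TE -(powRM _ (ltW A0) (ltW T0)) mulrC.
      by have := mulr_powRB1 (ltW AT0) (addr_gt0 beta0 ltr01); rewrite addrK.
    rewrite /d1 /hardy -/r -/P.
    transitivity (c * r ^- n.+1 * ((A * T) `^ beta * (A * T)) * (1 - (2 `^ beta)^-1) / beta); last by ring.
    by rewrite e1; ring.
  rewrite integral_mkcond; apply: ge0_le_integral => //.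
  + move=> u _; rewrite patchE; case: ifP => // _.
    by rewrite mule_ge0 ?lee_fin ?powR_ge0// mulr_ge0// ltW.
  + apply: (proj1 (measurable_restrictT _ (measurable_itv _))).
    apply: measurable_funTS; apply: emeasurable_funM => //.
    by apply/measurable_EFinP; exact: measurable_powR.
  + apply: emeasurable_funM; first by apply/measurable_EFinP; exact: measurable_power_weight.
    exact: (@measurable_tail_potential _ _ _ measurable_heat_density _ _ id (cst x)).
  + move=> u _; rewrite patchE mem_setE in_itv/=; case: ifP => [/andP[u1 u2]|_]; last first.
      by rewrite mule_ge0 ?lee_fin ?power_weight_ge0// tail_potential_ge0.
    rewrite muleC /power_weight (lt_le_trans AT20 u1) lee_wpmul2l ?lee_fin ?powR_ge0//.
    exact: tail.
- pose Z := `[(A * T), (2 * (A * T))]%classic.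
  have -> : (d2 * (P * hardy x))%:E =
      (\int[mu]_(u in Z) ((c * r ^- n.+1)%:E * (u `^ (beta - 1))%:E))%E.
    rewrite ge0_integralZl; last 4 first.
    - exact: measurable_itv.
    - by apply: measurable_funTS; apply/measurable_EFinP; exact: measurable_powR.
    - by move=> u _; rewrite lee_fin powR_ge0.
    - by rewrite lee_fin.
    rewrite /Z integral_powR_itv// -EFinM; congr EFin.
    rewrite (powRM _ _ (ltW AT0))//.
    have e1 : (A * T) `^ beta = A `^ beta * (P * P `^ (- beta - 1)).
      rewrite (powRM _ (ltW A0) (ltW T0)) TE; congr (_ * _).
      rewrite -[X in X * _](powRr1 (ltW P0)) -powRD; last by rewrite (gt_eqF P0) implybT.
      by congr (_ `^ _); ring.
    rewrite /d2 /hardy -/r -/P e1; ring.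
  rewrite integral_mkcond; apply: ge0_le_integral => //.
  + move=> u _; rewrite patchE; case: ifP => // _.
    by rewrite mule_ge0 ?lee_fin ?powR_ge0.
  + apply: (proj1 (measurable_restrictT _ (measurable_itv _))).
    apply: measurable_funTS; apply: emeasurable_funM => //.
    by apply/measurable_EFinP; exact: measurable_powR.
  + apply/measurable_EFinP; apply: measurable_funM;
      [exact: measurable_power_weight|exact: pp_x].
  + move=> u _; rewrite patchE mem_setE in_itv/=; case: ifP => [/andP[u1 u2]|_]; last first.
      by rewrite lee_fin mulr_ge0 ?power_weight_ge0// pos_part_ge0.
    rewrite -EFinM lee_fin mulrC /power_weight /pos_part (lt_le_trans AT0 u1).
    by rewrite ler_wpM2l ?powR_ge0// lowp.
Qed.

Lemma radial_profile_ge0 r : 0 <= psi r.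
Proof. exact: (levy_exponent_ge0 nu). Qed.

Lemma radial_profile0 : psi 0 = 0.
Proof.
rewrite /radial_profile (_ : axisv 0 = zerov) ?(levy_exponent0 Hnu)//.
by apply: eq_from_tnth => i; rewrite !tnth_mktuple if_same.
Qed.

Lemma measurable_radial_profile : measurable_fun setT psi.
Proof.
rewrite /radial_profile; apply: (measurableT_comp (measurable_levy_exponent Hnu)).
apply: measurable_mktuple => i.
by case: (val i == 0%N).
Qed.

Lemma measurable_radial_profile_inv :
  measurable_fun setT (fun y : Rn R n.+1 => psi (normv y)^-1).
Proof.
apply: (measurableT_comp measurable_radial_profile).
rewrite (_ : (fun y => _) = fun y : Rn R n.+1 => normv y `^ (- 1)); last first.
  by apply/funext => y; rewrite powR_inv1// sqrtr_ge0.
apply: (measurableT_comp (f := fun a : R => a `^ (- 1))); last exact: measurable_normv_id.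
exact: measurable_powR.
Qed.

Lemma measurable_hardy : measurable_fun setT hardy.
Proof.
apply: measurable_funM.
  apply: (measurableT_comp (f := fun a : R => a `^ (- beta - 1))).
    exact: measurable_powR.
  exact: measurable_radial_profile_inv.
rewrite (_ : (fun y => _) = fun y : Rn R n.+1 => normv y `^ (- N)); last first.
  by apply/funext => y; rewrite powRN powR_mulrn// sqrtr_ge0.
apply: (measurableT_comp (f := fun a : R => a `^ (- N))); last exact: measurable_normv_id.
exact: measurable_powR.
Qed.

Lemma hardy_ge0 y : 0 <= hardy y.
Proof. by rewrite mulr_ge0 ?powR_ge0// invr_ge0 exprn_ge0// sqrtr_ge0. Qed.

(** A convention: the inverse of 0 is 0, [psi 0 = 0], and 0 to a nonzero power is 0. The lower
    comparison with [H] is thus trivial at the origin. *)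
Lemma hardy0 : hardy zerov = 0.
Proof.
rewrite /hardy normv0 invr0 radial_profile0 powR0 ?mul0r//.
by rewrite lt_eqF//; move: beta0; lra.
Qed.

Lemma heat_schrodinger_hardy_le : exists c1 c2 : R, [/\ 0 < c1, 0 < c2 &
  forall (t : R) x, 0 < t -> x <> zerov ->
    (\int[lam]_y (p t (subv y x) * hardy y)%:E <= (c1 * hardy x)%:E)%E /\
    (\int[lam]_y (schrodinger (fun t x y => p t (subv y x))
        (fun z => (c2 * psi (1 / normv z))%R) t x y * (hardy y)%:E)
      <= (c1 * hardy x)%:E)%E].
Proof.
have [C [C0 upper]] := potential_le.
have [c [c' [c0 c'0 lower]]] := potential_ge.
(* From [c h <= H <= C h] the passage through [H] costs [C / c]; from
   [G >= c' psi h >= (c' / C) psi H] comes the admissible size of [q]. *)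
exists (C / c), (c' / C); split; [exact: divr_gt0|exact: divr_gt0|].
pose q (z : Rn R n.+1) := c' / C * psi (1 / normv z).
have mp := measurable_heat_density.
have sg := heat_density_semigroup Hnu iP.
have mg := measurable_power_weight.
have g0 := power_weight_ge0; have gN := power_weight_le0.
have H0 y : (0 <= H y)%E by exact: potential_ge0.
have mH : measurable_fun setT H by exact: measurable_potential.
have mG : measurable_fun setT G by exact: measurable_density_potential.
have q0 z : 0 <= q z by rewrite mulr_ge0 ?radial_profile_ge0// ltW// divr_gt0.
have mq : measurable_fun setT q.
  apply: measurable_funM => //; under eq_fun do rewrite div1r.
  exact: measurable_radial_profile_inv.
have qH z : ((q z)%:E * H z <= G z)%E.
  (* At the origin [q] vanishes because [psi 0 = 0], so the product is 0 even if [H] is infinite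
     there. *)
  have [->|z0] := pselect (z = zerov).
    rewrite /q normv0 invr0 mulr0 radial_profile0 mulr0 mul0e.
    exact: density_potential_ge0.
  apply: le_trans (lower z z0).2.
  apply: le_trans (lee_wpmul2l _ (upper z z0)) _; first by rewrite lee_fin.
  rewrite -EFinM lee_fin /q div1r le_eqVlt; apply/orP; left; apply/eqP.
  by field; rewrite gt_eqF.
have hH y : ((hardy y)%:E <= (c^-1)%:E * H y)%E.
  have [->|y0] := pselect (y = zerov).
    by rewrite hardy0 mule_ge0 ?lee_fin// invr_ge0 ltW.
  apply: le_trans (lee_wpmul2l _ (lower y y0).1); last by rewrite lee_fin invr_ge0 ltW.
  by rewrite -EFinM lee_fin mulrA mulVf ?mul1r// gt_eqF.
pose pk t (x y : Rn R n.+1) := p t (subv y x).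
have pk0 t x y : 0 < t -> 0 <= pk t x y by exact: p0.
have mpk : measurable_fun setT (fun u : R * Rn R n.+1 * Rn R n.+1 => pk u.1.1 u.1.2 u.2).
  apply: (measurable_pt mp); first exact: measurableT_comp.
  by apply: measurable_subv; [exact: measurable_snd|exact: measurableT_comp].
have mpkx t x : measurable_fun setT (fun y => pk t x y).
  exact: (measurable_comp_kernel mpk (a := cst t) (b := cst x) (c := id)).
have mEpk t x : measurable_fun setT (fun y => (pk t x y)%:E).
  by apply/measurable_EFinP; exact: mpkx.
have mEq : measurable_fun setT (fun y => (q y)%:E) by apply/measurable_EFinP; exact: mq.
have super t x : 0 < t ->
    (\int[lam]_y ((pk t x y)%:E * H y) +
     \int[mu]_(s in `]0%R, t[) \int[lam]_z ((pk s x z)%:E * ((q z)%:E * H z)) <= H x)%E.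
  move=> t0; apply: le_trans (potential_supermedian mp p0 sg mg g0 gN x t0).
  rewrite leeD2l// integral_mkcond [leRHS]integral_mkcond; apply: ge0_le_integral => //.
  - move=> s _; rewrite patchE mem_setE in_itv/=; case: ifP => // /andP[s0 _].
    apply: integral_ge0 => z _.
    by rewrite !mule_ge0 ?lee_fin ?pk0.
  - apply: (proj1 (measurable_restrictT _ (measurable_itv _))); apply: measurable_funTS.
    apply: (@measurable_integral_param _ _ _ _ _ lam
      (fun w : R * Rn R n.+1 => (pk w.1 x w.2)%:E * ((q w.2)%:E * H w.2))%E).
    apply: emeasurable_funM.
      apply/measurable_EFinP; exact: (measurable_comp_kernel mpk (a := fst) (b := cst x) (c := snd)).
    apply: emeasurable_funM; last exact: measurableT_comp.
    by apply/measurable_EFinP; exact: measurableT_comp.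
  - apply: (proj1 (measurable_restrictT _ (measurable_itv _))); apply: measurable_funTS.
    apply: (@measurable_integral_param _ _ _ _ _ lam
      (fun w : R * Rn R n.+1 => (pk w.1 x w.2)%:E * G w.2)%E).
    apply: emeasurable_funM.
      apply/measurable_EFinP; exact: (measurable_comp_kernel mpk (a := fst) (b := cst x) (c := snd)).
    exact: (measurableT_comp mG).
  - move=> s _; rewrite !patchE mem_setE in_itv/=; case: ifP => // /andP[s0 _].
    apply: ge0_le_integral => //.
    + by move=> z _; rewrite !mule_ge0 ?lee_fin ?pk0.
    + exact: (emeasurable_funM (mEpk s x) (emeasurable_funM mEq mH)).
    + exact: (emeasurable_funM (mEpk s x) mG).
    + by move=> z _; rewrite lee_wpmul2l ?lee_fin ?pk0.
have cHx x : x <> zerov -> ((c^-1)%:E * H x <= (C / c * hardy x)%:E)%E.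
  move=> x0; apply: le_trans (lee_wpmul2l _ (upper x x0)) _.
    by rewrite lee_fin invr_ge0 ltW.
  by rewrite -EFinM mulrA (mulrC _ C).
move=> t x t0 x0; split; last first.
  apply: le_trans (cHx x x0).
  have ci : 0 <= c^-1 by rewrite invr_ge0 ltW.
  have := integral_schrodinger_le mpk pk0 mq q0 mH H0 super x measurable_hardy hardy_ge0 ci hH t0.
  exact.
apply: le_trans (cHx x x0).
(* For the unperturbed kernel the nonnegative time integral in [super] is simply discarded. *)
apply: (@le_trans _ _ ((c^-1)%:E * \int[lam]_y ((pk t x y)%:E * H y))%E); last first.
  rewrite lee_wpmul2l ?lee_fin ?invr_ge0 ?(ltW c0)//.
  apply: le_trans (super t x t0); rewrite leeDl//.
  apply: integral_ge0 => s; rewrite /= in_itv/= => /andP[s0 _]; apply: integral_ge0 => z _.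
  by rewrite !mule_ge0 ?lee_fin ?pk0.
rewrite -ge0_integralZl; last 4 first.
- exact: measurableT.
- exact: (emeasurable_funM (mEpk t x) mH).
- by move=> y _; rewrite mule_ge0 ?lee_fin ?pk0.
- by rewrite lee_fin invr_ge0 ltW.
apply: ge0_le_integral => //.
- by move=> y _; rewrite lee_fin mulr_ge0 ?pk0 ?hardy_ge0.
- apply/measurable_EFinP; apply: measurable_funM; [exact: mpkx|exact: measurable_hardy].
- apply: emeasurable_funM; first exact: measurable_cst.
  exact: (emeasurable_funM (mEpk t x) mH).
- by move=> y _; rewrite EFinM muleCA lee_wpmul2l ?lee_fin ?pk0.
Qed.

End potential_estimates.

Theorem mainTheorem14 (R : realType) (d : nat)
    (nu : {measure set (Rn R d) -> \bar R}) (nur : R -> R)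
    (alo aup clo cup : R) :
  infinite_isotropic_unimodal_levy nu nur ->
  let Psi := levy_exponent nu in
  let psi := radial_profile Psi in
  0 < alo -> alo <= aup -> aup < 2 ->
  (exists xi, Psi xi <> 0) ->
  WLSC alo clo psi -> WUSC aup cup psi ->
  aup < d%:R ->
  let p (t : R) (x y : Rn R d) := heat_density Psi t (subv y x) in
  forall beta : R, 0 < beta -> beta < (d%:R - aup) / aup ->
  let h (y : Rn R d) :=
    psi (normv y)^-1 `^ (- beta - 1) * (normv y) ^- d in
  exists c1 c2 : R, [/\ 0 < c1, 0 < c2 &
    let q (z : Rn R d) := c2 * psi (1 / normv z) in
    forall (t : R) (x : Rn R d), 0 < t -> x <> zerov ->
      (\int[lebesgue_Rn R d]_y (p t x y * h y)%:E <= (c1 * h x)%:E)%E /\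
      (\int[lebesgue_Rn R d]_y (schrodinger p q t x y * (h y)%:E)
         <= (c1 * h x)%:E)%E].
Proof.
move=> Hnu Psi psi alo0 loup aup2 Psi0 Hlo Hup aupd p beta beta0 betad h.
have aup0 : 0 < aup by exact: lt_le_trans loup.
(* Dimension 0 contradicts [0 < aup < d]. *)
case: d nu Hnu @Psi @psi Psi0 Hlo Hup aupd @p betad @h => [|n] nu Hnu Psi psi
  Psi0 Hlo Hup aupd p betad h; first by move: aupd; rewrite ltNge ltW.
exact: (heat_schrodinger_hardy_le Hnu alo0 aup0 Hlo Hup Psi0 beta0 betad).
Qed.
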